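(* Let $k,n\ge 1$ be integers, let $z_1,\dots,z_n$ be distinct nonzero points of the open unit disk $\mathbb D$, and let $W_1,\dots,W_n\in\mathbb C^{k\times k}$. There exists a function $S\in(\mathcal S_1)^{k\times k}$ with $S(z_j)=W_j$ for $j=1,\dots,n$ if and only if for all integers $\ell,\ell'$ with $1\le\ell\le\ell'\le k$, for each pair $(\alpha,\beta)\in\mathbb G(\ell'\times\ell)$, and for all $n$-tuples $(X_1,\dots,X_n)$ of $k\times\ell$ complex matrices, $$\sum_{i,j=1}^{n}\operatorname{trace}\left[X_jK^{\alpha,\beta}(z_i,z_j)X_i^*-W_j^*X_jK^{\alpha,\beta}(z_i,z_j)X_i^*W_i\right]\ge 0 .$$
   Context: $\mathbb D=\{\lambda\in\mathbb C:|\lambda|<1\}$. $(\mathcal S_1)^{k\times k}$ is the set of bounded holomorphic $k\times k$ matrix-valued functions $S$ on $\mathbb D$ with $\|S\|_\infty=\sup_{z\in\mathbb D}\|S(z)\|\le 1$ (operator norm) and $S'(0)=0$. For integers $1\le\ell\le\ell'\le k$, $\mathbb G(\ell'\times\ell)$ is the set of pairs $(\alpha,\beta)$ of complex $\ell'\times\ell$ matrices such that $\alpha\alpha^*+\beta\beta^*=I_{\ell'}$ and $\alpha$ is injective ($\ker\alpha=\{0\}$). For $(\alpha,\beta)\in\mathbb G(\ell'\times\ell)$, the $\mathbb C^{\ell\times\ell}$-valued kernel $K^{\alpha,\beta}$ on $\mathbb D\times\mathbb D$ is $$K^{\alpha,\beta}(z,w)=(\alpha^*+\overline w\beta^* )(\alpha+z\beta)+\frac{\overline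 w^{2}z^{2}}{1-\overline w z}I_\ell .$$ *)

(* Defs.v *)
From mathcomp Require Import all_boot all_order all_algebra.
From mathcomp Require Import all_classical all_reals all_analysis.
From mathcomp Require Import complex.

Set Implicit Arguments.
Unset Strict Implicit.
Unset Printing Implicit Defensive.

Import Order.TTheory GRing.Theory Num.Theory.
Import numFieldNormedType.Exports.

Local Open Scope classical_set_scope.
Local Open Scope ring_scope.
Local Open Scope sesquilinear_scope.

(* R[i] is declared here at numClosedFieldType because the topology and norm
   of a numFieldType are not inferred on the bare type R[i].  In particular
   [derivable] and [derive1] below are complex differentiation, and
   [0 <= z] for z : Cplx R means that z is real and nonnegative. *)
Definition Cplx (R : realType) : numClosedFieldType := R[i].

Definition unit_disk (R : realType) : set (Cplx R) := [set z | `|z| < 1].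

(* Euclidean norm on C^m; [Normc.normc] is the R-valued modulus, whereas
   [`|z|] lives in the complex field itself. *)
Definition enorm (R : realType) (m : nat) (v : 'cV[Cplx R]_m) : R :=
  Num.sqrt (\sum_(i < m) Normc.normc (v i 0) ^+ 2).

Definition opnorm (R : realType) (m p : nat) (A : 'M[Cplx R]_(m, p)) : R :=
  sup [set enorm (A *m v) | v in [set v : 'cV[Cplx R]_p | enorm v <= 1]].

(* Extended-real supremum: it is +oo when S is unbounded on the disk, so that
   [supnorm S <= 1] includes boundedness. *)
Definition supnorm (R : realType) (k : nat) (S : Cplx R -> 'M[Cplx R]_k) :
    \bar R :=
  ereal_sup [set (opnorm (S z))%:E | z in @unit_disk R].

(* Functions on the disk are represented by total functions whose values off
   the disk are irrelevant. *)
Definition holo_disk (R : realType) (k : nat)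
    (S : Cplx R -> 'M[Cplx R]_k) : Prop :=
  forall z, unit_disk z -> derivable S z 1.

Definition schur1 (R : realType) (k : nat) : set (Cplx R -> 'M[Cplx R]_k) :=
  [set S | [/\ holo_disk S, (supnorm S <= 1)%E & derive1 S 0 = 0]].

Definition GG (R : realType) (l' l : nat) :
    set ('M[Cplx R]_(l', l) * 'M[Cplx R]_(l', l)) :=
  [set ab | ab.1 *m ab.1^t* + ab.2 *m ab.2^t* = 1%:M
         /\ forall v : 'cV[Cplx R]_l, ab.1 *m v = 0 -> v = 0].

Definition Kab (R : realType) (l' l : nat) (alpha beta : 'M[Cplx R]_(l', l))
    (z w : Cplx R) : 'M[Cplx R]_l :=
  (alpha^t* + w^* *: beta^t*) *m (alpha + z *: beta)
  + (w^* ^+ 2 * z ^+ 2 / (1 - w^* * z))%:M.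

(* Main.v *)
(* Let M be the span, tensored with C^k, of the vectors (1, z_i, z_i^2, ...) and of the first two
   unit vectors of l^2.  A constrained interpolant exists exactly when, for some matrix S0, the
   operator R(S0) on M that multiplies the coefficients on the right by W_i at z_i and by S0 at
   both unit vectors is a contraction: S0 is the free value S(0), and using it twice encodes
   S'(0) = 0.

   If S is an interpolant, the means of |u S - y|^2 over the circles |w| = r are nonnegative;
   Cauchy's formulas for S and S'(0) evaluate them, and r -> 1 shows that R(S(0)) is a
   contraction.  Applying it to vectors whose components at the unit vectors are adapted to
   (alpha, beta) gives the kernel inequalities.

   Conversely, if no R(S0) is a contraction, convex duality yields a pair (u, v) orthogonal to
   all variations of S0 with 2 Re <u R, v> > |u|^2 + |v|^2.  The backward shift B commutes with R,
   so an extremal argument allows to assume that the constant term v0 = v eps of v has full row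
   rank; then the column space of (v0, v1), where v1 = v B eps, is that of (alpha, beta)^* for
   some (alpha, beta) in G, whose kernel inequality contradicts the choice of (u, v).  Finally a
   contraction R(S0) is realized by a contractive colligation, whose transfer function is a
   rational interpolant. *)

(* Operators act on row vectors from the right, and the infinite series behind the model space enter
   only through the finite Gram matrix of the frame. The nodes must be distinct and nonzero for this
   matrix to be definite: a node at 0 would repeat the first unit vector.

   Duality yields a pair (u, v) with 2 m rows, whereas a kernel inequality is available only for 1
   <= l <= l' <= k and injective alpha. The extremal argument closes this gap: once every row
   relation of v0 is a relation of v, dependent rows can be compressed away without loss. The
   remaining rows of v0 are independent, hence at most k in number, and v0 = alpha^* y forces alpha
   to be injective.

   In the other direction S is only assumed complex differentiable at each point, without continuity
   of the derivative. Cauchy's formulas are therefore derived by a Goursat bisection. It is carried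
   out on dyadic trapezoidal sums instead of integrals; on a circle these sums are multiples of
   plain averages over the 2^n-th roots of unity. *)
Require Import Defs.
From HB Require Import structures.
From mathcomp Require Import all_boot all_order all_algebra.
From mathcomp Require Import all_classical all_reals all_analysis.
From mathcomp Require Import complex ring lra.

Set Implicit Arguments.
Unset Strict Implicit.
Unset Printing Implicit Defensive.

Import Order.TTheory GRing.Theory Num.Theory.
Import numFieldNormedType.Exports.

Local Open Scope classical_set_scope.
Local Open Scope ring_scope.
Local Open Scope sesquilinear_scope.

(** * Frobenius norms and positive semidefinite matrices *)

(* Locked, so that rewriting with the adjoint lemmas does not reach inside. *)
HB.lock Definition fsq (C : numClosedFieldType) m n (A : 'M[C]_(m, n)) : C :=
  \tr (A *m A^t*).

Section Adjoint.
Variable C : numClosedFieldType.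
Implicit Types m n p : nat.

Lemma adjmxM m n p (A : 'M[C]_(m, n)) (B : 'M[C]_(n, p)) :
  (A *m B)^t* = B^t* *m A^t*.
Proof. by rewrite trmx_mul map_mxM. Qed.

Lemma adjmxD m n (A B : 'M[C]_(m, n)) : (A + B)^t* = A^t* + B^t*.
Proof. by rewrite linearD map_mxD. Qed.

Lemma adjmxN m n (A : 'M[C]_(m, n)) : (- A)^t* = - A^t*.
Proof. by rewrite linearN map_mxN. Qed.

Lemma adjmxB m n (A B : 'M[C]_(m, n)) : (A - B)^t* = A^t* - B^t*.
Proof. by rewrite adjmxD adjmxN. Qed.

Lemma adjmxZ m n a (A : 'M[C]_(m, n)) : (a *: A)^t* = a^* *: A^t*.
Proof. by rewrite linearZ map_mxZ. Qed.

Lemma adjmx0 m n : (0 : 'M[C]_(m, n))^t* = 0.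
Proof. by rewrite trmx0 map_mx0. Qed.

Lemma adjmx1 n : (1%:M : 'M[C]_n)^t* = 1%:M.
Proof. by rewrite trmx1 map_mx1. Qed.

Lemma adjmx_sum (I : finType) m n (F : I -> 'M[C]_(m, n)) :
  (\sum_i F i)^t* = \sum_i (F i)^t*.
Proof. by apply: (big_morph (fun A : 'M[C]_(m, n) => A^t*)); [exact: adjmxD|exact: adjmx0]. Qed.

Lemma mxtrace_adj n (A : 'M[C]_n) : \tr (A^t*) = (\tr A)^*.
Proof. by rewrite trace_map_mx mxtrace_tr. Qed.

Lemma fsqT m n (A : 'M[C]_(m, n)) : fsq A = \tr (A *m A^t*).
Proof. by rewrite fsq.unlock. Qed.

Lemma fsqE m n (A : 'M[C]_(m, n)) : fsq A = \sum_i \sum_j `|A i j| ^+ 2.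
Proof.
rewrite fsqT /mxtrace; apply: eq_bigr => i _; rewrite mxE.
by apply: eq_bigr => j _; rewrite !mxE normCK.
Qed.

Lemma fsq_ge0 m n (A : 'M[C]_(m, n)) : 0 <= fsq A.
Proof.
by rewrite fsqE; apply: sumr_ge0 => i _; apply: sumr_ge0 => j _; rewrite exprn_ge0.
Qed.

Lemma fsq_eq0 m n (A : 'M[C]_(m, n)) : fsq A = 0 -> A = 0.
Proof.
rewrite fsqE => /eqP; rewrite psumr_eq0; last first.
  by move=> i _; apply: sumr_ge0 => j _; rewrite exprn_ge0.
move=> /allP H; apply/matrixP => i j; have /(_ i) := H.
rewrite mem_index_enum => /(_ isT) /=; rewrite psumr_eq0 => [|? _]; last by rewrite exprn_ge0.
move=> /allP /(_ j); rewrite mem_index_enum => /(_ isT) /=.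
by rewrite sqrf_eq0 normr_eq0 mxE => /eqP.
Qed.

Lemma fsq_adj m n (A : 'M[C]_(m, n)) : fsq (A^t*) = fsq A.
Proof. by rewrite !fsqT trmxCK mxtrace_mulC. Qed.

Lemma fsq_row n (w : 'rV[C]_n) : fsq w = (w *m w^t*) 0 0.
Proof. by rewrite fsqT /mxtrace big_ord1. Qed.

Lemma fsqB m n (A B : 'M[C]_(m, n)) :
  fsq (A - B) = fsq A + fsq B - \tr (A *m B^t*) - (\tr (A *m B^t*))^*.
Proof.
rewrite !fsqT adjmxB mulmxBl !mulmxBr -mxtrace_adj adjmxM trmxCK !linearB /=.
by ring.
Qed.

Lemma fsqN m n (A : 'M[C]_(m, n)) : fsq (- A) = fsq A.
Proof. by rewrite !fsqT adjmxN mulmxN mulNmx opprK. Qed.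

Lemma fsqD m n (A B : 'M[C]_(m, n)) :
  fsq (A + B) = fsq A + fsq B + \tr (A *m B^t*) + (\tr (A *m B^t*))^*.
Proof.
by rewrite -{1}[B]opprK fsqB fsqN adjmxN mulmxN raddfN /= rmorphN /= !opprK.
Qed.

Lemma fsqZ m n a (A : 'M[C]_(m, n)) : fsq (a *: A) = `|a| ^+ 2 * fsq A.
Proof. by rewrite !fsqT adjmxZ -scalemxAl -scalemxAr scalerA linearZ normCK. Qed.

Lemma fsq_real m n (A : 'M[C]_(m, n)) : (fsq A)^* = fsq A.
Proof. by rewrite !fsqT -mxtrace_adj adjmxM trmxCK. Qed.

Definition psd n (P : 'M[C]_n) : Prop :=
  P^t* = P /\ forall w : 'rV[C]_n, 0 <= (w *m P *m w^t*) 0 0.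

Lemma psd_gram n p (T : 'M[C]_(n, p)) : psd (T *m T^t*).
Proof.
split=> [|w]; first by rewrite adjmxM trmxCK.
by rewrite !mulmxA -mulmxA -adjmxM -fsq_row fsq_ge0.
Qed.

(** By the spectral theorem: the eigenvalues are the values of the form at the rows of the spectral
    matrix, hence nonnegative, and T carries their square roots. *)
Lemma psd_fact n (P : 'M[C]_n) : psd P -> exists T : 'M[C]_n, P = T *m T^t*.
Proof.
move=> [hP pP].
have nP : P \is normalmx by apply/normalmxP; rewrite hP.
have := @orthomx_spectralP _ _ P; move=> /elimT /(_ nP).
set V := spectralmx P; set d := spectral_diag P => PE.
have uV : V \is unitarymx := spectral_unitarymx P.
rewrite (invmx_unitary uV) in PE.
have VV : V *m V^t* = 1%:M by apply/unitarymxP.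
have d0 i : 0 <= d 0 i.
  have := pP (row i V); rewrite PE !mulmxA -row_mul VV row1 -rowE row_diag_mx -mulmxA.
  have -> : V *m (row i V)^t* = col i 1%:M.
    rewrite -VV; apply/colP => j; rewrite !mxE; apply: eq_bigr => l _; by rewrite !mxE.
  by rewrite -scalemxAl -rowE !mxE !eqxx mulr1.
exists (V^t* *m diag_mx (map_mx sqrtC d)).
rewrite adjmxM trmxCK PE !mulmxA; congr (_ *m _); rewrite -!mulmxA; congr (_ *m _).
rewrite tr_diag_mx map_diag_mx.
rewrite mulmx_diag; congr diag_mx; apply/rowP => i.
transitivity (sqrtC (d 0 i) * (sqrtC (d 0 i))^*); last by rewrite !mxE.
by rewrite geC0_conj ?sqrtC_ge0 // -expr2 sqrtCK.
Qed.

Lemma psd_tr n p (P : 'M[C]_n) (X : 'M[C]_(p, n)) : psd P -> 0 <= \tr (X *m P *m X^t*).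
Proof.
move=> /psd_fact[T ->]; rewrite !mulmxA -mulmxA -adjmxM -fsqT; exact: fsq_ge0.
Qed.

Lemma psd_contr n p (M : 'M[C]_(n, p)) : psd (1%:M - M *m M^t*) ->
  forall q (X : 'M[C]_(q, n)), fsq (X *m M) <= fsq X.
Proof.
move=> h q X; have := psd_tr X h; rewrite mulmxBr mulmxBl raddfB /= mulmx1 subr_ge0.
by rewrite !fsqT adjmxM !mulmxA.
Qed.

Lemma contr_psd n p (M : 'M[C]_(n, p)) :
  (forall w : 'rV_n, fsq (w *m M) <= fsq w) -> psd (1%:M - M *m M^t*).
Proof.
move=> h; split=> [|w]; first by rewrite adjmxB adjmx1 adjmxM trmxCK.
rewrite mulmxBr mulmxBl mulmx1 mxE [X in _ + X]mxE subr_ge0.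
by have := h w; rewrite !fsq_row adjmxM !mulmxA.
Qed.

(** The Moore-Penrose inverse: eigenvalues are inverted, and the convention 0^-1 = 0 takes care of
    the kernel. *)
Lemma hermitian_pinv n (P : 'M[C]_n) : P^t* = P ->
  exists Q : 'M[C]_n, [/\ Q^t* = Q, P *m Q *m P = P & Q *m P *m Q = Q].
Proof.
move=> hP.
have nP : P \is normalmx by apply/normalmxP; rewrite hP.
have := @orthomx_spectralP _ _ P; move=> /elimT /(_ nP).
set V := spectralmx P; set d := spectral_diag P => PE.
have uV : V \is unitarymx := spectral_unitarymx P.
clearbody V d.
rewrite (invmx_unitary uV) in PE.
have VV : V *m V^t* = 1%:M by apply/unitarymxP.
pose e : 'rV[C]_n := \row_i (d 0 i)^-1.
have comp (a b : 'rV[C]_n) : (V^t* *m diag_mx a *m V) *m (V^t* *m diag_mx b *m V)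
    = V^t* *m diag_mx (\row_i (a 0 i * b 0 i)) *m V.
  rewrite !mulmxA -(mulmxA _ V) VV mulmx1; congr (_ *m _).
  by rewrite -!mulmxA mulmx_diag.
have dreal : map_mx (@Num.conj C) d = d.
  have : (diag_mx d)^t* = diag_mx d.
    have -> : diag_mx d = V *m P *m V^t*.
      by rewrite PE !mulmxA VV mul1mx -mulmxA VV mulmx1.
    by rewrite !adjmxM trmxCK hP mulmxA.
  rewrite tr_diag_mx map_diag_mx => /matrixP h.
  by apply/rowP => i; have := h i i; rewrite !mxE eqxx !mulr1n.
have ereal : map_mx (@Num.conj C) e = e.
  apply/rowP => i; rewrite !mxE fmorphV; congr (_^-1).
  by have /rowP/(_ i) := dreal; rewrite !mxE.
exists (V^t* *m diag_mx e *m V); split.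
- by rewrite !adjmxM trmxCK tr_diag_mx map_diag_mx ereal mulmxA.
- rewrite PE !comp; congr (_ *m diag_mx _ *m _); apply/rowP => i; rewrite !mxE.
  by case: (eqVneq (d 0 i) 0) => [->|h]; rewrite ?mulr0 ?mulfV ?mul1r.
- rewrite PE !comp; congr (_ *m diag_mx _ *m _); apply/rowP => i; rewrite !mxE.
  by case: (eqVneq (d 0 i) 0) => [->|h]; rewrite ?invr0 ?mulr0 // mulVf // mul1r.
Qed.

(* Douglas' factorization lemma. *)
Lemma gram_eq_factor n p q (X : 'M[C]_(n, p)) (Y : 'M[C]_(n, q)) :
  X *m X^t* = Y *m Y^t* ->
  exists2 M : 'M[C]_(p, q), X *m M = Y & psd (1%:M - M *m M^t*).
Proof.
move=> XY; have [hP _] := psd_gram Y.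
have [Q [hQ PQP QPQ]] := hermitian_pinv hP.
exists (X^t* *m Q *m Y).
  (* With P = Y Y^*, the Gram matrix of P Q Y - Y contains the factor P Q P - P = 0. *)
  rewrite !mulmxA XY; apply/eqP; rewrite -subr_eq0; apply/eqP; apply: fsq_eq0.
  have -> : Y *m Y^t* *m Q *m Y - Y = (Y *m Y^t* *m Q - 1%:M) *m Y.
    by rewrite mulmxBl mul1mx.
  rewrite !fsqT adjmxM !mulmxA -(mulmxA _ Y) mulmxBl PQP mul1mx subrr mul0mx.
  by rewrite mxtrace0.
(* E is M M^*, the orthogonal projection onto the row space of X, so 1 - E is itself a Gram
   matrix. *)
pose E := X^t* *m Q *m X.
have -> : X^t* *m Q *m Y *m (X^t* *m Q *m Y)^t* = E.
  by rewrite !adjmxM trmxCK hQ /E -[in RHS]QPQ !mulmxA.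
have EE : E *m E = E.
  by rewrite /E -[in RHS]QPQ -XY !mulmxA.
have hE : E^t* = E by rewrite /E !adjmxM trmxCK hQ mulmxA.
have -> : 1%:M - E = (1%:M - E) *m (1%:M - E)^t*.
  by rewrite adjmxB adjmx1 hE mulmxBl mul1mx mulmxBr mulmx1 EE subrr subr0.
exact: psd_gram.
Qed.

End Adjoint.

(** * Realization of contractive transfer functions *)

Section Realization.
Variable C : numClosedFieldType.
Implicit Types m n p k : nat.

Lemma fsq0 m n : fsq (0 : 'M[C]_(m, n)) = 0.
Proof. by rewrite !fsqT mul0mx mxtrace0. Qed.

Lemma adj_row_mx m n p (A : 'M[C]_(m, n)) (B : 'M[C]_(m, p)) :
  (row_mx A B)^t* = col_mx (A^t*) (B^t*).
Proof. by rewrite tr_row_mx map_col_mx. Qed.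

Lemma fsq_row_mx m n p (A : 'M[C]_(m, n)) (B : 'M[C]_(m, p)) :
  fsq (row_mx A B) = fsq A + fsq B.
Proof. by rewrite !fsqT adj_row_mx mul_row_col linearD. Qed.

(* Lurking isometry: with [1 - R R^* = G G^*], the block rows [B G, eps] and
   [G, R eps] have the same Gram matrix. *)
Lemma realization_colligation m k (B R : 'M[C]_m) (eps : 'M[C]_(m, k)) :
  1%:M - B *m B^t* = eps *m eps^t* -> R *m B = B *m R -> psd (1%:M - R *m R^t*) ->
  exists (G A : 'M[C]_m) (b : 'M[C]_(m, k)) (c : 'M[C]_(k, m)) (d : 'M[C]_k),
    [/\ B *m G *m A + eps *m c = G, B *m G *m b + eps *m d = R *m eps &
        psd (1%:M - block_mx A b c d *m (block_mx A b c d)^t*)].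
Proof.
move=> stein RB /psd_fact[G GE].
have [M XM pM] : exists2 M : 'M[C]_(m + k),
    row_mx (B *m G) eps *m M = row_mx G (R *m eps) & psd (1%:M - M *m M^t*).
  (* Both Gram matrices equal 1 - R B B^* R^*, by the Stein identity and the commutation of R with
     B. *)
  apply: gram_eq_factor; rewrite !adj_row_mx !mul_row_col !adjmxM.
  rewrite !mulmxA -(mulmxA B) -GE -[R *m eps *m _]mulmxA -stein.
  rewrite !mulmxBr !mulmxBl !mulmx1 !mulmxA -RB.
  have -> : R *m B *m R^t* *m B^t* = R *m B *m B^t* *m R^t*.
    by rewrite -mulmxA -adjmxM -RB adjmxM !mulmxA.
  rewrite !addrA; apply/eqP; rewrite subr_eq addrC addrA; apply/eqP.
  by rewrite subrK addrAC.
exists G, (ulsubmx M), (ursubmx M), (dlsubmx M), (drsubmx M).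
rewrite submxK; move: XM; rewrite -{1}[M]submxK mul_row_block.
by move=> /eq_row_mx[].
Qed.

Definition transfer m k (A : 'M[C]_m) (b : 'M[C]_(m, k)) (c : 'M[C]_(k, m))
    (d : 'M[C]_k) (z : C) : 'M[C]_k :=
  d + z *: (c *m invmx (1%:M - z *: A) *m b).

Section Transfer.
Variables (m k : nat) (A : 'M[C]_m) (b : 'M[C]_(m, k)) (c : 'M[C]_(k, m)).
Variable (d : 'M[C]_k).
Hypothesis contr : psd (1%:M - block_mx A b c d *m (block_mx A b c d)^t*).

Let colligation_le p (v : 'M[C]_(p, m)) (w : 'M[C]_(p, k)) :
  fsq (v *m A + w *m c) + fsq (v *m b + w *m d) <= fsq v + fsq w.
Proof.
by rewrite -!fsq_row_mx -mul_row_block; exact: psd_contr contr _ _.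
Qed.

(** A is a contraction, being a corner of the colligation, so v = z v A gives |v| <= |z| |v| and
    hence v = 0. *)
Lemma resolvent_unit (z : C) : `|z| < 1 -> 1%:M - z *: A \in unitmx.
Proof.
move=> z1; rewrite -row_free_unit -kermx_eq0; apply/rowV0P => v /sub_kermxP.
rewrite mulmxBr mulmx1 -scalemxAr => /eqP; rewrite subr_eq0 => /eqP vE.
have h : fsq (v *m A) <= fsq v.
  have := colligation_le v 0; rewrite !mul0mx !addr0 fsq0 addr0.
  by apply: le_trans; rewrite lerDl fsq_ge0.
apply: fsq_eq0; apply/eqP; rewrite -[_ == _]negbK; apply/negP => v0.
have vp : 0 < fsq v by rewrite lt_def v0 fsq_ge0.
have : fsq v < fsq v.
  rewrite {1}vE fsqZ; apply: le_lt_trans (_ : `|z| ^+ 2 * fsq v < _).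
    by rewrite ler_wpM2l // exprn_ge0.
  by rewrite gtr_pMl // exprn_ilt1.
by rewrite ltxx.
Qed.

(** Energy balance: the colligation sends the state and input (z v, w) to the state and output (v, w
    S(z)), and |z v| <= |v|. *)
Lemma transfer_contr (z : C) : `|z| < 1 ->
  forall p (w : 'M[C]_(p, k)), fsq (w *m transfer A b c d z) <= fsq w.
Proof.
move=> z1 p w; have U := resolvent_unit z1.
pose v := w *m c *m invmx (1%:M - z *: A).
have vE : (z *: v) *m A + w *m c = v.
  have : v *m (1%:M - z *: A) = w *m c by rewrite /v mulmxKV.
  by rewrite mulmxBr mulmx1 -scalemxAr -scalemxAl => <-; rewrite addrC subrK.
have := colligation_le (z *: v) w; rewrite vE.
have -> : (z *: v) *m b + w *m d = w *m transfer A b c d z.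
  by rewrite /transfer mulmxDr addrC -scalemxAr -scalemxAl /v !mulmxA.
move=> h; have : fsq v + fsq (w *m transfer A b c d z) <= fsq v + fsq w.
  apply: le_trans h _; rewrite lerD2r fsqZ.
  by apply: ler_piMl; rewrite ?fsq_ge0 // exprn_ile1 // ltW.
by rewrite lerD2l.
Qed.

(** A left eigenvector e of B with eigenvalue z turns the realization identities into e G (1 - z A)
    = c and z e G b + d = e R eps. *)
Lemma transfer_interp (B R G : 'M[C]_m) (eps : 'M[C]_(m, k)) (e : 'M[C]_(k, m)) (z : C) :
  B *m G *m A + eps *m c = G -> B *m G *m b + eps *m d = R *m eps ->
  `|z| < 1 -> e *m B = z *: e -> e *m eps = 1%:M ->
  transfer A b c d z = e *m R *m eps.
Proof.
move=> h1 h2 z1 eB ee; have U := resolvent_unit z1.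
have : e *m G *m (1%:M - z *: A) = c.
  rewrite mulmxBr mulmx1 -{1}h1 mulmxDr !mulmxA eB ee mul1mx.
  by rewrite -!scalemxAr -!scalemxAl addrAC subrr add0r.
move=> cE; rewrite /transfer -{1}cE mulmxK // -[e *m R *m _]mulmxA -h2 mulmxDr !mulmxA eB ee mul1mx.
by rewrite -!scalemxAl addrC.
Qed.

(** The matrix c b is the derivative of the transfer function at 0. The chain e1, e0, 0 under B
    gives c = e0 G and e1 R eps = e0 G b. *)
Lemma transfer_moment (B R G : 'M[C]_m) (eps : 'M[C]_(m, k)) (e0 e1 : 'M[C]_(k, m)) :
  B *m G *m A + eps *m c = G -> B *m G *m b + eps *m d = R *m eps ->
  e0 *m B = 0 -> e0 *m eps = 1%:M -> e1 *m B = e0 -> e1 *m eps = 0 ->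
  e1 *m R *m eps = 0 -> c *m b = 0.
Proof.
move=> h1 h2 e0B e0e e1B e1e <-.
have <- : e0 *m G = c by rewrite -h1 mulmxDr !mulmxA e0B e0e !mul0mx mul1mx add0r.
by rewrite -[e1 *m R *m _]mulmxA -h2 mulmxDr !mulmxA e1B e1e mul0mx addr0.
Qed.

End Transfer.
End Realization.

(** * Frames for the model space *)

Section Frames.
Variable C : numClosedFieldType.

(* Gram matrix of the vectors [(1, z_i, z_i ^ 2, ...)], indexed by [inl i], and of the first
   two unit vectors of l^2, indexed by [inr false] and [inr true]. *)
Definition gram n (z : 'I_n -> C) (p q : 'I_n + bool) : C :=
  match p, q with
  | inl i, inl j => (1 - z i * (z j)^*)^-1
  | inl i, inr b => if b then z i else 1
  | inr b, inl j => if b then (z j)^* else 1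
  | inr b, inr b' => (b == b')%:R
  end.

(* The l^2 vectors enter only through their Gram matrix: [e p] is the p-th one, tensored with
   [C^k] and written in coordinates of their span; [f] is the dual family. *)
Definition frame n k m (z : 'I_n -> C) (e : 'I_n + bool -> 'M[C]_(k, m))
    (f : 'I_n + bool -> 'M[C]_(m, k)) : Prop :=
  [/\ forall p q, e p *m f q = (p == q)%:R%:M,
      \sum_p f p *m e p = 1%:M &
      forall p q, e p *m (e q)^t* = (gram z p q)%:M].

Lemma adjmx_inj m n (A B : 'M[C]_(m, n)) : A^t* = B^t* -> A = B.
Proof. by move=> h; rewrite -[A]trmxCK h trmxCK. Qed.

Lemma fsq_adj_mul m n (A : 'M[C]_(m, n)) : fsq A = \tr (A^t* *m A).
Proof. by rewrite fsqT mxtrace_mulC. Qed.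

Lemma fsq_sum (I : finType) m n (x : I -> 'M[C]_(m, n)) :
  fsq (\sum_i x i) = \sum_i \sum_j \tr (x i *m (x j)^t*).
Proof.
rewrite !fsqT adjmx_sum mulmx_suml linear_sum /=; apply: eq_bigr => i _.
by rewrite mulmx_sumr linear_sum.
Qed.

(** Gram-Schmidt on a basis of the row space of M; [Z^t* *m Z] is then the orthogonal projection
    onto that space. *)
Lemma coisometry_basis p q (M : 'M[C]_(p, q)) :
  exists2 Z : 'M[C]_(\rank M, q), Z *m Z^t* = 1%:M &
    M *m Z^t* *m Z = M /\ exists Y, Z = Y *m M.
Proof.
pose Z := schmidt (row_base M).
have uZ : Z *m Z^t* = 1%:M.
  by apply/unitarymxP; apply: schmidt_unitarymx; rewrite rank_leq_col.
have ZE : (Z :=: M)%MS.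
  exact: eqmx_trans (eqmx_schmidt_free (row_base_free M)) (eq_row_base M).
exists Z => //; split.
  have /submxP[D DE] : (M <= Z)%MS by rewrite ZE.
  transitivity (D *m Z *m Z^t* *m Z); first by rewrite -DE.
  by rewrite -(mulmxA D) uZ mulmx1 -DE.
by apply/submxP; rewrite ZE.
Qed.

Section Model.
Variables (n k m : nat) (z : 'I_n -> C).
Variables (e : 'I_n + bool -> 'M[C]_(k, m)) (f : 'I_n + bool -> 'M[C]_(m, k)).
Hypothesis ef_frame : frame z e f.

Let ef p q : e p *m f q = (p == q)%:R%:M. Proof. by case: ef_frame. Qed.
Let fe : \sum_p f p *m e p = 1%:M. Proof. by case: ef_frame. Qed.
Let ee p q : e p *m (e q)^t* = (gram z p q)%:M. Proof. by case: ef_frame. Qed.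

Definition frame_op q (T : 'I_n + bool -> 'M[C]_(k, q)) : 'M[C]_(m, q) :=
  \sum_p f p *m T p.

Lemma frame_opE q (T : 'I_n + bool -> 'M[C]_(k, q)) p : e p *m frame_op T = T p.
Proof.
rewrite /frame_op mulmx_sumr (bigD1 p) //= big1 ?addr0 => [|r rp].
  by rewrite mulmxA ef eqxx mul1mx.
by rewrite mulmxA ef eq_sym (negPf rp) /= raddf0 mul0mx.
Qed.

Lemma frame_ext q (A B : 'M[C]_(m, q)) : (forall p, e p *m A = e p *m B) -> A = B.
Proof.
move=> h; rewrite -[A]mul1mx -[B]mul1mx -fe !mulmx_suml.
by apply: eq_bigr => p _; rewrite -!mulmxA h.
Qed.

Lemma frame_ext2 (A B : 'M[C]_m) :
  (forall p q, e p *m A *m (e q)^t* = e p *m B *m (e q)^t*) -> A = B.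
Proof.
move=> h; apply: frame_ext => p; apply: adjmx_inj; apply: frame_ext => q.
by apply: adjmx_inj; rewrite !adjmxM !trmxCK.
Qed.

(* The backward shift of l^2, acting on rows. *)
Definition bshift : 'M[C]_m :=
  frame_op (fun p => match p with inl i => z i *: e p
                              | inr b => if b then e (inr false) else 0 end).

Definition pick_op (W : 'I_n -> 'M[C]_k) (S : 'M[C]_k) : 'M[C]_m :=
  frame_op (fun p => match p with inl i => W i *m e p | inr _ => S *m e p end).

(** [u *m eps] is the constant term of the sequence u, and [u *m bshift *m eps] its coefficient of
    order one. *)
Definition eps : 'M[C]_(m, k) := (e (inr false))^t*.

Lemma e_eps p : e p *m eps = (if p is inr true then 0 else 1%:M).
Proof. by rewrite /eps ee; case: p => [i|[]] //=; rewrite raddf0. Qed.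

Lemma bshift_pt i : e (inl i) *m bshift = z i *: e (inl i).
Proof. by rewrite frame_opE. Qed.

Lemma bshift0 : e (inr false) *m bshift = 0.
Proof. by rewrite frame_opE. Qed.

Lemma bshift1 : e (inr true) *m bshift = e (inr false).
Proof. by rewrite frame_opE. Qed.

Lemma bshift_eps : bshift *m eps = (e (inr true))^t*.
Proof.
apply: frame_ext => -[i|[]]; rewrite mulmxA ee /=.
- by rewrite bshift_pt -scalemxAl e_eps scalemx1.
- by rewrite bshift1 e_eps.
- by rewrite bshift0 mul0mx raddf0.
Qed.

(** The nodes are eigenvectors of the shift. The shift sends e_1 to e_0, so commutation requires the
    same S at both unit vectors. *)
Lemma bshift_pick W S : pick_op W S *m bshift = bshift *m pick_op W S.
Proof.
apply: frame_ext => -[i|[]]; rewrite !mulmxA frame_opE -mulmxA.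
- by rewrite !bshift_pt -scalemxAl -scalemxAr frame_opE.
- by rewrite !bshift1 frame_opE.
- by rewrite !bshift0 mulmx0 mul0mx.
Qed.

Hypothesis z1 : forall i, `|z i| < 1.

(** In l^2, |u|^2 is |u_0|^2 plus the squared norm of the shifted sequence. The two sides are
    compared through their Gram entries; at two nodes this is the identity 1/(1 - x) - x/(1 - x) =
    1. *)
Lemma bshift_stein : 1%:M - bshift *m bshift^t* = eps *m eps^t*.
Proof.
apply: frame_ext2 => p q.
rewrite mulmxBr mulmxBl mulmx1 ee !mulmxA -[X in _ - X]mulmxA -adjmxM.
rewrite -[RHS]mulmxA -[eps^t* *m _]adjmxM !e_eps.
case: p q => [i|[]] [j|[]] /=; rewrite ?bshift_pt ?bshift1 ?bshift0 ?adjmxZ ?adjmx0 ?adjmx1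
 ?mul0mx ?mulmx0 ?mul1mx -?scalemxAl -?scalemxAr ?ee /= ?subr0 //.
- rewrite scalerA scale_scalar_mx -raddfB /=; congr (_%:M).
  rewrite -[X in X - _]mul1r -mulrBl mulfV // subr_eq0 eq_sym; apply/eqP => h.
  have : `|z i * (z j)^*| < 1 by rewrite normrM norm_conjC mulr_ilt1.
  by rewrite h normr1 ltxx.
- by rewrite scalemx1 subrr.
- by rewrite scalemx1 subrr.
- by rewrite subrr.
- by rewrite raddf0.
- by rewrite raddf0.
Qed.

Lemma tr_shift N (u v : 'M[C]_(N, m)) :
  \tr (u *m v^t*) = \tr ((u *m eps) *m (v *m eps)^t*)
    + \tr ((u *m bshift) *m (v *m bshift)^t*).
Proof.
rewrite -linearD /= !adjmxM !mulmxA -(mulmxA u eps) -(mulmxA u bshift) -mulmxDl.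
by rewrite -mulmxDr -bshift_stein subrK mulmx1.
Qed.

Lemma fsq_shift N (u : 'M[C]_(N, m)) : fsq u = fsq (u *m eps) + fsq (u *m bshift).
Proof. by rewrite !fsqT; exact: tr_shift. Qed.

(** Two shifts kill both unit vectors, so the tail of u depends only on its coordinates at the
    nodes. *)
Lemma bshift2_comb N (u : 'M[C]_(N, m)) : u *m bshift *m bshift =
  \sum_i (z i ^+ 2 *: (u *m f (inl i))) *m e (inl i).
Proof.
rewrite -[u in LHS]mulmx1 -fe mulmx_sumr !mulmx_suml big_sumType /= big_bool /=.
have -> : u *m (f (inr true) *m e (inr true)) *m bshift *m bshift = 0.
  by rewrite -!mulmxA (mulmxA (e _)) bshift1 bshift0 !mulmx0.
have -> : u *m (f (inr false) *m e (inr false)) *m bshift *m bshift = 0.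
  by rewrite -!mulmxA (mulmxA (e _)) bshift0 mul0mx !mulmx0.
rewrite !addr0; apply: eq_bigr => i _.
rewrite -!mulmxA (mulmxA (e _)) bshift_pt -!scalemxAl bshift_pt.
by rewrite scalerA -!scalemxAr !mulmxA expr2.
Qed.

(** The meaning of the kernel: its first summand measures the two leading coefficients of the
    combination of nodes after compression by (alpha, beta), its second summand the tail left by two
    backward shifts. *)
Lemma kernel_sum l l' (al be : 'M[C]_(l', l)) (x : 'I_n -> 'M[C]_(l, k)) :
  \sum_i \sum_j \tr ((x j)^t* *m ((al^t* + (z j)^* *: be^t*) *m (al + z i *: be)
      + ((z j)^* ^+ 2 * z i ^+ 2 / (1 - (z j)^* * z i))%:M) *m x i)
  = fsq (al *m (\sum_i x i) + be *m (\sum_i z i *: x i))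
    + fsq (\sum_i (z i ^+ 2 *: x i) *m e (inl i)).
Proof.
have -> : al *m (\sum_i x i) + be *m (\sum_i z i *: x i) =
    \sum_i (al + z i *: be) *m x i.
  rewrite !mulmx_sumr -big_split /=; apply: eq_bigr => i _.
  by rewrite mulmxDl -scalemxAl -scalemxAr.
rewrite !fsq_sum -big_split; apply: eq_bigr => i _.
rewrite -big_split; apply: eq_bigr => j _ /=.
rewrite mulmxDr mulmxDl linearD /=; congr (_ + _).
  by rewrite [RHS]mxtrace_mulC adjmxM adjmxD adjmxZ !mulmxA.
rewrite mul_mx_scalar -!scalemxAl adjmxZ adjmxM -scalemxAr !mulmxA.
rewrite -(mulmxA _ (e _)) ee mul_mx_scalar -!scalemxAl !mxtraceZ mxtrace_mulC.
rewrite rmorphXn /= [(z j)^* * _]mulrC; ring.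
Qed.

End Model.
End Frames.

(** * The kernel inequalities *)

Section KernelInequality.
Variable C : numClosedFieldType.

(** The kernel sum of the theorem with [Kab] written out, over an arbitrary [numClosedFieldType]. *)
Definition kernel_form n k l l' (z : 'I_n -> C) (W : 'I_n -> 'M[C]_k)
    (al be : 'M[C]_(l', l)) (X : 'I_n -> 'M[C]_(k, l)) : C :=
  let K i j := (al^t* + (z j)^* *: be^t*) *m (al + z i *: be)
      + ((z j)^* ^+ 2 * z i ^+ 2 / (1 - (z j)^* * z i))%:M in
  \sum_i \sum_j \tr (X j *m K i j *m (X i)^t*
                     - (W j)^t* *m X j *m K i j *m (X i)^t* *m W i).

Lemma row_freeP_adj m n (A : 'M[C]_(m, n)) :
  row_free A -> forall p (B : 'M[C]_(m, p)), A^t* *m B = 0 -> B = 0.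
Proof.
move=> /row_freeP[D AD] p B h.
by rewrite -[B]mul1mx -adjmx1 -AD adjmxM -mulmxA h mulmx0.
Qed.

Lemma fsq_col_mx m1 m2 n (A : 'M[C]_(m1, n)) (B : 'M[C]_(m2, n)) :
  fsq (col_mx A B) = fsq A + fsq B.
Proof.
by rewrite -fsq_adj tr_col_mx map_row_mx fsq_row_mx !fsq_adj.
Qed.

(** Pythagoras for the projection Z^* Z. *)
Lemma coisometry_contr p q r (Z : 'M[C]_(p, q)) (A : 'M[C]_(q, r)) :
  Z *m Z^t* = 1%:M -> fsq (Z *m A) <= fsq A.
Proof.
move=> ZZ; rewrite -subr_ge0.
suff -> : fsq A - fsq (Z *m A) = fsq (A - Z^t* *m (Z *m A)) by exact: fsq_ge0.
rewrite fsqB [fsq (Z^t* *m _)]fsq_adj_mul !adjmxM trmxCK !mulmxA.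
rewrite -[_ *m Z *m Z^t*]mulmxA ZZ mulmx1 -(mulmxA _ Z A) -adjmxM.
rewrite -fsq_adj_mul.
have -> : \tr (A *m A^t* *m Z^t* *m Z) = fsq (Z *m A).
  by rewrite mxtrace_mulC !fsqT adjmxM !mulmxA.
by rewrite fsq_real; ring.
Qed.

Section Model.
Variables (n k m : nat) (z : 'I_n -> C).
Variables (e : 'I_n + bool -> 'M[C]_(k, m)) (f : 'I_n + bool -> 'M[C]_(m, k)).
Hypothesis ef_frame : frame z e f.
Hypothesis z1 : forall i, `|z i| < 1.
Variable W : 'I_n -> 'M[C]_k.

Let ef p q : e p *m f q = (p == q)%:R%:M. Proof. by case: ef_frame. Qed.
Let fe : \sum_p f p *m e p = 1%:M. Proof. by case: ef_frame. Qed.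

Local Notation B := (bshift z e f).
Local Notation eps := (eps e).
Local Notation R := (pick_op e f W).

Lemma kernel_formE l l' (al be : 'M[C]_(l', l)) (X : 'I_n -> 'M[C]_(k, l))
    (x : 'I_n -> 'M[C]_(l, k)) :
  (forall i, X i = (x i)^t*) ->
  kernel_form z W al be X =
   (fsq (al *m (\sum_i x i) + be *m (\sum_i z i *: x i))
     + fsq (\sum_i (z i ^+ 2 *: x i) *m e (inl i)))
   - (fsq (al *m (\sum_i x i *m W i) + be *m (\sum_i z i *: (x i *m W i)))
     + fsq (\sum_i (z i ^+ 2 *: (x i *m W i)) *m e (inl i))).
Proof.
move=> hx; rewrite -!(kernel_sum ef_frame) -sumrB; apply: eq_bigr => i _.
rewrite -sumrB; apply: eq_bigr => j _; rewrite linearB /= !hx trmxCK.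
by rewrite adjmxM !mulmxA.
Qed.

Lemma eps_sum N (u : 'M[C]_(N, m)) :
  u *m eps = \sum_i u *m f (inl i) + u *m f (inr false).
Proof.
rewrite -{1}[u]mulmx1 -fe mulmx_sumr mulmx_suml big_sumType /= big_bool /=.
rewrite -!mulmxA !(e_eps ef_frame) /= !mulmx0 add0r !mulmx1.
by congr (_ + _); apply: eq_bigr => i _; rewrite -!mulmxA (e_eps ef_frame) mulmx1.
Qed.

Lemma bshift_eps_sum N (u : 'M[C]_(N, m)) :
  u *m B *m eps = \sum_i z i *: (u *m f (inl i)) + u *m f (inr true).
Proof.
rewrite -{1}[u]mulmx1 -fe mulmx_sumr !mulmx_suml big_sumType /= big_bool /=.
rewrite -!mulmxA !(mulmxA _ B) (bshift0 ef_frame) (bshift1 ef_frame) mul0mx !mulmx0 addr0.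
rewrite (e_eps ef_frame) mulmx1.
congr (_ + _); apply: eq_bigr => i _; rewrite -!mulmxA (mulmxA _ B) (bshift_pt ef_frame).
by rewrite -scalemxAl (e_eps ef_frame) scalemx1 mul_mx_scalar -scalemxAr.
Qed.

(** In the coordinates [u *m f p] the operator R(S) acts diagonally, by right multiplication. *)
Lemma pick_coord N (u : 'M[C]_(N, m)) S p :
  u *m R S *m f p = u *m f p *m (if p is inl i then W i else S).
Proof.
rewrite /pick_op /frame_op -!mulmxA mulmx_suml (bigD1 p) //= big1 ?addr0 => [|q qp].
  by case: p => [i|b]; rewrite -!mulmxA ef eqxx mulmx1.
by case: q qp => [i|b] qp; rewrite -!mulmxA ef (negPf qp) raddf0 !mulmx0.
Qed.

Lemma fsq_shift2 N (u : 'M[C]_(N, m)) :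
  fsq u = fsq (u *m eps) + fsq (u *m B *m eps) + fsq (u *m B *m B).
Proof. by rewrite (fsq_shift ef_frame z1) (fsq_shift ef_frame z1 (u *m B)) addrA. Qed.

Lemma tr_shift2 N (u v : 'M[C]_(N, m)) :
  \tr (u *m v^t*) = \tr ((u *m eps) *m (v *m eps)^t*)
    + \tr ((u *m B *m eps) *m (v *m B *m eps)^t*)
    + \tr ((u *m B *m B) *m (v *m B *m B)^t*).
Proof. by rewrite (tr_shift ef_frame z1) (tr_shift ef_frame z1 (u *m B)) addrA. Qed.

Lemma fsq_frame N (u : 'M[C]_(N, m)) y : (forall p, u *m f p = y p) ->
  fsq u = fsq (\sum_i y (inl i) + y (inr false))
    + fsq (\sum_i z i *: y (inl i) + y (inr true))
    + fsq (\sum_i (z i ^+ 2 *: y (inl i)) *m e (inl i)).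
Proof.
move=> h; rewrite fsq_shift2 eps_sum bshift_eps_sum (bshift2_comb ef_frame) !h.
have h0 : \sum_i u *m f (inl i) = \sum_i y (inl i) by apply: eq_bigr.
have h1 : \sum_i z i *: (u *m f (inl i)) = \sum_i z i *: y (inl i).
  by apply: eq_bigr => i _; rewrite h.
have h2 : \sum_i (z i ^+ 2 *: (u *m f (inl i))) *m e (inl i)
        = \sum_i (z i ^+ 2 *: y (inl i)) *m e (inl i).
  by apply: eq_bigr => i _; rewrite h.
by rewrite h0 h1 h2.
Qed.

(* The free components d0, d1 of u at the unit vectors are chosen so that (u0, u1) lies in the
   range of (alpha, beta)^*, while (alpha, beta) annihilates (d0, d1). *)
Lemma pick_kernel S l l' (al be : 'M[C]_(l', l)) (X : 'I_n -> 'M[C]_(k, l)) :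
  psd (1%:M - R S *m (R S)^t*) -> al *m al^t* + be *m be^t* = 1%:M ->
  0 <= kernel_form z W al be X.
Proof.
move=> pR Z1; pose x i := (X i)^t*.
rewrite (@kernel_formE _ _ _ _ _ x) => [|i]; last by rewrite trmxCK.
pose a := al *m (\sum_i x i) + be *m (\sum_i z i *: x i).
pose u0 := al^t* *m a; pose u1 := be^t* *m a.
pose d0 := u0 - \sum_i x i; pose d1 := u1 - \sum_i z i *: x i.
pose y p := match p with inl i => x i | inr b => if b then d1 else d0 end.
pose u := \sum_p y p *m e p.
have yE p : u *m f p = y p.
  rewrite /u mulmx_suml (bigD1 p) //= big1 ?addr0 => [|q qp].
    by rewrite -mulmxA ef eqxx mulmx1.
  by rewrite -mulmxA ef (negPf qp) raddf0 mulmx0.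
have d01 : al *m d0 + be *m d1 = 0.
  rewrite /d0 /d1 !mulmxBr addrACA -opprD -/a /u0 /u1 !mulmxA -mulmxDl Z1 mul1mx.
  by rewrite subrr.
pose Z := row_mx al be.
have ZZ : Z *m Z^t* = 1%:M by rewrite adj_row_mx mul_row_col.
have uRE p : u *m R S *m f p = y p *m (if p is inl i then W i else S).
  by rewrite pick_coord yE.
have := psd_contr pR u.
rewrite (fsq_frame yE) (fsq_frame uRE) /= => hle.
rewrite subr_ge0.
(* The leading coefficients of u are (u0, u1) = Z^* a, and Z^* is isometric. *)
have aE : fsq (\sum_i x i + d0) + fsq (\sum_i z i *: x i + d1) = fsq a.
  rewrite /d0 /d1 ![_ + (_ - _)]addrC !subrK /u0 /u1 -fsq_col_mx -mul_col_mx.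
  have -> : col_mx (al^t*) (be^t*) = Z^t* by rewrite adj_row_mx.
  by rewrite fsq_adj_mul adjmxM trmxCK !mulmxA -(mulmxA _ Z) ZZ mulmx1 -fsq_adj_mul.
rewrite aE in hle; apply: le_trans hle; rewrite /x lerD2r -fsq_col_mx.
(* Compression by Z can only shrink the leading coefficients of u R(S), and it removes d0 S and d1 S
   because alpha d0 + beta d1 = 0. *)
apply: le_trans (coisometry_contr _ ZZ); rewrite mul_row_col !mulmxDr addrACA.
by rewrite !mulmxA -mulmxDl d01 mul0mx addr0.
Qed.

Definition kernel_cond : Prop := forall l l' : nat,
  (1 <= l)%N -> (l <= l')%N -> (l' <= k)%N ->
  forall al be : 'M[C]_(l', l), al *m al^t* + be *m be^t* = 1%:M ->
  (forall v : 'cV[C]_l, al *m v = 0 -> v = 0) ->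
  forall X : 'I_n -> 'M[C]_(k, l), 0 <= kernel_form z W al be X.

(* An orthonormal basis of the column space of (v0, v1) provides (alpha, beta)^*; full row rank
   of v0 makes alpha injective, and orthogonality to all S makes (d0, d1) disappear. *)
Lemma kernel_dual N (u v : 'M[C]_(N, m)) :
  kernel_cond -> row_free (v *m eps) ->
  (forall S, \tr (u *m pick_op e f (fun=> 0) S *m v^t*) = 0) ->
  0 <= fsq u + fsq v - \tr (u *m R 0 *m v^t*) - (\tr (u *m R 0 *m v^t*))^*.
Proof.
move=> hker v0free horth; set p := \tr _.
(* N will serve as l, and the kernel condition requires l >= 1. *)
case: (posnP N) => [N0|Npos].
  subst N; have u0 : u = 0 by apply: flatmx0.
  have v0 : v = 0 by apply: flatmx0.
  by rewrite /p u0 v0 !mul0mx mxtrace0 !fsq0 rmorph0 !subr0 addr0.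
pose x i := u *m f (inl i); pose d0 := u *m f (inr false); pose d1 := u *m f (inr true).
pose v0 := v *m eps; pose v1 := v *m B *m eps.
have e0E : e (inr false) = eps^t* by rewrite trmxCK.
have e1E : e (inr true) = (B *m eps)^t* by rewrite (bshift_eps ef_frame) trmxCK.
have dorth : v0^t* *m d0 + v1^t* *m d1 = 0.
  have e0v : e (inr false) *m v^t* = v0^t* by rewrite e0E -adjmxM.
  have e1v : e (inr true) *m v^t* = v1^t* by rewrite e1E -adjmxM mulmxA.
  (* Testing the orthogonality with S = Y^* gives |Y|^2 = 0. *)
  set Y := LHS; have YE : Y = v0^t* *m d0 + v1^t* *m d1 by []; clearbody Y.
  apply: fsq_eq0; rewrite !fsqT mxtrace_mulC -(horth (Y^t*)).
  rewrite /pick_op /frame_op mulmx_sumr mulmx_suml.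
  rewrite big_sumType /= big_bool /= big1 ?add0r; last first.
    by move=> i _; rewrite mul0mx !mulmx0 mul0mx.
  rewrite !mulmxA -!(mulmxA _ (e _)) e0v e1v -/d0 -/d1 {2}YE mulmxDr !linearD /= addrC.
  have cyc (d w : 'M[C]_(N, k)) : \tr (Y^t* *m (w^t* *m d)) = \tr (d *m Y^t* *m w^t*).
    by rewrite mulmxA mxtrace_mulC mulmxA.
  by rewrite !cyc.
have [Z ZZ [VZ [Y ZY]]] := coisometry_basis ((col_mx v0 v1)^t*).
set l' := \rank _ in Z ZZ VZ Y ZY.
pose al := lsubmx Z; pose be := rsubmx Z.
have ZE : Z = row_mx al be by rewrite hsubmxK.
have Zd : al *m d0 + be *m d1 = 0.
  rewrite -mul_row_col -ZE ZY tr_col_mx map_row_mx -mulmxA mul_row_col dorth.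
  by rewrite mulmx0.
have Zcoiso : al *m al^t* + be *m be^t* = 1%:M by rewrite -mul_row_col -adj_row_mx -ZE.
pose y := al *m v0 + be *m v1.
have vy : col_mx v0 v1 = Z^t* *m y.
  rewrite -[LHS]trmxCK -VZ !adjmxM !trmxCK; congr (_ *m _).
  by rewrite ZE mul_row_col.
have [v0y v1y] : v0 = al^t* *m y /\ v1 = be^t* *m y.
  by apply: eq_col_mx; rewrite vy {1}ZE adj_row_mx mul_col_mx.
(* From v0 = alpha^* y: alpha w = 0 implies v0^* w = 0, and v0 has full row rank. *)
have al_inj p' (w : 'M[C]_(N, p')) : al *m w = 0 -> w = 0.
  move=> h; apply: (row_freeP_adj v0free); rewrite -/v0 v0y adjmxM trmxCK.
  by rewrite -mulmxA h mulmx0.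
have l'k : (l' <= k)%N by rewrite rank_leq_row.
have Nl' : (N <= l')%N.
  move: v0free; rewrite /row_free -/v0 => /eqP <-; rewrite v0y.
  exact: leq_trans (mxrankM_maxl _ _) (rank_leq_col _).
(* Here l is the number N of rows and l' the rank of (v0, v1), which is at least N by injectivity
   and at most k by size. *)
have := hker N l' Npos Nl' l'k al be Zcoiso (fun w => al_inj 1%N w) (fun i => (x i)^t*).
rewrite (@kernel_formE _ _ _ _ _ x) // => hK.
set a := al *m _ + _ in hK; set t := fsq (\sum_i _ *m _) in hK.
set aW := al *m _ + _ in hK; set tW := \sum_i _ in hK.
have uRE q : u *m R 0 *m f q = (if q is inl i then x i *m W i else 0).
  by rewrite pick_coord; case: q => [i|b] //; rewrite mulmx0.
have uEt : u *m B *m B = \sum_i (z i ^+ 2 *: x i) *m e (inl i).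
  by rewrite (bshift2_comb ef_frame).
have uRt : u *m R 0 *m B *m B = tW.
  by rewrite (bshift2_comb ef_frame); apply: eq_bigr => i _; rewrite uRE.
have uR0 : u *m R 0 *m eps = \sum_i x i *m W i.
  by rewrite eps_sum uRE addr0; apply: eq_bigr => i _; rewrite uRE.
have uR1 : u *m R 0 *m B *m eps = \sum_i z i *: (x i *m W i).
  by rewrite bshift_eps_sum uRE addr0; apply: eq_bigr => i _; rewrite uRE.
pose vt := v *m B *m B.
have pE : p = \tr (aW *m y^t*) + \tr (tW *m vt^t*).
  rewrite /p tr_shift2 uR0 uR1 uRt -/v0 -/v1 -/vt v0y v1y !adjmxM !trmxCK.
  have cyc (A : 'M[C]_(N, k)) (g : 'M[C]_(l', N)) :
      \tr (A *m (y^t* *m g)) = \tr (g *m A *m y^t*).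
    by rewrite mulmxA mxtrace_mulC mulmxA.
  by rewrite !cyc -mxtraceD -mulmxDl.
have fv : fsq v = fsq y + fsq vt.
  rewrite fsq_shift2 -/v0 -/v1 -fsq_col_mx vy [fsq (_ *m y)]fsq_adj_mul adjmxM trmxCK.
  by rewrite !mulmxA -(mulmxA _ Z) ZZ mulmx1 -fsq_adj_mul.
(* The vector a is the compression by Z of the leading coefficients of u, since (alpha, beta)
   annihilates (d0, d1). *)
have fu : 0 <= fsq (u *m eps) + fsq (u *m B *m eps) - fsq a.
  rewrite subr_ge0 -fsq_col_mx; apply: le_trans (coisometry_contr _ ZZ).
  rewrite ZE mul_row_col eps_sum bshift_eps_sum -/d0 -/d1 !mulmxDr addrACA Zd addr0.
  exact: lexx.
(* The gap decomposes into two squares, the defect [fu] and the kernel form. *)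
have -> : fsq u + fsq v - p - p^* = fsq (aW - y) + fsq (tW - vt)
   + (fsq (u *m eps) + fsq (u *m B *m eps) - fsq a) + (fsq a + t - (fsq aW + fsq tW)).
  rewrite !fsqB fv fsq_shift2 uEt -/t pE rmorphD /=; ring.
apply: addr_ge0 hK; apply: addr_ge0 fu; by rewrite addr_ge0 ?fsq_ge0.
Qed.

End Model.
End KernelInequality.

(** * Existence of frames *)

Section FrameExists.
Variable C : numClosedFieldType.

(** The row t tensored with the identity of C^k, pairs of indices being encoded by [mxvec]. *)
Definition kron_row d k (t : 'rV[C]_d) : 'M[C]_(k, d * k) :=
  \matrix_(a < k) mxvec (t^T *m delta_mx 0 a).

Lemma kron_rowM d k (t s : 'rV[C]_d) :
  kron_row k t *m (kron_row k s)^T = ((t *m s^T) 0 0)%:M.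
Proof.
apply/matrixP => a a'.
have -> : (kron_row k t *m (kron_row k s)^T) a a' =
    (mxvec (t^T *m delta_mx 0 a) *m (mxvec (s^T *m delta_mx 0 a'))^T) 0 0.
  by rewrite !mxE; apply: eq_bigr => j _; rewrite ![kron_row _ _]/kron_row !mxE.
rewrite mxvec_dotmul mulmxA -mulmxA trmx_delta mul_delta_mx_cond.
set x := (t *m s^T) 0 0; have -> : t *m s^T = x%:M by exact: mx11_scalar.
by rewrite mul_scalar_mx !mxE mulmxnE !mxE !eqxx eq_sym mulrnAr mulr1.
Qed.

Lemma kron_rowE d k (t : 'rV[C]_d) (a a' : 'I_k) b :
  kron_row k t a (mxvec_index b a') = t 0 b * (a == a')%:R.
Proof.
rewrite mxE mxvecE mxE big_ord1 !mxE eqxx /= eq_sym.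
by [].
Qed.

Lemma kron_row_adj d k (t : 'rV[C]_d) : (kron_row k t)^t* = (kron_row k (map_mx (@Num.conj C) t))^T.
Proof.
rewrite -map_trmx; congr trmx; apply/row_matrixP => a.
by rewrite -map_row !rowK map_mxvec map_mxM map_trmx map_delta_mx.
Qed.

(** Factor the scalar Gram matrix as T T^*. The rows of T realize the vectors, definiteness makes T
    invertible, and the columns of its inverse are the dual family; everything is then tensored with
    C^k. *)
Lemma frame_of_definite n k (z : 'I_n -> C) :
  (forall c : 'I_n + bool -> C,
     let F := \sum_p \sum_q c p * gram z p q * (c q)^* in
     0 <= F /\ (F = 0 -> forall p, c p = 0)) ->
  exists m (e : 'I_n + bool -> 'M[C]_(k, m)) (f : 'I_n + bool -> 'M[C]_(m, k)),
    frame z e f.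
Proof.
move=> pos; pose I := ('I_n + bool)%type; pose d := #|{: I}|.
pose g : 'M[C]_d := \matrix_(a, b) gram z (enum_val a) (enum_val b).
have gE (w : 'rV[C]_d) : (w *m g *m w^t*) 0 0 =
    \sum_p \sum_q w 0 (enum_rank p) * gram z p q * (w 0 (enum_rank q))^*.
  have bij := onW_bij xpredT (enum_val_bij I).
  rewrite !mxE [RHS]exchange_big /= (reindex _ bij) /=.
  apply: eq_bigr => b _; rewrite !mxE [RHS](reindex _ bij) /=.
  by rewrite mulr_suml; apply: eq_bigr => a _; rewrite !mxE !enum_valK.
have gp : psd g.
  split=> [|w]; last by rewrite gE; have [] := pos (fun p => w 0 (enum_rank p)).
  apply/matrixP => a b; rewrite !mxE /gram.
  case: (enum_val a) => [i|[]]; case: (enum_val b) => [j|[]] //=;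
    rewrite ?rmorph1 ?rmorph0 ?conjCK //.
  by rewrite fmorphV rmorphB rmorph1 rmorphM /= conjCK mulrC.
have [T TE] := psd_fact gp.
have Tu : T \in unitmx.
  rewrite -row_free_unit -kermx_eq0; apply/rowV0P => w /sub_kermxP wT.
  have [_ h] := pos (fun p => w 0 (enum_rank p)).
  apply/rowP => a; rewrite mxE -[a]enum_valK; apply: h.
  by rewrite -gE TE !mulmxA wT !mul0mx mxE.
exists (d * k)%N, (fun p => kron_row k (row (enum_rank p) T)).
exists (fun p => (kron_row k (col (enum_rank p) (invmx T))^T)^T); split.
- move=> p q; rewrite kron_rowM trmxK; congr (_%:M).
  have /matrixP /(_ (enum_rank p) (enum_rank q)) := mulmxV Tu.
  rewrite !mxE (inj_eq enum_rank_inj) => <-.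
  by apply: eq_bigr => j _; rewrite !mxE.
- apply/matrixP => j j'; rewrite summxE.
  case/mxvec_indexP: j => b a; case/mxvec_indexP: j' => b' a'.
  have -> : 1%:M (mxvec_index b a) (mxvec_index b' a') = (delta_mx b a : 'M[C]_(d, k)) b' a'.
    by rewrite -[RHS](mxvecE (delta_mx b a)) mxvec_delta !mxE eqxx eq_sym.
  have /matrixP /(_ b b') := mulVmx Tu; rewrite !mxE => h.
  rewrite (eq_sym b') (eq_sym a') -mulnb natrM -h mulr_suml (reindex _ (onW_bij _ (enum_val_bij I))) /=.
  apply: eq_bigr => p _; rewrite mxE (bigD1 a) //= big1 => [|c ca].
    by rewrite mxE !kron_rowE !mxE !enum_valK eqxx mulr1 addr0 mulrA.
  by rewrite mxE !kron_rowE (negPf ca) mulr0 mul0r.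
- move=> p q; rewrite kron_row_adj kron_rowM; congr (_%:M).
  have /matrixP /(_ (enum_rank p) (enum_rank q)) := TE; rewrite !mxE !enum_rankK => ->.
  by apply: eq_bigr => j _; rewrite !mxE.
Qed.

End FrameExists.

Section Modulus.
Variable R : realType.
Local Notation C := (Cplx R).

Definition modu (z : C) : R := Normc.normc z.

Lemma moduE (z : C) : `|z| = (modu z)%:C%C.
Proof. by case: z. Qed.

Lemma modu_ge0 z : 0 <= modu z.
Proof. by rewrite -lecR -moduE normr_ge0. Qed.

Lemma moduM z w : modu (z * w) = modu z * modu w.
Proof. exact: Normc.normcM. Qed.

Lemma moduD z w : modu (z + w) <= modu z + modu w.
Proof. exact: (@le_normcD R). Qed.

Lemma moduN z : modu (- z) = modu z.
Proof. exact: (@normcN R). Qed.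

Lemma modu0 : modu 0 = 0.
Proof. exact: Normc.normc0. Qed.

Lemma modu1 : modu 1 = 1.
Proof. exact: Normc.normc1. Qed.

Lemma moduV z : modu z^-1 = (modu z)^-1.
Proof. exact: Normc.normcV. Qed.

Lemma moduX z n : modu (z ^+ n) = modu z ^+ n.
Proof. by elim: n => [|n IH]; rewrite ?expr0 ?modu1 // !exprS moduM IH. Qed.

Lemma modu_conj (z : C) : modu z^* = modu z.
Proof. by apply: (@complexI R); rewrite -!moduE norm_conjC. Qed.

Lemma modu_sum (I : Type) (r : seq I) (P : pred I) (F : I -> C) :
  modu (\sum_(i <- r | P i) F i) <= \sum_(i <- r | P i) modu (F i).
Proof.
elim/big_rec2: _ => [|i y x _ h]; first by rewrite modu0.
by apply: le_trans (moduD _ _) _; rewrite lerD2l.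
Qed.

Lemma modu_lt (z : C) (x : R) : (modu z < x) = (`|z| < x%:C%C).
Proof. by rewrite moduE ltcR. Qed.

Lemma modu_lt1 (z : C) : (modu z < 1) = (`|z| < 1).
Proof. by rewrite moduE -(ltcR _ 1). Qed.

End Modulus.

(** * Strict positivity of the Szego kernel *)

Section Szego.
Variable R : realType.
Local Notation C := (Cplx R).
Variables (n : nat) (z : 'I_n -> C).
Hypothesis z1 : forall i, `|z i| < 1.

Definition szego_form (c : 'I_n -> C) : C :=
  \sum_i \sum_j c i * (c j)^* / (1 - z i * (z j)^*).

Lemma szego_denom i j : 1 - z i * (z j)^* != 0.
Proof.
rewrite subr_eq0 eq_sym; apply/eqP => h.
have : `|z i * (z j)^*| < 1 by rewrite normrM norm_conjC mulr_ilt1.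
by rewrite h normr1 ltxx.
Qed.

Lemma szego_step c :
  szego_form c = `|\sum_i c i| ^+ 2 + szego_form (fun i => z i * c i).
Proof.
rewrite normCK rmorph_sum mulr_suml -big_split; apply: eq_bigr => i _.
rewrite mulr_sumr -big_split; apply: eq_bigr => j _ /=.
rewrite rmorphM /=; field; exact: szego_denom.
Qed.

Lemma szego_steps c J : szego_form c =
  \sum_(j < J) `|\sum_i z i ^+ j * c i| ^+ 2 + szego_form (fun i => z i ^+ J * c i).
Proof.
elim: J => [|J IH].
  by rewrite big_ord0 add0r; congr szego_form; apply/funext => i; rewrite mul1r.
rewrite IH big_ord_recr /= szego_step addrA; congr (_ + szego_form _).
by apply/funext => i; rewrite exprS mulrA.
Qed.

Lemma szego_real c : (szego_form c)^* = szego_form c.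
Proof.
rewrite /szego_form rmorph_sum exchange_big; apply: eq_bigr => i _ /=.
rewrite rmorph_sum; apply: eq_bigr => j _ /=.
by rewrite !rmorphM fmorphV rmorphB rmorph1 rmorphM /= !conjCK [c j * _]mulrC [_ * z j]mulrC.
Qed.

Lemma szego_small c (d : R) : 0 < d ->
  exists K, forall J, (K <= J)%N -> modu (szego_form (fun i => z i ^+ J * c i)) < d.
Proof.
move=> d0.
pose q := \big[Num.max/0]_i modu (z i).
have q0 : 0 <= q by apply: bigmax_ge_id.
have q1 : q < 1 by apply: bigmax_lt => // i _; rewrite modu_lt1.
have zq i : modu (z i) <= q by apply: le_bigmax.
pose M := \sum_i \sum_j modu (c i * (c j)^* / (1 - z i * (z j)^*)).
have M0 : 0 <= M by apply: sumr_ge0 => i _; apply: sumr_ge0 => j _; exact: modu_ge0.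
have : (q ^+ J @[J --> \oo] --> 0)%classic by apply: cvg_expr; rewrite ger0_norm.
move=> /cvgrPdist_lt /(_ (d / (M + 1))) => -[|K _ hK].
  by rewrite divr_gt0 // ltr_pwDr.
exists K => J KJ; have := hK J KJ; rewrite /= sub0r normrN ger0_norm ?exprn_ge0 //.
rewrite ltr_pdivlMr ?ltr_pwDr // => hJ; apply: le_lt_trans hJ.
apply: le_trans (_ : q ^+ J * M <= _); last by rewrite ler_wpM2l ?exprn_ge0 // lerDl.
rewrite mulr_sumr; apply: le_trans (modu_sum _ _ _) _; apply: ler_sum => i _.
rewrite mulr_sumr; apply: le_trans (modu_sum _ _ _) _; apply: ler_sum => j _.
rewrite rmorphM rmorphXn /=.
have -> : z i ^+ J * c i * ((z j)^* ^+ J * (c j)^*) / (1 - z i * (z j)^*) =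
  (z i ^+ J * (z j)^* ^+ J) * (c i * (c j)^* / (1 - z i * (z j)^*)) by ring.
rewrite moduM; apply: ler_wpM2r; first exact: modu_ge0.
rewrite moduM !moduX modu_conj -[leRHS]mulr1; apply: ler_pM; rewrite ?exprn_ge0 ?modu_ge0 //.
  by rewrite lerXn2r ?nnegrE ?modu_ge0.
by rewrite exprn_ile1 ?modu_ge0 // ltW // modu_lt1.
Qed.

(** The partial sums increase and the remainder tends to 0. If one partial sum exceeded the form,
    the real remainders would from then on stay below a fixed negative number. *)
Lemma szego_ge c J : \sum_(j < J) `|\sum_i z i ^+ j * c i| ^+ 2 <= szego_form c.
Proof.
pose s K : C := \sum_(j < K) `|\sum_i z i ^+ j * c i| ^+ 2.
have sE K : szego_form c - s K = szego_form (fun i => z i ^+ K * c i).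
  by rewrite (szego_steps c K) addrC addKr.
have sreal K : s K \is Num.real.
  by apply: rpred_sum => j _; rewrite realX // normr_real.
have creal : szego_form c \is Num.real by apply/CrealP; exact: szego_real.
rewrite -/(s J); case: (real_leP (sreal J) creal) => // lt.
have d0 : 0 < modu (szego_form c - s J).
  by rewrite -ltcR -moduE normr_gt0 subr_eq0 lt_eqF.
have [K hK] := szego_small c d0.
have := hK (maxn J K) (leq_maxr _ _); rewrite -sE -ltcR -!moduE.
have smono : s J <= s (maxn J K).
  rewrite /s -(subnKC (leq_maxl J K)) big_split_ord /= lerDl.
  by apply: sumr_ge0 => j _; rewrite exprn_ge0.
have h1 : szego_form c - s (maxn J K) <= szego_form c - s J by rewrite lerD2l lerN2.
have h2 : szego_form c - s J <= 0 by rewrite subr_le0 ltW.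
rewrite (ler0_norm h2) (ler0_norm (le_trans h1 h2)) ltrN2 => h3.
by have := lt_le_trans h3 h1; rewrite ltxx.
Qed.

Lemma szego_definite (c : 'I_n -> C) : injective z -> szego_form c = 0 -> forall i, c i = 0.
Proof.
move=> zinj c0.
have mom J : \sum_i z i ^+ J * c i = 0.
  have := szego_ge c J.+1; rewrite c0 big_ord_recr /= => h.
  apply/eqP; rewrite -normr_eq0 -sqrf_eq0 eq_le exprn_ge0 // andbT.
  apply: le_trans h; rewrite lerDr; apply: sumr_ge0 => j _; by rewrite exprn_ge0.
have hp (p : {poly C}) : \sum_i p.[z i] * c i = 0.
  under eq_bigr do rewrite horner_coef mulr_suml.
  rewrite exchange_big big1 //= => j _.
  under eq_bigr do rewrite -mulrA.
  by rewrite -mulr_sumr mom mulr0.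
(* All moments of c vanish, hence its sums against all polynomials; this product vanishes at every
   node except z_i. *)
move=> i; have := hp (\prod_(j | j != i) ('X - (z j)%:P)).
rewrite (bigD1 i) //= [X in _ + X]big1 => [|j ji].
  rewrite addr0 => /eqP; rewrite mulf_eq0 => /orP[|/eqP //].
  rewrite horner_prod prodf_seq_eq0 => /hasP[j _ /andP[ji]].
  by rewrite !hornerE subr_eq0 (inj_eq zinj) eq_sym (negPf ji).
by rewrite horner_prod (bigD1 j) //= !hornerE subrr !mul0r.
Qed.

Lemma gram_form_split (c : 'I_n + bool -> C) :
  \sum_p \sum_q c p * gram z p q * (c q)^* =
  `|\sum_i c (inl i) + c (inr false)| ^+ 2 + `|\sum_i z i * c (inl i) + c (inr true)| ^+ 2
  + szego_form (fun i => z i * (z i * c (inl i))).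
Proof.
rewrite big_sumType /= big_bool /=.
under eq_bigr do rewrite big_sumType /= big_bool /=.
rewrite !big_sumType /= !big_bool /= !mulr1 !mulr0 !mul0r add0r addr0.
rewrite big_split big_split /=.
have -> : \sum_i \sum_j c (inl i) / (1 - z i * (z j)^*) * (c (inl j))^* = szego_form (c \o inl).
  by apply: eq_bigr => i _; apply: eq_bigr => j _; rewrite /= mulrAC.
rewrite szego_step szego_step /= !normCK.
have -> : \sum_i c (inl i) * z i * (c (inr true))^* = (\sum_i z i * c (inl i)) * (c (inr true))^*.
  by rewrite mulr_suml; apply: eq_bigr => i _; rewrite [c _ * _]mulrC.
have -> : \sum_i c (inl i) * 1 * (c (inr false))^* = (\sum_i c (inl i)) * (c (inr false))^*.
  by rewrite mulr_suml; apply: eq_bigr => i _; rewrite mulr1.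
have -> : \sum_i c (inr true) * (z i)^* * (c (inl i))^* = c (inr true) * (\sum_i z i * c (inl i))^*.
  by rewrite rmorph_sum mulr_sumr; apply: eq_bigr => i _; rewrite rmorphM mulrA.
have -> : \sum_i c (inr false) * (c (inl i))^* = c (inr false) * (\sum_i c (inl i))^*.
  by rewrite rmorph_sum mulr_sumr.
rewrite !rmorphD /=; ring.
Qed.

(** Vanishing of the tail forces z_i^2 c_i = 0, hence c_i = 0 as z_i is nonzero; the two leading
    coefficients then give the coordinates at the unit vectors. *)
Lemma frame_exists k : (forall i, z i != 0) -> injective z ->
  exists m (e : 'I_n + bool -> 'M[C]_(k, m)) (f : 'I_n + bool -> 'M[C]_(m, k)),
    frame z e f.
Proof.
move=> z0 zinj; apply: frame_of_definite => c /=; rewrite gram_form_split.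
set a := _ ^+ 2; set b := _ ^+ 2; set s := szego_form _.
have a0 : 0 <= a by rewrite exprn_ge0.
have b0 : 0 <= b by rewrite exprn_ge0.
have s0 : 0 <= s.
  by have := szego_ge (fun i => z i * (z i * c (inl i))) 0; rewrite big_ord0.
split; first by rewrite !addr_ge0.
move=> /eqP; rewrite paddr_eq0 ?addr_ge0 // paddr_eq0 // => /andP[/andP[ha hb] hs].
have ci i : c (inl i) = 0.
  have := szego_definite zinj (eqP hs) i.
  by move=> /eqP; rewrite !mulf_eq0 (negPf (z0 i)) /= => /eqP.
have hP : \sum_i c (inl i) = 0 by rewrite big1.
have hQ : \sum_i z i * c (inl i) = 0 by rewrite big1 // => i _; rewrite ci mulr0.
move: ha hb; rewrite /a /b hP hQ !add0r !sqrf_eq0 !normr_eq0 => /eqP h0 /eqP h1.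
by case=> [i|[]].
Qed.

End Szego.

(** * Minimization over complex matrices *)

Section ComplexContinuity.
Variables (R : realType) (T : topologicalType).
Local Notation C := (Cplx R).

(** Stated through real and imaginary parts, because the minimizations below take place in real
    coordinates. *)
Definition ccont (h : T -> C) : Prop :=
  continuous (fun t => complex.Re (h t)) /\ continuous (fun t => complex.Im (h t)).

Lemma ccont_cst c : ccont (fun=> c).
Proof. by split=> t; exact: cvg_cst. Qed.

Lemma ccontD g h : ccont g -> ccont h -> ccont (fun t => g t + h t).
Proof.
move=> [g1 g2] [h1 h2]; split => t.
- have -> : (fun t => complex.Re (g t + h t)) = (fun t => complex.Re (g t) + complex.Re (h t)).
    by apply/funext => s; case: (g s) => ? ?; case: (h s).
  by apply: cvgD; [exact: g1|exact: h1].
- have -> : (fun t => complex.Im (g t + h t)) = (fun t => complex.Im (g t) + complex.Im (h t)).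
    by apply/funext => s; case: (g s) => ? ?; case: (h s).
  by apply: cvgD; [exact: g2|exact: h2].
Qed.

Lemma ccontM g h : ccont g -> ccont h -> ccont (fun t => g t * h t).
Proof.
move=> [g1 g2] [h1 h2]; split => t.
- have -> : (fun t => complex.Re (g t * h t)) =
     (fun t => complex.Re (g t) * complex.Re (h t) - complex.Im (g t) * complex.Im (h t)).
    by apply/funext => s; case: (g s) => ? ?; case: (h s).
  by apply: cvgB; apply: cvgM; [exact: g1|exact: h1|exact: g2|exact: h2].
- have -> : (fun t => complex.Im (g t * h t)) =
     (fun t => complex.Re (g t) * complex.Im (h t) + complex.Im (g t) * complex.Re (h t)).
    by apply/funext => s; case: (g s) => ? ?; case: (h s).
  by apply: cvgD; apply: cvgM; [exact: g1|exact: h2|exact: g2|exact: h1].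
Qed.

Lemma ccont_conj h : ccont h -> ccont (fun t => (h t)^*).
Proof.
move=> [h1 h2]; split => t.
- have -> : (fun t => complex.Re ((h t)^*)) = (fun t => complex.Re (h t)).
    by apply/funext => s; case: (h s).
  exact: h1.
- have -> : (fun t => complex.Im ((h t)^*)) = (fun t => - complex.Im (h t)).
    by apply/funext => s; case: (h s).
  by apply: cvgN; exact: h2.
Qed.

Lemma ccont_sum (I : finType) (h : I -> T -> C) :
  (forall i, ccont (h i)) -> ccont (fun t => \sum_i h i t).
Proof.
move=> hc; have -> : (fun t => \sum_i h i t) = \sum_i h i by apply/funext => t; rewrite fct_sumE.
elim/big_rec: _ => [|i x _ hx]; first exact: ccont_cst.
exact: ccontD.
Qed.

Definition mcont p q (H : T -> 'M[C]_(p, q)) : Prop := forall i j, ccont (fun t => H t i j).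

Lemma mcont_cst p q (A : 'M[C]_(p, q)) : mcont (fun=> A).
Proof. by move=> i j; exact: ccont_cst. Qed.

Lemma mcontD p q (G H : T -> 'M[C]_(p, q)) :
  mcont G -> mcont H -> mcont (fun t => G t + H t).
Proof.
move=> hG hH i j; have -> : (fun t => (G t + H t) i j) = (fun t => G t i j + H t i j).
  by apply/funext => t; rewrite mxE.
exact: ccontD.
Qed.

Lemma mcontM p q r (G : T -> 'M[C]_(p, q)) (H : T -> 'M[C]_(q, r)) :
  mcont G -> mcont H -> mcont (fun t => G t *m H t).
Proof.
move=> hG hH i j; have -> : (fun t => (G t *m H t) i j) = (fun t => \sum_l G t i l * H t l j).
  by apply/funext => t; rewrite mxE.
by apply: ccont_sum => l; exact: ccontM.
Qed.

Lemma mcont_adj p q (H : T -> 'M[C]_(p, q)) : mcont H -> mcont (fun t => (H t)^t*).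
Proof.
move=> hH i j; have -> : (fun t => ((H t)^t*) i j) = (fun t => (H t j i)^*).
  by apply/funext => t; rewrite !mxE.
exact: ccont_conj.
Qed.

Lemma mcontN p q (H : T -> 'M[C]_(p, q)) : mcont H -> mcont (fun t => - H t).
Proof.
move=> hH i j; have -> : (fun t => (- H t) i j) = (fun t => (-1) * H t i j).
  by apply/funext => t; rewrite mxE mulN1r.
by apply: ccontM => //; exact: ccont_cst.
Qed.

Lemma mcont_lsub p q r (H : T -> 'M[C]_(p, q + r)) : mcont H -> mcont (fun t => lsubmx (H t)).
Proof.
move=> hH i j; have -> : (fun t => lsubmx (H t) i j) = (fun t => H t i (lshift r j)).
  by apply/funext => t; rewrite mxE.
exact: hH.
Qed.

Lemma mcont_rsub p q r (H : T -> 'M[C]_(p, q + r)) : mcont H -> mcont (fun t => rsubmx (H t)).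
Proof.
move=> hH i j; have -> : (fun t => rsubmx (H t) i j) = (fun t => H t i (rshift q j)).
  by apply/funext => t; rewrite mxE.
exact: hH.
Qed.

Lemma mcont_usub p q r (H : T -> 'M[C]_(q + r, p)) : mcont H -> mcont (fun t => usubmx (H t)).
Proof.
move=> hH i j; have -> : (fun t => usubmx (H t) i j) = (fun t => H t (lshift r i) j).
  by apply/funext => t; rewrite mxE.
exact: hH.
Qed.

Lemma mcont_dsub p q r (H : T -> 'M[C]_(q + r, p)) : mcont H -> mcont (fun t => dsubmx (H t)).
Proof.
move=> hH i j; have -> : (fun t => dsubmx (H t) i j) = (fun t => H t (rshift q i) j).
  by apply/funext => t; rewrite mxE.
exact: hH.
Qed.

Lemma ccont_tr p (H : T -> 'M[C]_p) : mcont H -> ccont (fun t => \tr (H t)).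
Proof. by move=> hH; apply: ccont_sum => i; exact: hH. Qed.

Lemma ccont_fsq p q (H : T -> 'M[C]_(p, q)) : mcont H -> ccont (fun t => fsq (H t)).
Proof. by move=> hH; under eq_fun do rewrite fsqT; apply: ccont_tr; apply: mcontM => //; exact: mcont_adj. Qed.

Lemma closed_mcont_eq0 p q (H : T -> 'M[C]_(p, q)) : mcont H -> closed [set t | H t = 0].
Proof.
move=> hH; have -> : [set t | H t = 0] = \bigcap_(ij in [set: 'I_p * 'I_q])
    ((fun t => complex.Re (H t ij.1 ij.2)) @^-1` [set 0] `&`
     (fun t => complex.Im (H t ij.1 ij.2)) @^-1` [set 0]).
  apply/seteqP; split => [t /= Ht [i j] _|t /= h]; first by rewrite /= Ht mxE.
  apply/matrixP => i j; have [/= h1 h2] := h (i, j) I; rewrite mxE.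
  by move: h1 h2; case: (H t i j) => a b /= -> ->.
apply: closed_bigI => -[i j] _; have [h1 h2] := hH i j.
by apply: closedI; apply: preimage_closed => [t _|]; [exact: h1|exact: closed_eq|exact: h2|exact: closed_eq].
Qed.

Lemma closed_ccont_Re_ge0 (h : T -> C) : ccont h -> closed [set t | 0 <= complex.Re (h t)].
Proof.
move=> [h1 _]; have -> : [set t | 0 <= complex.Re (h t)] =
   (fun t => complex.Re (h t)) @^-1` [set x | 0 <= x] by [].
by apply: preimage_closed => [t _|]; [exact: h1|exact: closed_ge].
Qed.

End ComplexContinuity.

Section ExtremeValue.
Variable R : realType.
Local Notation C := (Cplx R).

(** Complex matrices in real coordinates, all real parts first, so that compactness of bounded
    closed sets of real vectors applies. *)
Definition mxdec p q (t : 'rV[R]_(p * q + p * q)) : 'M[C]_(p, q) :=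
  \matrix_(i, j) ((vec_mx (lsubmx t)) i j +i* (vec_mx (rsubmx t)) i j)%C.

Definition mxenc p q (A : 'M[C]_(p, q)) : 'rV[R]_(p * q + p * q) :=
  row_mx (mxvec (map_mx (@complex.Re R) A)) (mxvec (map_mx (@complex.Im R) A)).

Lemma mxencK p q : cancel (@mxenc p q) (@mxdec p q).
Proof.
move=> A; apply/matrixP => i j; rewrite [LHS]mxE row_mxKl row_mxKr !mxvecK !mxE.
by case: (A i j).
Qed.

Lemma mcont_dec p q : mcont (@mxdec p q).
Proof.
move=> i j; split.
- have -> : (fun t => complex.Re (@mxdec p q t i j)) = fun t => t 0 (lshift _ (mxvec_index i j)).
    by apply/funext => t; rewrite !mxE.
  exact: coord_continuous.
- have -> : (fun t => complex.Im (@mxdec p q t i j)) = fun t => t 0 (rshift _ (mxvec_index i j)).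
    by apply/funext => t; rewrite !mxE.
  exact: coord_continuous.
Qed.

Lemma Re_le_modu (x : C) : `|complex.Re x| <= modu x.
Proof.
case: x => a b /=; rewrite /modu /= -sqrtr_sqr ler_wsqrtr // lerDl exprn_even_ge0 //.
Qed.

Lemma Im_le_modu (x : C) : `|complex.Im x| <= modu x.
Proof.
case: x => a b /=; rewrite /modu /= -sqrtr_sqr ler_wsqrtr // lerDr exprn_even_ge0 //.
Qed.

Lemma mxdec_norm_le p q (t : 'rV[R]_(p * q + p * q)) (b : R) : 0 <= b ->
  (forall i j, modu (mxdec t i j) <= b) -> `|t| <= b.
Proof.
move=> b0 hb; rewrite [leLHS]mx_normrE; apply: bigmax_le => // -[i0 l] _ /=.
rewrite (ord1 i0) => {i0}; case: (split_ordP l) => l' ->; case/mxvec_indexP: l' => i j.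
- apply: le_trans (hb i j); apply: le_trans (Re_le_modu _).
  by rewrite !mxE /=.
- apply: le_trans (hb i j); apply: le_trans (Im_le_modu _).
  by rewrite !mxE /=.
Qed.

Lemma mx_evt p q (K : set 'M[C]_(p, q)) (f : 'M[C]_(p, q) -> R) (b : R) :
  K !=set0 -> 0 <= b -> (forall A, K A -> forall i j, modu (A i j) <= b) ->
  closed [set t | K (mxdec t)] -> continuous (fun t => f (mxdec t)) ->
  exists2 A, K A & forall A', K A' -> f A <= f A'.
Proof.
move=> [A0 KA0] b0 Kb Kc fc; pose K' := [set t | K (@mxdec p q t)].
have K'c : compact K'.
  apply: bounded_closed_compact => //.
  exists b; split=> [|M bM t Kt]; first exact: num_real.
  by apply: le_trans (ltW bM); apply: mxdec_norm_le => // i j; exact: Kb.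
have K'0 : K' !=set0 by exists (mxenc A0); rewrite /K' /= mxencK.
have [t /set_mem Kt ht] := compact_EVT_min K'0 K'c (continuous_subspaceT fc).
exists (mxdec t) => // A' KA'; have := ht (mxenc A').
by rewrite mxencK; apply; apply/mem_set; rewrite /K' /= mxencK.
Qed.

End ExtremeValue.

Section RealPart.
Variable R : realType.
Local Notation C := (Cplx R).
Implicit Types x y : C.

Lemma ReD x y : complex.Re (x + y) = complex.Re x + complex.Re y.
Proof. by case: x y => [a b] [c d]. Qed.

Lemma ReN x : complex.Re (- x) = - complex.Re x.
Proof. by case: x. Qed.

Lemma cRe_conj x : complex.Re (@Num.conj (Cplx R) x) = complex.Re x.
Proof. by case: x. Qed.

Lemma Re_scale (a : R) x : complex.Re (a%:C%C * x) = a * complex.Re x.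
Proof. by case: x => c d /=; rewrite mul0r subr0. Qed.

Lemma ge0_Re x : x^* = x -> (0 <= x) = (0 <= complex.Re x).
Proof.
case: x => a b [h]; rewrite lecE /=; have -> : b = 0 by lra.
by rewrite eqxx.
Qed.

Lemma Re_ge0 x : 0 <= x -> 0 <= complex.Re x.
Proof. by rewrite lecE /= => /andP[]. Qed.

Lemma Re_le x y : x <= y -> complex.Re x <= complex.Re y.
Proof. by rewrite lecE /= => /andP[]. Qed.

Lemma Re_lt x y : x < y -> complex.Re x < complex.Re y.
Proof. by rewrite ltcE /= => /andP[]. Qed.

Lemma modu_fsq p q (A : 'M[C]_(p, q)) i j : modu (A i j) <= 1 + complex.Re (fsq A).
Proof.
have h : `|A i j| ^+ 2 <= fsq A.
  rewrite fsqE (bigD1 i) //= (bigD1 j) //= -addrA lerDl addr_ge0 //.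
    by apply: sumr_ge0 => l _; rewrite exprn_ge0.
  by apply: sumr_ge0 => l _; apply: sumr_ge0 => l' _; rewrite exprn_ge0.
have := Re_le h; rewrite moduE -rmorphXn /= => h'.
have := modu_ge0 (A i j); nra.
Qed.

End RealPart.

(** * Reduction to dual pairs with v of full rank at 0 *)

(* For a unit row c, this replaces the c-component of w by that of x. *)
HB.lock Definition replace_row (C : numClosedFieldType) N m (c : 'rV[C]_N)
    (w x : 'M[C]_(N, m)) : 'M[C]_(N, m) :=
  w - c^t* *m (c *m w) + c^t* *m (c *m x).

Section RankOne.
Variable C : numClosedFieldType.

(** P = c^* c and E = 1 - P are complementary projections, so the cross terms vanish under the
    trace. *)
Lemma replace_row_tr N m (c : 'rV[C]_N) (w x y t : 'M[C]_(N, m)) (M : 'M[C]_m) :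
  c *m c^t* = 1%:M ->
  \tr (replace_row c w x *m M *m (replace_row c y t)^t*) =
  \tr (w *m M *m y^t*) - \tr (c *m w *m M *m (c *m y)^t*) + \tr (c *m x *m M *m (c *m t)^t*).
Proof.
move=> cc; pose P := c^t* *m c; pose E := 1%:M - P.
have hP : P^t* = P by rewrite /P adjmxM trmxCK.
have hE : E^t* = E by rewrite /E adjmxB adjmx1 hP.
have PP : P *m P = P by rewrite /P !mulmxA -(mulmxA _ c) cc mulmx1.
have EP : E *m P = 0 by rewrite /E mulmxBl mul1mx PP subrr.
have PE : P *m E = 0 by rewrite /E mulmxBr mulmx1 PP subrr.
have EE : E *m E = E by rewrite {1}/E mulmxBl mul1mx PE subr0.
have rE (u v : 'M[C]_(N, m)) : replace_row c u v = E *m u + P *m v.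
  by rewrite replace_row.unlock /E mulmxBl mul1mx !mulmxA.
have cyc (X Y A : 'M[C]_N) : \tr (X *m A *m Y) = \tr (Y *m X *m A).
  by rewrite mxtrace_mulC mulmxA.
have [PT ET] : P = c^t* *m c /\ E = 1%:M - P by [].
clearbody E; clearbody P.
have split4 : replace_row c w x *m M *m (replace_row c y t)^t* =
   E *m (w *m M *m y^t*) *m E + E *m (w *m M *m t^t*) *m P
   + (P *m (x *m M *m y^t*) *m E + P *m (x *m M *m t^t*) *m P).
  by rewrite !rE adjmxD (adjmxM E) (adjmxM P) hE hP !mulmxDl !mulmxDr !mulmxA.
have qE (A : 'M[C]_N) : \tr (P *m A) = \tr (c *m A *m c^t*).
  by rewrite PT -mulmxA mxtrace_mulC.
have t1 (A : 'M[C]_N) : \tr (E *m A *m E) = \tr (E *m A) by rewrite cyc EE.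
have t2 (A : 'M[C]_N) : \tr (E *m A *m P) = 0 by rewrite cyc PE mul0mx mxtrace0.
have t3 (A : 'M[C]_N) : \tr (P *m A *m E) = 0 by rewrite cyc EP mul0mx mxtrace0.
have t4 (A : 'M[C]_N) : \tr (P *m A *m P) = \tr (P *m A) by rewrite cyc PP.
rewrite split4 !mxtraceD t1 t2 t3 t4 addr0 add0r.
rewrite {1}ET mulmxBl mul1mx linearB /= !qE !adjmxM !mulmxA.
by [].
Qed.

Lemma replace_row_fsq N m (c : 'rV[C]_N) (w x : 'M[C]_(N, m)) : c *m c^t* = 1%:M ->
  fsq (replace_row c w x) = fsq w - fsq (c *m w) + fsq (c *m x).
Proof.
move=> cc; have := replace_row_tr w x w x 1%:M cc.
by rewrite !mulmx1 !fsqT.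
Qed.

Lemma replace_rowM N m p (c : 'rV[C]_N) (w x : 'M[C]_(N, m)) (B : 'M[C]_(m, p)) :
  replace_row c w x *m B = replace_row c (w *m B) (x *m B).
Proof. by rewrite replace_row.unlock mulmxDl mulmxBl !mulmxA. Qed.

End RankOne.

Section OuterReduction.
Variable R : realType.
Local Notation C := (Cplx R).
Variables (m k N J : nat) (I : Type).
Variables (B R0 : 'M[C]_m) (eps : 'M[C]_(m, k)) (L : I -> 'M[C]_m).
Hypothesis stein : 1%:M - B *m B^t* = eps *m eps^t*.
Hypothesis R0B : R0 *m B = B *m R0.
Hypothesis LB : forall i, L i *m B = B *m L i.

Fixpoint shiftn p j (w : 'M[C]_(p, m)) : 'M[C]_(p, m) :=
  if j is j'.+1 then shiftn j' w *m B else w.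

(** Observability: by the Stein identity it says that one of the first J coefficients of r is
    nonzero. *)
Hypothesis stable : forall r : 'rV[C]_m, r != 0 -> fsq (shiftn J r) < fsq r.

Lemma shiftnM p q j (c : 'M[C]_(q, p)) (w : 'M[C]_(p, m)) :
  shiftn j (c *m w) = c *m shiftn j w.
Proof. by elim: j => [//|j IH] /=; rewrite IH mulmxA. Qed.

Lemma shiftn_replace j (c : 'rV[C]_N) (w x : 'M[C]_(N, m)) :
  shiftn j (replace_row c w x) = replace_row c (shiftn j w) (shiftn j x).
Proof. by elim: j => [//|j IH] /=; rewrite IH (replace_rowM c _ _ B). Qed.

Lemma shiftnS p j (w : 'M[C]_(p, m)) : shiftn j (w *m B) = shiftn j.+1 w.
Proof. by elim: j => [//|j IH] /=; rewrite IH. Qed.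

Lemma fsq_eps_shift p (w : 'M[C]_(p, m)) : fsq w = fsq (w *m eps) + fsq (w *m B).
Proof.
rewrite !fsqT -linearD /= !adjmxM !mulmxA -(mulmxA w eps) -(mulmxA w B) -mulmxDl.
by rewrite -mulmxDr -stein subrK mulmx1.
Qed.

Lemma fsq_shift_le p (w : 'M[C]_(p, m)) : fsq (w *m B) <= fsq w.
Proof. by rewrite [leRHS]fsq_eps_shift lerDr fsq_ge0. Qed.

Definition shift_energy (v : 'M[C]_(N, m)) : C := \sum_(j < J) fsq (shiftn j.+1 v).

Lemma shift_energy_ge0 v : 0 <= shift_energy v.
Proof. by apply: sumr_ge0 => j _; exact: fsq_ge0. Qed.

Definition pairing (M : 'M[C]_m) (u v : 'M[C]_(N, m)) : C := \tr (u *m M *m v^t*).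

(** Commutation moves both shifts next to c v, where B B^* = 1 - eps eps^* acts as the identity
    because c v has no constant term. *)
Lemma pairing_replace (c : 'rV[C]_N) (M : 'M[C]_m) u v :
  c *m c^t* = 1%:M -> c *m v *m eps = 0 -> M *m B = B *m M ->
  pairing M (replace_row c u (u *m B)) (replace_row c v (v *m B)) = pairing M u v.
Proof.
move=> cc cv MB; rewrite /pairing replace_row_tr //.
have -> : c *m (u *m B) *m M *m (c *m (v *m B))^t* = c *m u *m M *m (c *m v)^t*.
  rewrite (mulmxA c u B) -(mulmxA _ B M) -MB (mulmxA c v B) (adjmxM (c *m v)) !mulmxA.
  rewrite -(mulmxA _ B) -[B *m _](subrK 1%:M) -opprB stein.
  rewrite mulmxDr mulmx1 mulmxN mulmxA mulmxDl mulNmx -(mulmxA _ (eps^t*)) -adjmxM cv.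
  by rewrite adjmx0 mulmx0 oppr0 add0r.
by rewrite subrK.
Qed.

(** Put a_j = |c v B^j|^2. The energy changes by the telescoping amount a_(J+1) - a_1. Here a_1 =
    a_0, as c v has no constant term, and a_(J+1) <= a_J < a_0 by observability. *)
Lemma shift_energy_replace (c : 'rV[C]_N) v :
  c *m c^t* = 1%:M -> c *m v *m eps = 0 -> c *m v != 0 ->
  shift_energy (replace_row c v (v *m B)) < shift_energy v.
Proof.
move=> cc cv cv0; pose a j := fsq (shiftn j (c *m v)).
have -> : shift_energy (replace_row c v (v *m B)) =
    shift_energy v - \sum_(j < J) a j.+1 + \sum_(j < J) a j.+2.
  rewrite /shift_energy -sumrB -big_split; apply: eq_bigr => j _.
  by rewrite shiftn_replace (replace_row_fsq _ _ cc) shiftnS -!shiftnM.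
rewrite -addrA gtrDl addrC subr_lt0.
have a1 : a 1%N = a 0%N by rewrite /a /= [RHS]fsq_eps_shift cv fsq0 add0r.
have aJ : a J.+1 < a 0%N.
  by apply: le_lt_trans (stable cv0); rewrite /a /=; exact: fsq_shift_le.
have : \sum_(j < J) a j.+2 + a 1%N = \sum_(j < J) a j.+1 + a J.+1.
  by rewrite -(big_ord_recr J (fun j => a j.+1)) big_ord_recl addrC.
move=> h; rewrite -(ltrD2r (a 1%N)) h ltrD2l a1; exact: aJ.
Qed.

Definition pair_gap (u v : 'M[C]_(N, m)) : C :=
  fsq u + fsq v - pairing R0 u v - (pairing R0 u v)^*.

Lemma pair_gap_real u v : (pair_gap u v)^* = pair_gap u v.
Proof. by rewrite /pair_gap !rmorphB rmorphD /= conjCK !fsq_real addrAC. Qed.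

(* Maximize the pairing minus a small multiple of the shift energy of v.  If a combination c of
   the rows of v vanishes at 0, shifting it back preserves the pairing and lowers the energy. *)
Lemma outer_reduction :
  (forall u v : 'M[C]_(N, m), (forall i, pairing (L i) u v = 0) ->
     (forall c : 'rV[C]_N, c *m v *m eps = 0 -> c *m v = 0) -> 0 <= pair_gap u v) ->
  forall u v : 'M[C]_(N, m), (forall i, pairing (L i) u v = 0) -> 0 <= pair_gap u v.
Proof.
move=> H u0 v0 orth0; case: (boolP (0 <= pair_gap u0 v0)) => // neg.
rewrite ge0_Re ?pair_gap_real // -ltNge in neg.
pose c0 := complex.Re (fsq u0 + fsq v0).
pose psi u v := complex.Re (pairing R0 u v).
have gapE u v : complex.Re (pair_gap u v) = complex.Re (fsq u + fsq v) - 2 * psi u v.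
  by rewrite /pair_gap !ReD !ReN cRe_conj /psi; lra.
pose en v := complex.Re (shift_energy v).
have en0 v : 0 <= en v by apply: Re_ge0; exact: shift_energy_ge0.
pose d := psi u0 v0 - c0 / 2.
have d0 : 0 < d by move: neg; rewrite gapE -/c0 /d; lra.
(* The penalty at (u0, v0) stays below the excess d of the pairing over c0 / 2, so the minimizer of
   f still has pairing above c0 / 2. *)
pose eta := d / (en v0 + 1).
have eta0 : 0 < eta by rewrite divr_gt0 // ltr_pwDr.
have eta1 : eta * en v0 < d.
  by rewrite /eta mulrAC ltr_pdivrMr ?ltr_pwDr // ltr_pM2l // ltrDl.
(* Pairs (u, v) are stored as one matrix. The norm bound makes K compact and keeps a pairing above
   c0 / 2 contradictory; [replace_row] respects both conditions. *)
pose K := [set A : 'M[C]_(N, m + m) | (forall i, pairing (L i) (lsubmx A) (rsubmx A) = 0)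
  /\ complex.Re (fsq A) <= c0].
pose f (A : 'M[C]_(N, m + m)) := eta * en (rsubmx A) - psi (lsubmx A) (rsubmx A).
have c00 : 0 <= c0 by rewrite /c0 ReD addr_ge0 // Re_ge0 // fsq_ge0.
have cl : mcont (fun t => lsubmx (@mxdec R N (m + m) t)) by apply: mcont_lsub; exact: mcont_dec.
have cr : mcont (fun t => rsubmx (@mxdec R N (m + m) t)) by apply: mcont_rsub; exact: mcont_dec.
have cpair M : ccont (fun t => pairing M (lsubmx (@mxdec R N (m + m) t)) (rsubmx (mxdec t))).
  apply: ccont_tr; apply: mcontM; last exact: mcont_adj.
  by apply: mcontM => //; exact: mcont_cst.
have [A KA Amin] : exists2 A, K A & forall A', K A' -> f A <= f A'.
  apply: (@mx_evt R N (m + m) K f (1 + c0)).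
  - exists (row_mx u0 v0); split=> [i|]; first by rewrite row_mxKl row_mxKr.
    by rewrite fsq_row_mx.
  - by rewrite addr_ge0.
  - by move=> A' [_ h] i j; apply: le_trans (modu_fsq _ _ _) _; rewrite lerD2l.
  - have -> : [set t | K (@mxdec R N (m + m) t)] =
        (\bigcap_(i in [set: I]) [set t | (pairing (L i) (lsubmx (@mxdec R N (m + m) t))
           (rsubmx (mxdec t)))%:M = 0 :> 'M[C]_1])
        `&` [set t | 0 <= complex.Re (c0%:C%C - fsq (@mxdec R N (m + m) t))].
      apply/seteqP; split => t /=; rewrite /K /= ReD ReN subr_ge0 => -[h1 h2]; split => //.
        by move=> i _ /=; rewrite h1 raddf0.
      by move=> i; have /= /matrixP /(_ 0 0) := h1 i Logic.I; rewrite !mxE eqxx mulr1n.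
    apply: closedI; last first.
      apply: closed_ccont_Re_ge0; apply: ccontD; first exact: ccont_cst.
      under eq_fun do rewrite -mulN1r; apply: ccontM; first exact: ccont_cst.
      by apply: ccont_fsq; exact: mcont_dec.
    apply: closed_bigI => i _; apply: closed_mcont_eq0 => a b.
    rewrite (ord1 a) (ord1 b); under eq_fun do rewrite mxE eqxx mulr1n.
    exact: cpair.
  - have c1 : ccont (fun t => shift_energy (rsubmx (@mxdec R N (m + m) t))).
      apply: ccont_sum => j; apply: ccont_fsq.
      have : forall j, mcont (fun t => shiftn j (rsubmx (@mxdec R N (m + m) t))).
        by elim=> [//|l IH] /=; apply: mcontM => //; exact: mcont_cst.
      by [].
    have -> : (fun t => f (@mxdec R N (m + m) t)) = (fun t => complex.Re
        (eta%:C%C * shift_energy (rsubmx (@mxdec R N (m + m) t))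
         + (-1) * pairing R0 (lsubmx (@mxdec R N (m + m) t)) (rsubmx (mxdec t)))).
      by apply/funext => t; rewrite /f /en /psi ReD Re_scale mulN1r ReN.
    suff [] : ccont (fun t => eta%:C%C * shift_energy (rsubmx (@mxdec R N (m + m) t))
         + (-1) * pairing R0 (lsubmx (@mxdec R N (m + m) t)) (rsubmx (mxdec t))) by [].
    by apply: ccontD; apply: ccontM => //; exact: ccont_cst.
set u := lsubmx A; set v := rsubmx A.
have [orth hA] := KA; rewrite -/u -/v in orth.
have KAuv : K (row_mx u v) by rewrite hsubmxK.
have fA : f A = eta * en v - psi u v by [].
have K0 : K (row_mx u0 v0).
  by split=> [i|]; rewrite ?row_mxKl ?row_mxKr // fsq_row_mx.
have psi_gt : c0 / 2 < psi u v.
  have := Amin _ K0; rewrite fA /f row_mxKl row_mxKr.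
  by have := mulr_ge0 (ltW eta0) (en0 v); rewrite /d in eta1; lra.
have gap_neg : complex.Re (pair_gap u v) < 0.
  have -> : complex.Re (pair_gap u v) = complex.Re (fsq A) - 2 * psi u v.
    by rewrite gapE -fsq_row_mx hsubmxK.
  lra.
suff /Re_ge0 : 0 <= pair_gap u v by rewrite leNgt gap_neg.
apply: H => // c cv; case: (eqVneq (c *m v) 0) => // cv0.
have c0' : fsq c != 0.
  by apply: contra_neq cv0 => /fsq_eq0 ->; rewrite mul0mx.
pose s := (sqrtC (fsq c))^-1; pose c' := s *: c.
have cc : c' *m c'^t* = 1%:M.
  rewrite [LHS]mx11_scalar -fsq_row fsqZ /s normfV ger0_norm ?sqrtC_ge0 ?fsq_ge0 //.
  by rewrite exprVn sqrtCK mulVf.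
have s0 : s != 0 by rewrite invr_eq0 sqrtC_eq0.
have cv' : c' *m v *m eps = 0 by rewrite -!scalemxAl cv scaler0.
have cv0' : c' *m v != 0 by rewrite -scalemxAl scaler_eq0 negb_or s0.
pose u' := replace_row c' u (u *m B); pose v' := replace_row c' v (v *m B).
have le_replace w : fsq (replace_row c' w (w *m B)) <= fsq w.
  rewrite replace_row_fsq // -addrA gerDl addrC subr_le0 mulmxA; exact: fsq_shift_le.
have K' : K (row_mx u' v').
  split=> [i|]; rewrite ?row_mxKl ?row_mxKr; first by rewrite pairing_replace.
  apply: le_trans hA; apply: Re_le; rewrite -[A]hsubmxK !fsq_row_mx.
  by apply: lerD; exact: le_replace.
have := Amin _ K'; rewrite fA /f row_mxKl row_mxKr /psi pairing_replace // lerD2r.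
by rewrite ler_pM2l // leNgt Re_lt // shift_energy_replace.
Qed.

End OuterReduction.

(** * Duality *)

Section Norm1.
Variable R : realType.
Local Notation C := (Cplx R).

Definition mxnorm1 p q (A : 'M[C]_(p, q)) : R := \sum_i \sum_j modu (A i j).

Lemma mxnorm1_ge0 p q (A : 'M[C]_(p, q)) : 0 <= mxnorm1 A.
Proof. by apply: sumr_ge0 => i _; apply: sumr_ge0 => j _; exact: modu_ge0. Qed.

Lemma modu_le_norm1 p q (A : 'M[C]_(p, q)) i j : modu (A i j) <= mxnorm1 A.
Proof.
rewrite /mxnorm1 (bigD1 i) //= (bigD1 j) //= -addrA lerDl addr_ge0 //.
  by apply: sumr_ge0 => l _; exact: modu_ge0.
by apply: sumr_ge0 => l _; apply: sumr_ge0 => l' _; exact: modu_ge0.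
Qed.

Lemma mxnorm1_bound p q (A : 'M[C]_(p, q)) b :
  (forall i j, modu (A i j) <= b) -> mxnorm1 A <= p%:R * (q%:R * b).
Proof.
move=> h; apply: le_trans (_ : \sum_(i < p) \sum_(j < q) b <= _).
  by apply: ler_sum => i _; apply: ler_sum => j _.
by rewrite !sumr_const !card_ord -(mulr_natl b) -(mulr_natl (_ * b)).
Qed.

Lemma mxnorm1M p q r (A : 'M[C]_(p, q)) (B : 'M[C]_(q, r)) :
  mxnorm1 (A *m B) <= mxnorm1 A * mxnorm1 B.
Proof.
rewrite /mxnorm1 mulr_suml; apply: ler_sum => i _.
apply: le_trans (_ : \sum_j \sum_l modu (A i l) * modu (B l j) <= _).
  apply: ler_sum => j _; rewrite mxE; apply: le_trans (modu_sum _ _ _) _.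
  by apply: ler_sum => l _; rewrite moduM.
rewrite exchange_big /= mulr_suml; apply: ler_sum => l _.
rewrite -mulr_sumr; apply: ler_wpM2l; first exact: modu_ge0.
rewrite (bigD1 l) //= lerDl; apply: sumr_ge0 => l' _; apply: sumr_ge0 => j _.
exact: modu_ge0.
Qed.

(** Entries of a Gram matrix satisfy |P_ij| <= (P_ii + P_jj) / 2. *)
Lemma psd_entry_bound d (P : 'M[C]_d) b : psd P ->
  (forall i, modu (P i i) <= b) -> forall i j, modu (P i j) <= b.
Proof.
move=> /psd_fact[T PE] hb i j.
have diag l : \sum_s modu (T l s) ^+ 2 <= b.
  apply: le_trans (hb l); have -> : P l l = (\sum_s modu (T l s) ^+ 2)%:C%C.
    rewrite PE mxE rmorph_sum; apply: eq_bigr => s _.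
    by rewrite !mxE -normCK moduE rmorphXn.
  apply: le_trans (ler_norm _) _; by rewrite -lecR -moduE normc_def /= expr0n /= addr0 sqrtr_sqr.
rewrite PE mxE; apply: le_trans (modu_sum _ _ _) _.
apply: le_trans (_ : \sum_s (modu (T i s) ^+ 2 + modu (T j s) ^+ 2) / 2 <= _).
  apply: ler_sum => s _; rewrite !mxE moduM modu_conj.
  have := sqr_ge0 (modu (T i s) - modu (T j s)); nra.
rewrite -mulr_suml big_split /=; have := diag i; have := diag j; lra.
Qed.

(** If b < 0, then t = -b / (1 + a - b) lies in (0, 1] and makes t a + b negative. *)
Lemma quad_ge0 (a b : R) : 0 <= a ->
  (forall t, 0 < t <= 1 -> 0 <= t ^+ 2 * a + t * b) -> 0 <= b.
Proof.
move=> a0 h; case: (leP 0 b) => // b0.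
pose s := 1 + a - b; have s0 : 0 < s by rewrite /s; lra.
have t01 : 0 < - b / s <= 1.
  by rewrite divr_gt0 ?oppr_gt0 //= ler_pdivrMr // mul1r /s; lra.
have := h _ t01; set t := - b / s => ht.
have ts : t * s = - b by rewrite /t divfK // gt_eqF.
have t0 : 0 < t by case/andP: t01.
have h1 : 0 <= t * a + b.
  by rewrite -(pmulr_rge0 _ t0) mulrDr mulrA -expr2.
move: ts h1; rewrite /s; nra.
Qed.

Lemma first_variation d (Y V : 'M[C]_d) :
  (forall t : R, 0 < t <= 1 -> complex.Re (fsq Y) <= complex.Re (fsq (Y + t%:C%C *: V))) ->
  0 <= complex.Re (\tr (Y *m V^t*)).
Proof.
move=> h; suff : 0 <= 2 * complex.Re (\tr (Y *m V^t*)) by lra.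
apply: (@quad_ge0 (complex.Re (fsq V))); first exact/Re_ge0/fsq_ge0.
move=> t t01; have := h t t01; have t0 : 0 <= t by case/andP: t01 => /ltW.
rewrite fsqD adjmxZ -scalemxAr mxtraceZ fsqZ !ReD.
rewrite cRe_conj.
have -> : (t%:C%C : C)^* = t%:C%C by apply: conj_Creal; rewrite ger0_real // lecR.
rewrite ger0_norm ?lecR // -rmorphXn /= !Re_scale; lra.
Qed.

End Norm1.

(** Contractivity of X is quadratic in X; positivity of 1 + [lmi_lift X] expresses it by a matrix
    that is real-affine in X, which makes convex duality applicable. *)
HB.lock Definition lmi_lift (C : numClosedFieldType) m (X : 'M[C]_m) : 'M[C]_(m + m) :=
  block_mx 0 X (X^t*) 0.

HB.lock Definition lin_part (C : numClosedFieldType) m k (f0 f1 : 'M[C]_(m, k))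
    (e0 e1 : 'M[C]_(k, m)) (D : 'M[C]_k) : 'M[C]_m :=
  f0 *m D *m e0 + f1 *m D *m e1.

Section LmiLift.
Variables (C : numClosedFieldType) (m : nat).
Implicit Type X : 'M[C]_m.

Lemma lmi_liftE X : lmi_lift X = block_mx 0 X (X^t*) 0.
Proof. by rewrite lmi_lift.unlock. Qed.

Lemma lmi_lift_mul X : lmi_lift X = col_mx 1%:M 0 *m X *m row_mx 0 1%:M
   + (col_mx 1%:M 0 *m X *m row_mx 0 1%:M)^t*.
Proof.
rewrite lmi_liftE mul_col_mx mul1mx mul0mx mul_col_row !mulmx0 mulmx1 mul0mx.
by rewrite tr_block_mx map_block_mx add_block_mx !adjmx0 !addr0 !add0r.
Qed.

Lemma lmi_liftD X X' : lmi_lift (X + X') = lmi_lift X + lmi_lift X'.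
Proof. by rewrite !lmi_liftE add_block_mx adjmxD !addr0. Qed.

Lemma lmi_liftZ (t : C) X : t^* = t -> lmi_lift (t *: X) = t *: lmi_lift X.
Proof. by move=> tR; rewrite !lmi_liftE scale_block_mx adjmxZ tR !scaler0. Qed.

Lemma lmi_lift_herm X : (lmi_lift X)^t* = lmi_lift X.
Proof. by rewrite !lmi_liftE tr_block_mx map_block_mx !adjmx0 trmxCK. Qed.

Lemma psd_lmi X : psd (1%:M + lmi_lift X) -> psd (1%:M - X *m X^t*).
Proof.
move=> [_ h]; apply: contr_psd => w.
(* Schur complement: with second component - w X the form reduces to |w|^2 - |w X|^2. *)
have := h (row_mx w (- (w *m X))); rewrite lmi_liftE (@scalar_mx_block C m m 1).
rewrite add_block_mx !addr0 !add0r mul_row_block !mulmx1 adj_row_mx mul_row_col.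
rewrite subrr mul0mx addr0 mulNmx mulmxBl mxE [X in _ + X]mxE subr_ge0.
by rewrite !fsq_row adjmxM !mulmxA.
Qed.

Lemma tr_lmi_lift p (T1 T2 : 'M[C]_(m, p)) X :
  let T := col_mx T1 T2 in
  \tr (T *m T^t* *m lmi_lift X) = \tr (T1^t* *m X *m T2) + (\tr (T1^t* *m X *m T2))^*.
Proof.
rewrite /= -mulmxA mxtrace_mulC lmi_liftE tr_col_mx map_row_mx mul_row_block.
rewrite !mulmx0 addr0 add0r mul_row_col mxtraceD addrC; congr (_ + _).
by rewrite -mxtrace_adj !adjmxM !trmxCK !mulmxA.
Qed.

Lemma lmi_diag X i : lmi_lift X i i = 0.
Proof.
by rewrite lmi_liftE; case: (split_ordP i) => j ->; rewrite ?block_mxEul ?block_mxEdr mxE.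
Qed.

End LmiLift.

Section LinPart.
Variables (C : numClosedFieldType) (m k : nat).
Variables (f0 f1 : 'M[C]_(m, k)) (e0 e1 : 'M[C]_(k, m)).
Local Notation L := (lin_part f0 f1 e0 e1).

Lemma lin_partD D D' : L (D + D') = L D + L D'.
Proof. by rewrite !lin_part.unlock !mulmxDr !mulmxDl addrACA. Qed.

Lemma lin_partZ a D : L (a *: D) = a *: L D.
Proof. by rewrite !lin_part.unlock scalerDr -!scalemxAr -!scalemxAl. Qed.

Lemma lin_partK D : e0 *m f0 = 1%:M -> e0 *m f1 = 0 -> e0 *m L D *m f0 = D.
Proof.
move=> h0 h1; rewrite lin_part.unlock mulmxDr !mulmxA h0 h1 !mul0mx addr0 mul1mx.
by rewrite -mulmxA h0 mulmx1.
Qed.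

End LinPart.

Section Duality.
Variable R : realType.
Local Notation C := (Cplx R).
Variables (m k : nat) (R0 : 'M[C]_m) (f0 f1 : 'M[C]_(m, k)) (e0 e1 : 'M[C]_(k, m)).
Hypotheses (e0f0 : e0 *m f0 = 1%:M) (e0f1 : e0 *m f1 = 0).
Local Notation L := (lin_part f0 f1 e0 e1).

Lemma psd_Re (d : nat) (P : 'M[C]_d) :
  psd P <-> P^t* - P = 0 /\ forall w : 'rV[C]_d, 0 <= complex.Re ((w *m P *m w^t*) 0 0).
Proof.
have herm : P^t* = P -> forall w : 'rV[C]_d, ((w *m P *m w^t*) 0 0)^* = (w *m P *m w^t*) 0 0.
  move=> hP w; have /matrixP /(_ 0 0) : (w *m P *m w^t*)^t* = w *m P *m w^t*.
    by rewrite !adjmxM trmxCK hP mulmxA.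
  by rewrite !mxE.
split=> [[hP h]|[hP h]]; split.
- by rewrite hP subrr.
- by move=> w; apply: Re_ge0.
- by apply/eqP; rewrite -subr_eq0 hP.
- have hP' : P^t* = P by apply/eqP; rewrite -subr_eq0 hP.
  by move=> w; rewrite ge0_Re ?herm.
Qed.

Lemma mxnorm1B p q (A B : 'M[C]_(p, q)) : mxnorm1 (A - B) <= mxnorm1 A + mxnorm1 B.
Proof.
rewrite /mxnorm1 -big_split; apply: ler_sum => a _; rewrite -big_split.
apply: ler_sum => c _ /=; have -> : (A - B) a c = A a c + - B a c by rewrite mxE [X in _ + X]mxE.
by apply: le_trans (moduD _ _) _; rewrite moduN.
Qed.

(** Z packs two unknowns, the parameter S in the upper left block and a positive matrix P in the
    lower right one; a zero gap solves the matrix inequality for S. *)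
Definition lmi_gap (Z : 'M[C]_(k + (m + m))) : 'M[C]_(m + m) :=
  drsubmx Z - (1%:M + lmi_lift (R0 + L (ulsubmx Z))).

Lemma psdD d (P Q : 'M[C]_d) : psd P -> psd Q -> psd (P + Q).
Proof.
move=> [hP pP] [hQ pQ]; split=> [|w]; first by rewrite adjmxD hP hQ.
by rewrite mulmxDr mulmxDl mxE addr_ge0.
Qed.

Lemma psdZ d (P : 'M[C]_d) (t : R) : 0 <= t -> psd P -> psd (t%:C%C *: P).
Proof.
move=> t0 [hP pP]; have t0' : (0 : C) <= t%:C%C by rewrite lecR.
split=> [|w]; first by rewrite adjmxZ hP geC0_conj.
by rewrite -scalemxAr -scalemxAl mxE mulr_ge0.
Qed.

Lemma lmi_gap_mcont : mcont (fun t => lmi_gap (@mxdec R _ _ t)).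
Proof.
have cdr : mcont (fun t => drsubmx (@mxdec R (k + (m + m)) (k + (m + m)) t)).
  by apply: mcont_rsub; apply: mcont_dsub; exact: mcont_dec.
have cul : mcont (fun t => ulsubmx (@mxdec R (k + (m + m)) (k + (m + m)) t)).
  by apply: mcont_lsub; apply: mcont_usub; exact: mcont_dec.
have cc p q (A : 'M[C]_(p, q)) := @mcont_cst R
  'rV[R]_((k + (m + m)) * (k + (m + m)) + (k + (m + m)) * (k + (m + m))) p q A.
have cL : mcont (fun t => R0 + L (ulsubmx (@mxdec R (k + (m + m)) (k + (m + m)) t))).
  apply: mcontD => //; under eq_fun do rewrite lin_part.unlock.
  by apply: mcontD; apply: mcontM => //; apply: mcontM.
apply: mcontD => //; apply: mcontN; apply: mcontD => //.
under eq_fun do rewrite lmi_lift_mul.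
apply: mcontD; last apply: mcont_adj; by apply: mcontM => //; apply: mcontM.
Qed.

Definition lmi_dom : set 'M[C]_(k + (m + m)) :=
  [set Z | [/\ psd (drsubmx Z), ursubmx Z = 0 & dlsubmx Z = 0]].

Lemma lmi_dom_block (S : 'M[C]_k) P : psd P -> lmi_dom (block_mx S 0 0 P).
Proof. by move=> pP; split; rewrite ?block_mxKdr ?block_mxKur ?block_mxKdl. Qed.

(** Coercivity. The lift has zero diagonal, so a bound on the gap bounds the diagonal of P and, by
    positivity, all of P. This bounds R0 + L S, from which S is recovered as e0 (L S) f0. *)
Lemma lmi_gap_bounded (M : R) : 0 <= M -> exists2 b, 0 <= b & forall Z, lmi_dom Z ->
  complex.Re (fsq (lmi_gap Z)) <= M -> forall i j, modu (Z i j) <= b.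
Proof.
move=> M0; pose d := (m + m)%N.
pose bR := m%:R * (m%:R * (2 + M + (1 + M))).
pose bS := mxnorm1 e0 * (bR + mxnorm1 R0) * mxnorm1 f0.
have bR0 : 0 <= bR by rewrite !mulr_ge0 ?ler0n // !addr_ge0.
have bS0 : 0 <= bS by rewrite !mulr_ge0 ?addr_ge0 ?mxnorm1_ge0.
exists (2 + M + bS) => [|Z [pP ur dl] hM]; first by rewrite !addr_ge0.
set P := drsubmx Z in pP; set S := ulsubmx Z; set Y := lmi_gap Z in hM.
have Yb i j : modu (Y i j) <= 1 + M by apply: le_trans (modu_fsq _ _ _) _; rewrite lerD2l.
have PE : P = Y + (1%:M + lmi_lift (R0 + L S)) by rewrite /Y /lmi_gap subrK.
have Pb : forall i j, modu (P i j) <= 2 + M.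
  apply: psd_entry_bound => // i; have -> : P i i = Y i i + 1.
    by rewrite PE mxE [X in _ + X]mxE lmi_diag addr0 [X in _ + X]mxE eqxx.
  by apply: le_trans (moduD _ _) _; rewrite modu1; have := Yb i i; lra.
have Rb i j : modu ((R0 + L S) i j) <= 2 + M + (1 + M).
  have -> : (R0 + L S) i j = P (lshift m i) (rshift m j) - Y (lshift m i) (rshift m j).
    have PY : P - Y = block_mx 1%:M (R0 + L S) ((R0 + L S)^t*) 1%:M.
      rewrite PE addrAC subrr add0r lmi_liftE (@scalar_mx_block C m m 1).
      by rewrite add_block_mx !addr0 !add0r.
    have /matrixP /(_ (lshift m i) (rshift m j)) := PY; rewrite block_mxEur => <-.
    by rewrite mxE [X in _ + X]mxE.
  by apply: le_trans (moduD _ _) _; rewrite moduN lerD.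
have Sb i j : modu (S i j) <= bS.
  apply: le_trans (modu_le_norm1 _ _ _) _.
  rewrite -(@lin_partK C m k f0 f1 e0 e1 S e0f0 e0f1); apply: le_trans (mxnorm1M _ _) _.
  apply: ler_wpM2r; first exact: mxnorm1_ge0.
  apply: le_trans (mxnorm1M _ _) _; apply: ler_wpM2l; first exact: mxnorm1_ge0.
  have -> : L S = (R0 + L S) + - R0 by rewrite addrAC subrr add0r.
  apply: le_trans (_ : mxnorm1 (R0 + L S) + mxnorm1 R0 <= _).
    exact: mxnorm1B.
  by rewrite lerD2r; apply: mxnorm1_bound.
move=> i j; rewrite -[Z]submxK ur dl.
case: (split_ordP i) => i' ->; case: (split_ordP j) => j' ->.
- by rewrite block_mxEul; apply: le_trans (Sb _ _) _; rewrite lerDr addr_ge0.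
- by rewrite block_mxEur mxE modu0 !addr_ge0.
- by rewrite block_mxEdl mxE modu0 !addr_ge0.
- by rewrite block_mxEdr; apply: le_trans (Pb _ _) _; rewrite lerDl.
Qed.

Lemma lmi_minimizer : exists2 Z, lmi_dom Z & forall Z', lmi_dom Z' ->
  complex.Re (fsq (lmi_gap Z)) <= complex.Re (fsq (lmi_gap Z')).
Proof.
pose f Z := complex.Re (fsq (lmi_gap Z)).
have f0' Z : 0 <= f Z by apply: Re_ge0; exact: fsq_ge0.
have dom0 : lmi_dom 0.
  split; rewrite -?[0](@block_mx_const C k (m + m) k (m + m)) ?block_mxKdr ?block_mxKur ?block_mxKdl //.
  by split=> [|w]; rewrite ?adjmx0 // mulmx0 mul0mx mxE.
have [b b0 hb] := lmi_gap_bounded (f0' 0).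
pose K := [set Z | lmi_dom Z /\ f Z <= f 0].
have [Z [dZ fZ] Zmin] : exists2 Z, K Z & forall Z', K Z' -> f Z <= f Z'.
  apply: (mx_evt (b := b)) => //.
  - by exists 0.
  - by move=> Z [dZ fZ]; exact: hb.
  - have cdec := @mcont_dec R (k + (m + m)) (k + (m + m)).
    have cdr : mcont (fun t => drsubmx (@mxdec R (k + (m + m)) (k + (m + m)) t)).
      by apply: mcont_rsub; apply: mcont_dsub.
    have -> : [set t | K (@mxdec R (k + (m + m)) (k + (m + m)) t)] =
      [set t | (drsubmx (@mxdec R (k + (m + m)) (k + (m + m)) t))^t* - drsubmx (mxdec t) = 0]
      `&` (\bigcap_(w in [set: 'rV[C]_(m + m)])
        [set t | 0 <= complex.Re ((w *m drsubmx (@mxdec R (k + (m + m)) (k + (m + m)) t) *m w^t*) 0 0)])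
      `&` ([set t | ursubmx (@mxdec R (k + (m + m)) (k + (m + m)) t) = 0]
      `&` [set t | dlsubmx (@mxdec R (k + (m + m)) (k + (m + m)) t) = 0])
      `&` [set t | 0 <= complex.Re ((f 0)%:C%C - fsq (lmi_gap (@mxdec R _ _ t)))].
      apply/seteqP; split => t.
        move=> [[/psd_Re[h1 h2] h3 h4] h5]; do 3?split => //.
          by move=> w _; exact: h2.
        by rewrite /= ReD ReN subr_ge0.
      move=> [[[h1 h2] [h3 h4]] h5]; split.
        by split => //; apply/psd_Re; split=> // w; exact: h2.
      by move: h5; rewrite /= ReD ReN subr_ge0.
    apply: closedI; last first.
      apply: closed_ccont_Re_ge0; apply: ccontD; first exact: ccont_cst.
      under eq_fun do rewrite -mulN1r; apply: ccontM; first exact: ccont_cst.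
      by apply: ccont_fsq; exact: lmi_gap_mcont.
    apply: closedI; first apply: closedI.
    + apply: closed_mcont_eq0; apply: mcontD; last exact: mcontN.
      exact: mcont_adj.
    + apply: closed_bigI => w _; apply: closed_ccont_Re_ge0.
      suff h : mcont (fun t => w *m drsubmx (@mxdec R (k + (m + m)) (k + (m + m)) t) *m w^t*) by exact: h.
      by apply: mcontM; [apply: mcontM => //|]; exact: mcont_cst.
    + apply: closedI; apply: closed_mcont_eq0.
        by apply: mcont_rsub; apply: mcont_usub.
      by apply: mcont_lsub; apply: mcont_dsub.
  - by have [] := ccont_fsq lmi_gap_mcont.
exists Z => // Z' dZ'; case: (leP (f Z') (f 0)) => h; first exact: Zmin.
by apply: le_trans fZ (ltW h).
Qed.

(* At the positive matrix P nearest to the affine space of the matrices 1 + lmi_lift, the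
   difference Y is positive and orthogonal to all directions; its factor is a dual pair. *)
Lemma lmi_duality :
  (forall u v : 'M[C]_(m + m, m), (forall D, pairing (L D) u v = 0) -> 0 <= pair_gap R0 u v) ->
  exists S, psd (1%:M - (R0 + L S) *m (R0 + L S)^t*).
Proof.
move=> H; have [Z [pP ur dl] Zmin] := lmi_minimizer.
set P := drsubmx Z in pP; set S := ulsubmx Z; set Y := lmi_gap Z in Zmin.
have YE : Y = P - (1%:M + lmi_lift (R0 + L S)) by [].
clearbody Y.
have tconj (t : R) : (t%:C%C : C)^* = t%:C%C.
  by apply/eqP; rewrite eq_complex /= oppr0 !eqxx.
have varP (V : 'M[C]_(m + m)) : (forall t : R, 0 < t <= 1 -> psd (P + t%:C%C *: V)) ->
    0 <= complex.Re (\tr (Y *m V^t*)).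
  move=> hV; apply: first_variation => t t01.
  have := Zmin _ (lmi_dom_block S (hV t t01)); rewrite /lmi_gap block_mxKdr block_mxKul.
  by rewrite YE addrAC.
have varS D : 0 <= complex.Re (\tr (Y *m (- lmi_lift (L D))^t*)).
  apply: first_variation => t t01.
  have := Zmin _ (lmi_dom_block (S + t%:C%C *: D) pP).
  rewrite /lmi_gap block_mxKdr block_mxKul lin_partD lin_partZ addrA.
  by rewrite lmi_liftD lmi_liftZ // addrA opprD addrA -YE scalerN.
have hY : Y^t* = Y.
  have [hP _] := pP; by rewrite YE adjmxB adjmxD adjmx1 lmi_lift_herm hP.
have pY : psd Y.
  apply/psd_Re; split=> [|w]; first by rewrite hY subrr.
  have := varP (w^t* *m w); rewrite adjmxM trmxCK => h.
  have pw : psd (w^t* *m w) by have := psd_gram (w^t*); rewrite trmxCK.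
  have : 0 <= complex.Re (\tr (Y *m (w^t* *m w))).
    apply: h => t /andP[t0 _]; exact: (psdD pP (psdZ (ltW t0) pw)).
  by rewrite mulmxA mxtrace_mulC mulmxA /mxtrace big_ord1.
(* Shrinking P towards 0 is an admissible variation. *)
have YP : complex.Re (\tr (Y *m P)) <= 0.
  have := varP (- P); rewrite adjmxN; have [-> _] := pP.
  rewrite mulmxN linearN /= ReN oppr_ge0; apply => t /andP[t0 t1].
  have -> : P + t%:C%C *: - P = (1 - t)%:C%C *: P.
    by rewrite rmorphB rmorph1 scalerBl scale1r scalerN.
  by apply: psdZ => //; rewrite subr_ge0.
have [T TE] := psd_fact pY.
pose T1 := usubmx T; pose T2 := dsubmx T.
have TT : T = col_mx T1 T2 by rewrite vsubmxK.
(* The sign makes the trace of Y against a lift equal to minus twice the real part of the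
   pairing. *)
pose u := T1^t*; pose v := - T2^t*.
have trY X : \tr (Y *m lmi_lift X) = - (pairing X u v + (pairing X u v)^*).
  rewrite TE TT tr_lmi_lift /pairing /u /v adjmxN trmxCK mulmxN linearN /=.
  by rewrite rmorphN /= -opprD opprK.
have orthRe D : complex.Re (pairing (L D) u v) = 0.
  have h1 := varS D; have h2 := varS (- D).
  have LN : L (- D) = - L D by rewrite -[- D]scaleN1r lin_partZ scaleN1r.
  have liftN (X : 'M[C]_m) : lmi_lift (- X) = - lmi_lift X.
    by rewrite -[- X]scaleN1r lmi_liftZ ?rmorphN1 // scaleN1r.
  move: h1 h2; rewrite LN liftN opprK adjmxN !lmi_lift_herm mulmxN linearN /=.
  by rewrite trY opprK ReN !ReD cRe_conj; lra.
(* The variation i D supplies the imaginary part. *)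
have orth D : pairing (L D) u v = 0.
  have := orthRe ('i%C *: D); have := orthRe D.
  rewrite lin_partZ /pairing -scalemxAr -scalemxAl mxtraceZ.
  case: (\tr _) => a b /= -> h; congr (_ +i* _)%C; lra.
have gap := H u v orth.
(* As tr Y = |u|^2 + |v|^2, expanding tr (Y Y) gives the trace of Y P minus the pair gap, whose real
   part is at most 0. *)
have Y0 : Y = 0.
  apply: fsq_eq0; apply/eqP; rewrite eq_le fsq_ge0 andbT -subr_ge0 add0r.
  rewrite ge0_Re; last by rewrite rmorphN /= fsq_real.
  rewrite ReN fsqT hY {2}YE mulmxBr mulmxDr mulmx1 lmi_liftD mulmxDr !linearB /= !linearD /=.
  have Re0 : complex.Re (0 : C) = 0 by [].
  rewrite !trY orth !(ReD, ReN, cRe_conj) Re0.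
  have trYE : \tr Y = fsq u + fsq v.
    by rewrite /u /v fsqN !fsq_adj -fsq_col_mx -TT fsqT -TE.
  have := Re_ge0 gap; rewrite /pair_gap trYE !(ReD, ReN, cRe_conj); move: YP; lra.
exists S; apply: psd_lmi; suff <- : P = 1%:M + lmi_lift (R0 + L S) by [].
by apply/eqP; rewrite -subr_eq0 -YE Y0.
Qed.

End Duality.

(** * From the kernel inequalities to a rational interpolant *)

Section Sufficiency.
Variable R : realType.
Local Notation C := (Cplx R).
Variables (n k m : nat) (z : 'I_n -> C).
Variables (e : 'I_n + bool -> 'M[C]_(k, m)) (f : 'I_n + bool -> 'M[C]_(m, k)).
Hypothesis ef_frame : frame z e f.
Hypothesis z1 : forall i, `|z i| < 1.
Hypothesis z0 : forall i, z i != 0.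
Hypothesis zinj : injective z.

Local Notation B := (bshift z e f).
Local Notation eps := (eps e).
Local Notation L := (lin_part (f (inr false)) (f (inr true)) (e (inr false)) (e (inr true))).

Lemma pick_op_split W S : pick_op e f W S = pick_op e f W 0 + L S.
Proof.
rewrite lin_part.unlock; apply: (frame_ext ef_frame) => p.
have [ef _ _] := ef_frame.
rewrite mulmxDr !(frame_opE ef_frame) mulmxDr !mulmxA !ef.
by case: p => [i|[]] /=; rewrite ?raddf0 ?mul0mx ?mul1mx ?addr0 ?add0r.
Qed.

Lemma pick_op_lin S : pick_op e f (fun=> 0) S = L S.
Proof.
rewrite pick_op_split -[RHS]add0r; congr (_ + _); apply: (frame_ext ef_frame) => p.
by rewrite (frame_opE ef_frame) mulmx0; case: p => [i|b]; rewrite mul0mx.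
Qed.

Lemma shiftn_pt N j (r : 'M[C]_(N, m)) :
  shiftn B j.+2 r = \sum_i (z i ^+ j.+2 *: (r *m f (inl i))) *m e (inl i).
Proof.
elim: j => [|j IH]; first exact: (bshift2_comb ef_frame).
rewrite [LHS]/= -[shiftn B j r *m B *m B]/(shiftn B j.+2 r) IH mulmx_suml.
apply: eq_bigr => i _; rewrite -mulmxA (bshift_pt ef_frame) -scalemxAr scalemxAl.
by rewrite scalerA -exprS.
Qed.

Lemma shiftn_fsq N J (r : 'M[C]_(N, m)) :
  fsq r = \sum_(j < J) fsq (shiftn B j r *m eps) + fsq (shiftn B J r).
Proof.
elim: J => [|J IH]; first by rewrite big_ord0 add0r.
by rewrite big_ord_recr /= -addrA -(fsq_shift ef_frame z1).
Qed.

Lemma frame_observable : exists J, forall r : 'rV[C]_m, r != 0 ->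
  fsq (shiftn B J r) < fsq r.
Proof.
pose p i : {poly C} := \prod_(j | j != i) ('X - (z j)%:P).
(* Two coefficients account for the unit vectors; the others give enough moments to evaluate each
   polynomial p_i, which vanishes at all nodes but z_i. *)
pose J := (\sum_i size (p i)).+2; exists J => r r0.
rewrite (shiftn_fsq J r) ltrDr lt_def sumr_ge0 => [|j _]; last exact: fsq_ge0.
rewrite andbT; apply: contra_neq r0 => /eqP.
rewrite psumr_eq0 => [/allP h|j _]; last exact: fsq_ge0.
have vanish j : (j < J)%N -> shiftn B j r *m eps = 0.
  move=> jJ; have := h (Ordinal jJ); rewrite mem_index_enum => /(_ isT) /= /eqP.
  exact: fsq_eq0.
pose x q := r *m f q.
have xi i : x (inl i) = 0.
  have mom j : (j < \sum_i size (p i))%N -> \sum_l z l ^+ j *: (z l ^+ 2 *: x (inl l)) = 0.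
    move=> jJ; rewrite -[RHS](vanish j.+2 jJ) shiftn_pt mulmx_suml.
    apply: eq_bigr => l _; rewrite -mulmxA (e_eps ef_frame) mulmx1 scalerA.
    by rewrite -exprD addn2.
  have : \sum_l (p i).[z l] *: (z l ^+ 2 *: x (inl l)) = 0.
    have sp : (size (p i) <= \sum_i size (p i))%N by rewrite (bigD1 i) //= leq_addr.
    under eq_bigr do rewrite (horner_coef_wide _ sp) scaler_suml.
    rewrite exchange_big big1 //= => j _.
    under eq_bigr do rewrite -scalerA.
    by rewrite -scaler_sumr mom // scaler0.
  rewrite (bigD1 i) //= big1 ?addr0 => [|l li]; last first.
    by rewrite /p horner_prod (bigD1 l) //= !hornerE subrr mul0r scale0r.
  have pz : (p i).[z i] != 0.
    rewrite /p horner_prod prodf_seq_neq0; apply/allP => j _; apply/implyP => ji.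
    by rewrite !hornerE subr_eq0 (inj_eq zinj) eq_sym.
  move=> /(congr1 (fun v => (z i ^+ 2)^-1 *: (((p i).[z i])^-1 *: v))).
  by rewrite !scaler0 !scalerK // expf_neq0.
have x0 : x (inr false) = 0.
  have := vanish 0%N isT; rewrite /= (eps_sum ef_frame) big1 ?add0r // => i _; exact: xi.
have x1 : x (inr true) = 0.
  have := vanish 1%N isT; rewrite /= (bshift_eps_sum ef_frame) big1 ?add0r // => i _.
  by have /= := xi i; rewrite /x => ->; rewrite scaler0.
have [_ fe _] := ef_frame.
rewrite -[r]mulmx1 -fe mulmx_sumr big1 // => q _; rewrite mulmxA.
suff -> : r *m f q = 0 by rewrite mul0mx.
by case: q => [i|[]]; [exact: xi|exact: x1|exact: x0].
Qed.

Variable W : 'I_n -> 'M[C]_k.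

(** Compress the pair by an orthonormal basis Z of the column space of [v *m eps]. By the hypothesis
    on c nothing of v is lost, so the pairing and |v| are unchanged, while |u| can only decrease;
    now [kernel_dual] applies. *)
Lemma kernel_gap N (u v : 'M[C]_(N, m)) : kernel_cond z W ->
  (forall D, pairing (L D) u v = 0) ->
  (forall c : 'rV[C]_N, c *m v *m eps = 0 -> c *m v = 0) ->
  0 <= pair_gap (pick_op e f W 0) u v.
Proof.
move=> hker orth hc.
have [q qE [Z ZZ VZ]] : exists2 q, \rank (v *m eps) = q & exists2 Z : 'M[C]_(q, N),
    Z *m Z^t* = 1%:M & (v *m eps)^t* *m Z^t* *m Z = (v *m eps)^t*.
  have [Z ZZ [VZ _]] := coisometry_basis ((v *m eps)^t*).
  by exists (\rank ((v *m eps)^t*)); [rewrite mxrank_map mxrank_tr|exists Z].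
(* The rows of the difference are combinations of rows of v without constant term. *)
have vZ : Z^t* *m (Z *m v) = v.
  apply/eqP; rewrite -subr_eq0; apply/eqP/row_matrixP => i; rewrite row0.
  have -> : Z^t* *m (Z *m v) - v = (Z^t* *m Z - 1%:M) *m v.
    by rewrite mulmxBl mul1mx mulmxA.
  rewrite row_mul; apply: hc; rewrite -mulmxA -row_mul mulmxBl mul1mx.
  have -> : Z^t* *m Z *m (v *m eps) = v *m eps.
    have := congr1 (fun A : 'M[C]_(k, N) => A^t*) VZ.
    by rewrite (adjmxM _ Z) (adjmxM _ (Z^t*)) !trmxCK mulmxA.
  by rewrite subrr row0.
have fv : fsq v = fsq (Z *m v).
  by rewrite [RHS]fsq_adj_mul adjmxM -mulmxA vZ -fsq_adj_mul.
have vZ' : v^t* *m Z^t* *m Z = v^t*.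
  by have := congr1 (fun A : 'M[C]_(N, m) => A^t*) vZ; rewrite adjmxM trmxCK (adjmxM Z).
have pr M : pairing M (Z *m u) (Z *m v) = pairing M u v.
  rewrite /pairing (adjmxM Z) -!(mulmxA Z) mxtrace_mulC.
  by rewrite -(mulmxA _ _ Z) vZ'.
have free : row_free (Z *m v *m eps).
  rewrite /row_free eqn_leq rank_leq_row /= -[leqLHS]qE -{1}vZ -mulmxA.
  exact: mxrankM_maxr.
have := kernel_dual (W := W) ef_frame z1 (u := Z *m u) hker free.
rewrite -!/(pairing _ _ _) !pr => h.
have {}h : 0 <= fsq (Z *m u) + fsq (Z *m v) - pairing (pick_op e f W 0) u v
   - (pairing (pick_op e f W 0) u v)^*.
  by apply: h => S; rewrite -/(pairing _ _ _) pr pick_op_lin.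
apply: le_trans h _; rewrite /pair_gap fv !lerD2r.
exact: coisometry_contr.
Qed.

Lemma pick_solution : kernel_cond z W ->
  exists S, psd (1%:M - pick_op e f W S *m (pick_op e f W S)^t*).
Proof.
move=> hker; have [ef _ _] := ef_frame.
have [J hJ] := frame_observable.
have h00 : e (inr false) *m f (inr false) = 1%:M by rewrite ef.
have h01 : e (inr false) *m f (inr true) = 0 by rewrite ef raddf0.
have [|S pS] := @lmi_duality R m k (pick_op e f W 0) (f (inr false)) (f (inr true))
    (e (inr false)) (e (inr true)) h00 h01.
- move=> u v; apply: (@outer_reduction R m k (m + m) J _ B _ eps) => //.
  + exact: bshift_stein ef_frame z1.
  + exact: bshift_pick.
  + by move=> D; rewrite -pick_op_lin; exact: bshift_pick.
  + by move=> u' v' h1 h2; apply: kernel_gap.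
by exists S; rewrite pick_op_split.
Qed.

Lemma interpolant : kernel_cond z W ->
  exists p (A : 'M[C]_p) (b : 'M[C]_(p, k)) (c : 'M[C]_(k, p)) (d : 'M[C]_k),
  [/\ psd (1%:M - block_mx A b c d *m (block_mx A b c d)^t*),
      forall i, transfer A b c d (z i) = W i & c *m b = 0].
Proof.
move=> /pick_solution[S pS].
have [G [A [b [c [d [h1 h2 pM]]]]]] :=
  realization_colligation (bshift_stein ef_frame z1) (bshift_pick ef_frame W S) pS.
exists m, A, b, c, d; split=> // [i|].
- rewrite (transfer_interp pM h1 h2 (z1 i) (bshift_pt ef_frame i)) ?(e_eps ef_frame) //.
  by rewrite (frame_opE ef_frame) -mulmxA (e_eps ef_frame) mulmx1.
- apply: (transfer_moment h1 h2 (bshift0 ef_frame) _ (bshift1 ef_frame)).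
  + by rewrite (e_eps ef_frame).
  + by rewrite (e_eps ef_frame).
  + by rewrite (frame_opE ef_frame) -mulmxA (e_eps ef_frame) mulmx0.
Qed.

End Sufficiency.

(** * Transfer functions are in the Schur class *)

Section OperatorNorm.
Variable R : realType.
Local Notation C := (Cplx R).

Lemma enorm_ge0 p (v : 'cV[C]_p) : 0 <= enorm v.
Proof. exact: sqrtr_ge0. Qed.

Lemma enorm_fsq p (v : 'cV[C]_p) : fsq v = (enorm v ^+ 2)%:C%C.
Proof.
rewrite /enorm sqr_sqrtr; last by apply: sumr_ge0 => i _; rewrite exprn_ge0 // modu_ge0.
rewrite fsqE rmorph_sum; apply: eq_bigr => i _.
by rewrite big_ord1 moduE rmorphXn.
Qed.

Lemma enorm_le p q (v : 'cV[C]_p) (w : 'cV[C]_q) : (enorm v <= enorm w) = (fsq v <= fsq w).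
Proof. by rewrite !enorm_fsq lecR ler_pXn2r ?nnegrE ?enorm_ge0. Qed.

Lemma enorm_norm1 p (v : 'cV[C]_p) : enorm v <= mxnorm1 v.
Proof.
have -> : mxnorm1 v = \sum_i modu (v i 0) by apply: eq_bigr => i _; rewrite big_ord1.
have s0 : 0 <= \sum_i modu (v i 0) by apply: sumr_ge0 => i _; exact: modu_ge0.
rewrite -[leRHS]ger0_norm // -sqrtr_sqr; apply: ler_wsqrtr.
rewrite expr2 mulr_suml; apply: ler_sum => i _; rewrite expr2.
apply: ler_wpM2l; first exact: modu_ge0.
by rewrite (bigD1 i) //= lerDl; apply: sumr_ge0 => j _; exact: modu_ge0.
Qed.

Lemma enormZ p (t : R) (v : 'cV[C]_p) : 0 <= t -> enorm (t%:C%C *: v) = t * enorm v.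
Proof.
move=> t0; apply/eqP; rewrite -(eqrXn2 (n := 2)) ?mulr_ge0 ?enorm_ge0 //.
rewrite -(inj_eq (@complexI R)) -enorm_fsq fsqZ enorm_fsq exprMn ger0_norm ?lecR //.
by rewrite -(rmorphXn (real_complex R)) -(rmorphM (real_complex R)).
Qed.

Lemma opnorm_le1 p q (A : 'M[C]_(p, q)) :
  (forall v : 'cV_q, fsq (A *m v) <= fsq v) -> opnorm A <= 1.
Proof.
move=> h; apply: ge_sup.
  exists (enorm (A *m 0)); exists 0 => //=.
  by rewrite -(@ler_sqr R) ?nnegrE ?enorm_ge0 // -lecR -enorm_fsq fsq0 expr1n lecR.
move=> _ [v /= v1 <-]; apply: le_trans v1; by rewrite enorm_le.
Qed.

Lemma opnorm_le1_contr p q (A : 'M[C]_(p, q)) : opnorm A <= 1 ->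
  forall v : 'cV_q, fsq (A *m v) <= fsq v.
Proof.
move=> A1 v; rewrite -enorm_le; case: (eqVneq (enorm v) 0) => [v0|v0].
  have -> : v = 0 by apply: fsq_eq0; rewrite enorm_fsq v0 expr0n.
  by rewrite enorm_le mulmx0 !fsq0.
have vp : 0 < enorm v by rewrite lt_def v0 enorm_ge0.
(* The supremum defining [opnorm] bounds its set only once the set is known to be bounded. *)
have hub : has_ubound [set enorm (A *m v) | v in [set v : 'cV[C]_q | enorm v <= 1]].
  exists (mxnorm1 A * (q%:R * (1%:R * 2))) => _ [w /= w1 <-].
  apply: le_trans (enorm_norm1 _) _; apply: le_trans (mxnorm1M _ _) _.
  apply: ler_wpM2l; first exact: mxnorm1_ge0.
  apply: mxnorm1_bound => i j; apply: le_trans (modu_fsq _ _ _) _.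
  rewrite enorm_fsq /=; have := enorm_ge0 w; nra.
have := ub_le_sup hub (x := enorm (A *m ((enorm v)^-1%:C%C *: v))).
rewrite -scalemxAr enormZ ?invr_ge0 ?enorm_ge0 // => h.
have : (enorm v)^-1 * enorm (A *m v) <= 1.
  apply: le_trans A1; apply: h; exists ((enorm v)^-1%:C%C *: v) => /=.
    by rewrite enormZ ?invr_ge0 ?enorm_ge0 // mulVf.
  by rewrite -scalemxAr enormZ ?invr_ge0 ?enorm_ge0.
by rewrite mulrC ler_pdivrMr // mul1r.
Qed.

(** With y = A v, expand 0 <= |v - A^* y|^2 = |v|^2 - 2 |y|^2 + |A^* y|^2 and use |A^* y| <= |y|. *)
Lemma row_contr_col p q (A : 'M[C]_(p, q)) :
  (forall w : 'rV_p, fsq (w *m A) <= fsq w) -> forall v : 'cV_q, fsq (A *m v) <= fsq v.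
Proof.
move=> h v; set y := A *m v.
have h1 : fsq (A^t* *m y) <= fsq y.
  by have := h (y^t*); rewrite -fsq_adj adjmxM trmxCK fsq_adj.
have : 0 <= fsq (v - A^t* *m y) by exact: fsq_ge0.
rewrite fsqB.
have -> : \tr (v *m (A^t* *m y)^t*) = fsq y.
  by rewrite adjmxM trmxCK mulmxA mxtrace_mulC mulmxA -/y fsqT.
rewrite fsq_real => h2; rewrite -subr_ge0; rewrite -subr_ge0 in h1.
have := addr_ge0 h2 h1; congr (0 <= _); ring.
Qed.

Lemma col_contr_row p q (A : 'M[C]_(p, q)) :
  (forall v : 'cV_q, fsq (A *m v) <= fsq v) -> forall w : 'rV_p, fsq (w *m A) <= fsq w.
Proof.
move=> h w; have := @row_contr_col _ _ (A^t*) _ (w^t*).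
rewrite -[fsq (_ *m w^t*)]fsq_adj adjmxM !trmxCK fsq_adj; apply => w'.
by have := h (w'^t*); rewrite -[fsq (_ *m _^t*)]fsq_adj adjmxM trmxCK fsq_adj.
Qed.

End OperatorNorm.

Section MatrixLimits.
Variables (K : numFieldType) (p q : nat).

Lemma cvg_mx_entries {T} (F : set_system T) {FF : Filter F} (f : T -> 'M[K]_(p, q)) (A : 'M[K]_(p, q)) :
  (forall i j, (fun t => f t i j) @ F --> A i j) -> f @ F --> A.
Proof.
move=> h; apply/cvg_ballP => eps e0; near=> t; split=> // i j.
move: i j; near: t; apply: filter_forall => i; apply: filter_forall => j.
by have /cvg_ballP := h i j; apply.
Unshelve. all: by end_near. Qed.

Lemma cvg_entry {T} (F : set_system T) {FF : Filter F} (f : T -> 'M[K]_(p, q)) (A : 'M[K]_(p, q)) i j :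
  f @ F --> A -> (fun t => f t i j) @ F --> A i j.
Proof. move=> h; apply: (cvg_comp f (fun M : 'M[K]_(p, q) => M i j) h); exact: coord_continuous. Qed.

End MatrixLimits.

Section PolynomialDerivability.
Variable K : numFieldType.

Lemma derivable_poly (p : {poly K}) x : derivable (horner p) x 1.
Proof.
elim/poly_ind: p => [|p r ih].
  have -> : horner (0 : {poly K}) = cst 0 by apply/funext => y; rewrite horner0.
  exact: derivable_cst.
have -> : horner (p * 'X + r%:P) = (fun y => p.[y] * y) + cst r.
  by apply/funext => y; rewrite !hornerE fctE.
apply: derivableD; last exact: derivable_cst.
by apply: derivableM => //; exact: derivable_id.
Qed.

End PolynomialDerivability.

Section MatrixDerivability.
Variables (K : numFieldType) (p q : nat).

Lemma derivable_entries (F : K -> 'M[K]_(p, q)) z :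
  (forall i j, derivable (fun x => F x i j) z 1) -> derivable F z 1.
Proof.
move=> ij; apply/cvg_ex.
exists (\matrix_(i, j) lim (h^-1 *: (((fun x => F x i j) \o shift z) (h *: 1) - F z i j)
   @[h --> 0^'])).
apply: cvg_mx_entries => i j; rewrite mxE.
have -> : (fun t => (t^-1 *: ((F \o shift z) (t *: 1) - F z)) i j)
  = (fun h => h^-1 *: (((fun x => F x i j) \o shift z) (h *: 1) - F z i j)).
  by apply/funext => t; rewrite !mxE.
exact: ij.
Qed.

End MatrixDerivability.

Section RationalTransfer.
Variable R : realType.
Local Notation C := (Cplx R).
Variables (m k : nat) (A : 'M[C]_m) (b : 'M[C]_(m, k)) (c : 'M[C]_(k, m)) (d : 'M[C]_k).

Definition pencil_det (z : C) : C := \det (1%:M - z *: A).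

Definition pencil_num (z : C) : 'M[C]_k := c *m \adj (1%:M - z *: A) *m b.

(** The resolvent is written as adjugate over determinant, so that the entries are quotients of
    polynomials and visibly derivable. *)
Definition rational_transfer (z : C) : 'M[C]_k :=
  d + z *: ((pencil_det z)^-1 *: pencil_num z).

Lemma rational_transferE z : 1%:M - z *: A \in unitmx ->
  rational_transfer z = transfer A b c d z.
Proof.
move=> u; rewrite /rational_transfer /transfer /invmx u; congr (_ + _ *: _).
by rewrite -scalemxAr -scalemxAl.
Qed.

Let M : 'M[{poly C}]_m := 1%:M - 'X *: map_mx polyC A.

Let M_eval z : map_mx (horner_eval z) M = 1%:M - z *: A.
Proof.
rewrite /M map_mxB map_mx1 map_mxZ /= /horner_eval hornerX; congr (_ - _ *: _).
by apply/matrixP => i j; rewrite !mxE /horner_eval hornerC.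
Qed.

Lemma pencil_detE z : pencil_det z = (\det M).[z].
Proof. by rewrite /pencil_det -M_eval det_map_mx. Qed.

Lemma pencil_numE z i j :
  pencil_num z i j = ((map_mx polyC c *m \adj M *m map_mx polyC b) i j).[z].
Proof.
have h p q (X : 'M[C]_(p, q)) : map_mx (horner_eval z) (map_mx polyC X) = X.
  by apply/matrixP => a a'; rewrite !mxE /horner_eval hornerC.
rewrite /pencil_num -M_eval -map_mx_adj -{1}(h _ _ c) -{1}(h _ _ b) -!map_mxM mxE.
by [].
Qed.

Lemma derivable_pencil z i j : pencil_det z != 0 ->
  derivable (fun z => (pencil_det z)^-1 * pencil_num z i j) z 1.
Proof.
move=> h; have -> : (fun z => (pencil_det z)^-1 * pencil_num z i j) =
    (fun z => ((\det M).[z])^-1) * horner ((map_mx polyC c *m \adj M *m map_mx polyC b) i j).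
  by apply/funext => y; rewrite pencil_detE pencil_numE fctE.
apply: derivableM; last exact: derivable_poly.
apply: derivableV; last exact: derivable_poly.
by rewrite -pencil_detE.
Qed.

Lemma derivable_rational z : pencil_det z != 0 -> derivable rational_transfer z 1.
Proof.
move=> h; apply: derivable_entries => i j.
have -> : (fun z => rational_transfer z i j) =
    cst (d i j) + id * (fun z => (pencil_det z)^-1 * pencil_num z i j).
  by apply/funext => y; rewrite [LHS]mxE [X in _ + X]mxE [X in _ + _ * X]mxE.
apply: derivableD; first exact: derivable_cst.
by apply: derivableM; [exact: derivable_id|exact: derivable_pencil].
Qed.

(** The difference quotient at 0 is exactly numerator over determinant, a continuous function with
    value c b at 0. *)
Lemma derive1_rational0 : c *m b = 0 -> derive1 rational_transfer 0 = 0.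
Proof.
move=> cb; rewrite /derive1; apply: cvg_lim => //.
have det0 : pencil_det 0 = 1 by rewrite /pencil_det scale0r subr0 det1.
have num0 : pencil_num 0 = 0 by rewrite /pencil_num scale0r subr0 adj1 mulmx1 cb.
apply: cvg_mx_entries => i j; rewrite mxE.
pose g (z : C) := (pencil_det z)^-1 * pencil_num z i j.
have gc : g @ (0 : C) --> g 0.
  apply/differentiable_continuous/derivable1_diffP; apply: derivable_pencil.
  by rewrite det0 oner_eq0.
have g0 : g 0 = 0 by rewrite /g num0 mxE mulr0.
rewrite g0 in gc; have {}gc : g @ (0 : C)^' --> (0 : C).
  by apply: cvg_trans gc; apply: cvg_app; exact: cvg_within.
apply: cvg_trans gc; apply: near_eq_cvg; near=> h.
have h0 : h != 0 by near: h; exact: nbhs_dnbhs_neq.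
have -> : rational_transfer (h + 0) - rational_transfer 0 =
    h *: ((pencil_det h)^-1 *: pencil_num h).
  by rewrite /rational_transfer addr0 scale0r addr0 addrC addKr.
by rewrite scalerK // mxE.
Unshelve. all: by end_near. Qed.

End RationalTransfer.

Section TransferSchur.
Variable R : realType.
Local Notation C := (Cplx R).
Variables (m k : nat) (A : 'M[C]_m) (b : 'M[C]_(m, k)) (c : 'M[C]_(k, m)) (d : 'M[C]_k).
Hypothesis contr : psd (1%:M - block_mx A b c d *m (block_mx A b c d)^t*).

Lemma rational_transfer_schur1 : c *m b = 0 -> schur1 (rational_transfer A b c d).
Proof.
move=> cb; split; last exact: derive1_rational0.
- move=> z z1; apply: derivable_rational.
  by have := resolvent_unit contr z1; rewrite unitmxE unitfE.
- apply: ge_ereal_sup => _ [z /= z1 <-]; rewrite lee_fin; apply: opnorm_le1.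
  apply: row_contr_col => w; rewrite rational_transferE; last exact: (resolvent_unit contr z1).
  exact: (transfer_contr contr z1 w).
Qed.

End TransferSchur.

(** * Discrete Goursat theorem *)

Section Bisection.
Variable R : realType.

Lemma nested_point (a h : nat -> R) :
  (forall j, a j <= a j.+1) -> (forall j, a j.+1 + h j.+1 <= a j + h j) ->
  (forall j, 0 <= h j) -> exists x, forall j, a j <= x <= a j + h j.
Proof.
move=> ha hb h0.
have mono i j : (i <= j)%N -> a i <= a j.
  by move=> ij; apply: (homo_leq (r := fun x y : R => x <= y)) ij => //; exact: le_trans.
have anti i j : (i <= j)%N -> a j + h j <= a i + h i.
  move=> ij; apply: (homo_leq (f := fun j => a j + h j) (r := fun x y : R => y <= x)) ij => //.
  by move=> y x z xy yz; exact: le_trans yz xy.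
have bound i j : a i <= a j + h j.
  case: (leqP i j) => ij; first by apply: le_trans (mono _ _ ij) _; rewrite lerDl.
  by apply: le_trans (anti _ _ (ltnW ij)); rewrite lerDl.
have hub j : ubound (range a) (a j + h j) by move=> _ [i _ <-].
exists (sup (range a)) => j; apply/andP; split.
  by apply: ub_le_sup; [exists (a 0%N + h 0%N); exact: hub|exists j].
by apply: ge_sup; [exists (a 0%N); exists 0%N|exact: hub].
Qed.

(** If the unit square is bad, some quarter is bad, and so on; the nested bad squares shrink to a
    point where the local hypothesis fails. *)
Lemma bisection (P : R -> R -> R -> Prop) :
  (forall s t h, 0 < h -> P s t (h / 2) -> P (s + h / 2) t (h / 2) ->
     P s (t + h / 2) (h / 2) -> P (s + h / 2) (t + h / 2) (h / 2) -> P s t h) ->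
  (forall x y, 0 <= x <= 1 -> 0 <= y <= 1 -> exists2 d, 0 < d & forall s t h,
     0 < h -> h < d -> 0 <= s -> s + h <= 1 -> 0 <= t -> t + h <= 1 ->
     s <= x <= s + h -> t <= y <= t + h -> P s t h) ->
  P 0 0 1.
Proof.
move=> quarter localP; apply: contrapT => bad.
pose good (q : R * R) h (q' : R * R) := [/\ q'.1 = q.1 \/ q'.1 = q.1 + h / 2,
  q'.2 = q.2 \/ q'.2 = q.2 + h / 2 & ~ P q'.1 q'.2 (h / 2)].
have step q h : 0 < h -> ~ P q.1 q.2 h -> exists q', good q h q'.
  move=> h0 nP; apply: contrapT => no; apply: nP; apply: quarter => //;
  apply: contrapT => nQ; apply: no.
  - by exists (q.1, q.2); split => //; left.
  - by exists (q.1 + h / 2, q.2); split => //; [right|left].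
  - by exists (q.1, q.2 + h / 2); split => //; [left|right].
  - by exists (q.1 + h / 2, q.2 + h / 2); split => //; right.
(* Chooses a bad quarter, with q itself as default value; the default never occurs along [seqq]. *)
pose next q h := if pselect (exists q', good q h q') is left e then sval (cid e) else q.
pose H j : R := (2 ^+ j)^-1.
have Hp j : 0 < H j by rewrite invr_gt0 exprn_gt0.
have HS j : H j.+1 = H j / 2 by rewrite /H exprS invfM mulrC.
pose fix seqq j := if j is j'.+1 then next (seqq j') (H j') else (0, 0).
have nextP q h : 0 < h -> ~ P q.1 q.2 h -> good q h (next q h).
  rewrite /next => h0 nP; case: pselect => [ex|ne]; first exact: (svalP (cid ex)).
  by case: ne; exact: step.
have badj j : ~ P (seqq j).1 (seqq j).2 (H j).
  elim: j => [|j IH]; first by rewrite /H expr0 invr1.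
  by rewrite HS; have [_ _] := nextP (seqq j) (H j) (Hp j) IH.
have goodj j : good (seqq j) (H j) (seqq j.+1) := nextP _ _ (Hp j) (badj j).
have [x hx] : exists x, forall j, (seqq j).1 <= x <= (seqq j).1 + H j.
  apply: nested_point => [j|j|j]; last exact: ltW.
  - by have [[->|->] _ _] := goodj j; have := Hp j; lra.
  - by rewrite HS; have [[->|->] _ _] := goodj j; have := Hp j; lra.
have [y hy] : exists y, forall j, (seqq j).2 <= y <= (seqq j).2 + H j.
  apply: nested_point => [j|j|j]; last exact: ltW.
  - by have [_ [->|->] _] := goodj j; have := Hp j; lra.
  - by rewrite HS; have [_ [->|->] _] := goodj j; have := Hp j; lra.
have range1 j : 0 <= (seqq j).1 /\ (seqq j).1 + H j <= 1.
  elim: j => [|j [h1 h2]]; first by rewrite /H expr0 invr1 add0r.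
  by rewrite HS; have [[->|->] _ _] := goodj j; have := Hp j; lra.
have range2 j : 0 <= (seqq j).2 /\ (seqq j).2 + H j <= 1.
  elim: j => [|j [h1 h2]]; first by rewrite /H expr0 invr1 add0r.
  by rewrite HS; have [_ [->|->] _] := goodj j; have := Hp j; lra.
have H0 : H 0%N = 1 by rewrite /H expr0 invr1.
have x01 : 0 <= x <= 1 by have := hx 0%N; rewrite H0 /= add0r.
have y01 : 0 <= y <= 1 by have := hy 0%N; rewrite H0 /= add0r.
have [d d0 hd] := localP x y x01 y01.
have [j hj] : exists j, H j < d.
  have : (fun j => (2^-1 : R) ^+ j) @ \oo --> (0 : R).
    by apply: cvg_expr; rewrite ger0_norm ?invr_ge0 // invf_lt1 // ltr1n.
  move=> /cvgrPdist_lt /(_ d d0)[j _ hj]; exists j; have := hj j (leqnn j).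
  by rewrite /= sub0r normrN ger0_norm ?exprn_ge0 ?invr_ge0 // /H exprVn.
by case: (badj j); have [? ?] := range1 j; have [? ?] := range2 j; apply: hd.
Qed.

End Bisection.

Section DiscreteGoursat.
Variable R : realType.
Local Notation C := (Cplx R).

Definition cdiff (g : C -> C) (p d : C) : Prop := forall eps : R, 0 < eps ->
  exists2 del : R, 0 < del & forall z, modu (z - p) < del ->
    modu (g z - g p - d * (z - p)) <= eps * modu (z - p).

Variable g : C -> C.

(* Twice the trapezoidal approximation of the integral of g along [a, b]. *)
Definition trapezoid (a b : C) : C := (g a + g b) * (b - a).

Fixpoint path_sum n (P : R -> C) (a h : R) : C :=
  if n is n'.+1 then path_sum n' P a (h / 2) + path_sum n' P (a + h / 2) (h / 2)
  else trapezoid (P a) (P (a + h)).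

(** For c + d w the trapezoidal sum telescopes to the increment of 2 c w + d w^2, twice a primitive.
    The remainder contributes at most 2 M times the length bound K h. *)
Lemma path_sum_affine n (P : R -> C) (c d : C) (M K a h : R) : 0 <= h ->
  (forall t, a <= t <= a + h -> modu (g (P t) - (c + d * P t)) <= M) ->
  (forall t t', a <= t <= a + h -> a <= t' <= a + h -> modu (P t - P t') <= K * `|t - t'|) ->
  modu (path_sum n P a h - ((2 * c * P (a + h) + d * P (a + h) ^+ 2)
                            - (2 * c * P a + d * P a ^+ 2))) <= 2 * M * K * h.
Proof.
elim: n a h => [|n IH] a h h0 hM hK /=.
  have -> : trapezoid (P a) (P (a + h)) - (2 * c * P (a + h) + d * P (a + h) ^+ 2
      - (2 * c * P a + d * P a ^+ 2)) =
    ((g (P a) - (c + d * P a)) + (g (P (a + h)) - (c + d * P (a + h)))) * (P (a + h) - P a).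
    by rewrite /trapezoid; ring.
  have ha : a <= a <= a + h by rewrite lexx lerDl.
  have hb : a <= a + h <= a + h by rewrite lexx lerDl h0.
  rewrite moduM -mulrA; apply: ler_pM; rewrite ?modu_ge0 //.
    apply: le_trans (moduD _ _) _; have := hM _ ha; have := hM _ hb; lra.
  by have := hK _ _ hb ha; rewrite addrAC subrr add0r ger0_norm.
have h20 : 0 <= h / 2 by rewrite divr_ge0.
have e1 : a + h / 2 + h / 2 = a + h by lra.
have i1 : forall t, a <= t <= a + h / 2 -> a <= t <= a + h by move=> t; lra.
have i2 : forall t, a + h / 2 <= t <= a + h / 2 + h / 2 -> a <= t <= a + h by move=> t; lra.
have b1 := IH a (h / 2) h20 (fun t ht => hM t (i1 t ht))
  (fun t t' ht ht' => hK t t' (i1 t ht) (i1 t' ht')).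
have b2 := IH (a + h / 2) (h / 2) h20 (fun t ht => hM t (i2 t ht))
  (fun t t' ht ht' => hK t t' (i2 t ht) (i2 t' ht')).
rewrite e1 in b2.
set X := path_sum n P a _ in b1 *; set Y := path_sum n P _ _ in b2 *.
have := lerD b1 b2; have := moduD (X - (2 * c * P (a + h / 2) + d * P (a + h / 2) ^+ 2
   - (2 * c * P a + d * P a ^+ 2))) (Y - (2 * c * P (a + h) + d * P (a + h) ^+ 2
   - (2 * c * P (a + h / 2) + d * P (a + h / 2) ^+ 2))).
set U := X - _ + _.
have -> : X + Y - (2 * c * P (a + h) + d * P (a + h) ^+ 2 - (2 * c * P a + d * P a ^+ 2)) = U.
  by rewrite /U; ring.
have -> : 2 * M * K * (h / 2) + 2 * M * K * (h / 2) = 2 * M * K * h by field.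
by move=> /le_trans; apply.
Qed.

Variable gam : R -> R -> C.

Definition square_sum n (s t h : R) : C :=
  path_sum n (gam^~ t) s h + path_sum n (gam (s + h)) t h
  - path_sum n (gam^~ (t + h)) s h - path_sum n (gam s) t h.

(** The inner edges of the four quarters are traversed twice, in opposite directions. *)
Lemma square_sumS n s t h : square_sum n.+1 s t h =
  square_sum n s t (h / 2) + square_sum n (s + h / 2) t (h / 2)
  + square_sum n s (t + h / 2) (h / 2) + square_sum n (s + h / 2) (t + h / 2) (h / 2).
Proof.
have e u : u + h / 2 + h / 2 = u + h :> R by lra.
rewrite /square_sum /= !e; ring.
Qed.

Variable K : R.
Hypothesis K0 : 0 < K.
Hypothesis lip : forall s t s' t', 0 <= s <= 1 -> 0 <= t <= 1 -> 0 <= s' <= 1 -> 0 <= t' <= 1 ->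
  modu (gam s t - gam s' t') <= K * (`|s - s'| + `|t - t'|).
Hypothesis diff : forall s t, 0 <= s <= 1 -> 0 <= t <= 1 -> exists d, cdiff g (gam s t) d.

(* Trapezoidal sums are exact on affine functions, so differentiability at the point singled
   out by bisection bounds the sums over small squares by eps times the area. *)
Lemma discrete_goursat (eps : R) : 0 < eps ->
  exists n0, forall n, (n0 <= n)%N -> modu (square_sum n 0 0 1) <= eps.
Proof.
move=> eps0.
pose P s t h := exists n0, forall n, (n0 <= n)%N -> modu (square_sum n s t h) <= eps * h ^+ 2.
suff : P 0 0 1 by rewrite /P expr1n mulr1.
apply: bisection => [s t h h0 [n1 h1] [n2 h2] [n3 h3] [n4 h4]|x y x01 y01].
  (* Level n + 1 on a square is level n on its quarters. *)
  exists (maxn (maxn n1 n2) (maxn n3 n4)).+1 => -[//|n]; rewrite ltnS !geq_max.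
  move=> /andP[/andP[l1 l2] /andP[l3 l4]]; rewrite square_sumS.
  have := h1 n l1; have := h2 n l2; have := h3 n l3; have := h4 n l4.
  set a := square_sum n s t _; set b := square_sum n (s + h / 2) t _.
  set c := square_sum n s (t + h / 2) _; set d := square_sum n (s + h / 2) (t + h / 2) _.
  have -> : eps * (h / 2) ^+ 2 = eps * h ^+ 2 / 4 by field.
  have := moduD (a + b + c) d; have := moduD (a + b) c; have := moduD a b; lra.
have [d hd] := diff x01 y01; set p := gam x y in hd.
(* Each of the four sides contributes 2 (2 K h e') K h. *)
pose e' := eps / (16 * K ^+ 2).
have e'0 : 0 < e' by rewrite divr_gt0 // mulr_gt0 // exprn_gt0.
have [del del0 hdel] := hd e' e'0.
(* By the Lipschitz bound in both parameters, the image of a square of side h stays within 2 K h of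
   p. *)
exists (del / (2 * K)); first by rewrite divr_gt0 // mulr_gt0.
move=> s t h h0 hsmall s0 s1 t0 t1 hx hy; exists 0%N => n _.
pose c := g p - d * p.
have near s' t' : s <= s' <= s + h -> t <= t' <= t + h -> modu (gam s' t' - p) <= 2 * K * h.
  move=> hs' ht'; apply: le_trans (lip _ _ _ _) _; try lra.
  have a1 : `|s' - x| <= h by rewrite ler_norml; lra.
  have a2 : `|t' - y| <= h by rewrite ler_norml; lra.
  have := ler_wpM2l (ltW K0) (lerD a1 a2); lra.
have rem s' t' : s <= s' <= s + h -> t <= t' <= t + h ->
    modu (g (gam s' t') - (c + d * gam s' t')) <= e' * (2 * K * h).
  move=> hs' ht'; have hn := near _ _ hs' ht'.
  have -> : g (gam s' t') - (c + d * gam s' t') = g (gam s' t') - g p - d * (gam s' t' - p).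
    by rewrite /c; ring.
  apply: le_trans (hdel _ _) _; last by rewrite ler_pM2l.
  apply: le_lt_trans hn _; rewrite ltr_pdivlMr ?mulr_gt0 // in hsmall.
  by rewrite mulrC.
have lips u v v' : 0 <= u <= 1 -> 0 <= v <= 1 -> 0 <= v' <= 1 ->
    modu (gam u v - gam u v') <= K * `|v - v'|.
  by move=> hu hv hv'; have := lip hu hv hu hv'; rewrite subrr normr0 add0r.
have lipt u v v' : 0 <= u <= 1 -> 0 <= v <= 1 -> 0 <= v' <= 1 ->
    modu (gam v u - gam v' u) <= K * `|v - v'|.
  by move=> hu hv hv'; have := lip hv hu hv' hu; rewrite subrr normr0 addr0.
have h0' := ltW h0.
have b1 : modu (path_sum n (gam^~ t) s h - _) <= _ :=
  @path_sum_affine n (gam^~ t) c d (e' * (2 * K * h)) K s h h0'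
    (fun u hu => rem u t hu ltac:(lra))
    (fun u u' hu hu' => lipt t u u' ltac:(lra) ltac:(lra) ltac:(lra)).
have b2 : modu (path_sum n (gam (s + h)) t h - _) <= _ :=
  @path_sum_affine n (gam (s + h)) c d (e' * (2 * K * h)) K t h h0'
    (fun u hu => rem (s + h) u ltac:(lra) hu)
    (fun u u' hu hu' => lips (s + h) u u' ltac:(lra) ltac:(lra) ltac:(lra)).
have b3 : modu (path_sum n (gam^~ (t + h)) s h - _) <= _ :=
  @path_sum_affine n (gam^~ (t + h)) c d (e' * (2 * K * h)) K s h h0'
    (fun u hu => rem u (t + h) hu ltac:(lra))
    (fun u u' hu hu' => lipt (t + h) u u' ltac:(lra) ltac:(lra) ltac:(lra)).
have b4 : modu (path_sum n (gam s) t h - _) <= _ :=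
  @path_sum_affine n (gam s) c d (e' * (2 * K * h)) K t h h0'
    (fun u hu => rem s u ltac:(lra) hu)
    (fun u u' hu hu' => lips s u u' ltac:(lra) ltac:(lra) ltac:(lra)).
have bound : 2 * (e' * (2 * K * h)) * K * h * 4 = eps * h ^+ 2.
  by rewrite /e'; field; rewrite gt_eqF.
move: b1 b2 b3 b4; rewrite /square_sum.
set x1 := path_sum _ _ _ _ - _; set x2 := path_sum _ _ _ _ - _.
set x3 := path_sum _ _ _ _ - _; set x4 := path_sum _ _ _ _ - _.
move=> b1 b2 b3 b4.
have -> : path_sum n (gam^~ t) s h + path_sum n (gam (s + h)) t h
    - path_sum n (gam^~ (t + h)) s h - path_sum n (gam s) t h = x1 + x2 - x3 - x4.
  by rewrite /x1 /x2 /x3 /x4; ring.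
have := moduD (x1 + x2 - x3) (- x4); have := moduD (x1 + x2) (- x3); have := moduD x1 x2.
rewrite !moduN; lra.
Qed.

End DiscreteGoursat.

(** * Circle means and Cauchy formulas *)

Section UnitCircle.
Variable R : realType.
Local Notation C := (Cplx R).

(** exp(2 pi i t), normalized so that [0, 1] is one full turn. *)
Definition cis (t : R) : C := (cos (2 * pi * t) +i* sin (2 * pi * t))%C.

Lemma cisD s t : cis (s + t) = cis s * cis t.
Proof.
by rewrite /cis mulrDr cosD sinD; apply/eqP; rewrite eq_complex /= eqxx addrC mulrC [X in _ + X]mulrC eqxx.
Qed.

Lemma cis0 : cis 0 = 1.
Proof. by rewrite /cis mulr0 cos0 sin0. Qed.

Lemma cis1 : cis 1 = 1.
Proof. by rewrite /cis mulr1 mulr_natl cos2pi sin2pi. Qed.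

Lemma cisN t : cis t * cis (- t) = 1.
Proof. by rewrite -cisD subrr cis0. Qed.

Lemma cis_quarter : cis 4^-1 = 'i%C.
Proof.
rewrite /cis; have -> : 2 * pi * 4^-1 = pi / 2 :> R by field.
by rewrite cos_pihalf sin_pihalf.
Qed.

Lemma modu_cis t : modu (cis t) = 1.
Proof. by rewrite /modu /= cos2Dsin2 sqrtr1. Qed.

Lemma cis_conj t : (cis t)^* = cis (- t).
Proof. by rewrite /cis mulrN cosN sinN. Qed.

Lemma lipschitz1 (f df : R -> R) : (forall x, is_derive x (1:R) f (df x)) ->
  (forall x, `|df x| <= 1) -> forall x y, `|f x - f y| <= `|x - y|.
Proof.
move=> hd hb x y; wlog xy : x y / x < y.
  move=> h; case: (ltgtP x y) => [|yx|->]; [exact: h| |by rewrite !subrr].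
  by rewrite distrC [leRHS]distrC; exact: h.
have [c _ h] : exists2 c, c \in `]x, y[%R & f y - f x = df c * (y - x).
  apply: (MVT xy) => //; apply: continuous_subspaceT => u.
  by apply/differentiable_continuous/derivable1_diffP; have [] := hd u.
rewrite distrC [leRHS]distrC h normrM -[leRHS]mul1r.
by apply: ler_wpM2r.
Qed.

Lemma modu_le_ReIm (x : C) : modu x <= `|complex.Re x| + `|complex.Im x|.
Proof.
case: x => a b; rewrite /modu /= -[leRHS]ger0_norm ?addr_ge0 // -sqrtr_sqr.
apply: ler_wsqrtr; rewrite sqrrD !real_normK ?num_real //.
by rewrite addrAC lerDl mulrn_wge0 // mulr_ge0.
Qed.

Lemma cis_lipschitz s t : modu (cis s - cis t) <= 4 * pi * `|s - t|.
Proof.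
apply: le_trans (modu_le_ReIm _) _ => /=.
have hc : `|cos (2 * pi * s) - cos (2 * pi * t)| <= `|2 * pi * s - 2 * pi * t|.
  apply: (@lipschitz1 cos (fun x => - sin x)) => x.
  by rewrite normrN ler_norml sin_geN1 sin_le1.
have hs : `|sin (2 * pi * s) - sin (2 * pi * t)| <= `|2 * pi * s - 2 * pi * t|.
  by apply: (@lipschitz1 sin cos) => x; rewrite ler_norml cos_geN1 cos_le1.
have e : `|2 * pi * s - 2 * pi * t| = 2 * pi * `|s - t|.
  by rewrite -mulrBr normrM ger0_norm // mulr_ge0 // pi_ge0.
rewrite e in hc hs; apply: le_trans (lerD hc hs) _; lra.
Qed.

(** Equality holds for n = 2. For unimodular a, b one has |a^2 - b^2| <= 2 |a - b|, so the
    right-hand side never decreases with n. *)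
Lemma cis_gap n : (2 <= n)%N -> 8 <= 2 ^+ n * modu (cis (2 ^- n) - cis (- 2 ^- n)).
Proof.
elim: n => // n IH; rewrite leq_eqVlt => /orP[/eqP <-|].
  have -> : 2 ^- 2 = 4^-1 :> R by rewrite -natrX.
  rewrite -cis_conj cis_quarter; have -> : ('i%C - 'i%C^* : C) = ((0 - 0) +i* (1 - - 1))%C by [].
  rewrite subrr opprK.
  by rewrite /modu /= expr0n add0r sqrtr_sqr ger0_norm //; lra.
rewrite ltnS => /IH h; apply: le_trans h _.
have -> : 2 ^- n = 2 ^- n.+1 + 2 ^- n.+1 :> R.
  by rewrite exprS; field; rewrite expf_neq0.
set x := 2 ^- n.+1; rewrite opprD !cisD.
have -> : cis x * cis x - cis (- x) * cis (- x) = (cis x - cis (- x)) * (cis x + cis (- x)).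
  by ring.
rewrite moduM exprS -(mulrA 2) [leRHS]mulrCA; apply: ler_wpM2l; first by rewrite exprn_ge0.
rewrite mulrC; apply: ler_wpM2r; first exact: modu_ge0.
by apply: le_trans (moduD _ _) _; rewrite !modu_cis.
Qed.

(* Dyadic partitions are the ones produced by the repeated bisection of [path_sum]. *)
Definition node n (j : nat) : C := cis (j%:R / 2 ^+ n).

Definition mean n (F : C -> C) : C := (2 ^+ n)^-1 * \sum_(j < 2 ^ n) F (node n j).

Lemma path_sum_sum (g : C -> C) n P a h : path_sum g n P a h =
  \sum_(j < 2 ^ n) trapezoid g (P (a + j%:R * (h / 2 ^+ n))) (P (a + j.+1%:R * (h / 2 ^+ n))).
Proof.
elim: n a h => [|n IH] a h.
  by rewrite expn0 big_ord1 expr0 divr1 mul0r addr0 mul1r.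
rewrite /= !IH expnS mul2n -addnn big_split_ord /=.
have e : h / 2 / 2 ^+ n = h / 2 ^+ n.+1 :> R by rewrite exprS; field; rewrite expf_neq0.
rewrite !e; congr (_ + _); apply: eq_bigr => j _.
have e2 i : a + h / 2 + i%:R * (h / 2 ^+ n.+1) = a + (2 ^ n + i)%:R * (h / 2 ^+ n.+1) :> R.
  by rewrite natrD natrX exprS; field; rewrite expf_neq0.
by rewrite !e2 addnS.
Qed.

(** Summation by parts around the closed circle: the value at node w_j is weighted by w_(j+1) -
    w_(j-1), which is w_j times a factor independent of j. *)
Lemma path_sum_circle (g : C -> C) n (c rho : C) :
  path_sum g n (fun t => c + rho * cis t) 0 1 =
  (cis (2 ^- n) - cis (- 2 ^- n)) * \sum_(j < 2 ^ n) g (c + rho * node n j) * (rho * node n j).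
Proof.
rewrite path_sum_sum.
pose F j := g (c + rho * node n j) * (rho * node n j).
have nodeS j : node n j.+1 = node n j * cis (2 ^- n).
  by rewrite /node -cisD -natr1 mulrDl mul1r.
have h (j : 'I_(2 ^ n)) : true -> trapezoid g (c + rho * cis (0 + j%:R * (1 / 2 ^+ n)))
     (c + rho * cis (0 + j.+1%:R * (1 / 2 ^+ n))) =
   F j * (cis (2 ^- n) - 1) + F j.+1 * (1 - cis (- 2 ^- n)).
  move=> _; rewrite !add0r !div1r -!/(node n _) /trapezoid /F.
  have back : node n j.+1 * cis (- 2 ^- n) = node n j.
    by rewrite nodeS -mulrA cisN mulr1.
  have -> : g (c + rho * node n j.+1) * (rho * node n j.+1) * (1 - cis (- 2 ^- n)) =
    g (c + rho * node n j.+1) * rho * (node n j.+1 - node n j.+1 * cis (- 2 ^- n)) by ring.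
  rewrite back nodeS; ring.
rewrite (eq_bigr _ h) big_split /= -!mulr_suml.
have -> : \sum_(j < 2 ^ n) F j.+1 = \sum_(j < 2 ^ n) F j.
  have F2 : F (2 ^ n)%N = F 0%N.
    rewrite /F /node natrX mulfV ?expf_neq0 // cis1 mul0r cis0.
    by [].
  have := big_ord_recl (2 ^ n) (fun j => F j) (idx := 0) (op := +%R).
  have := big_ord_recr (2 ^ n) (fun j => F j) (idx := 0) (op := +%R).
  move=> /= -> /eqP; rewrite F2 [X in _ == X]addrC => /eqP /addIr ->.
  by apply: eq_bigr.
by rewrite -mulrDr mulrC; congr (_ * _); ring.
Qed.

End UnitCircle.

Section CircleMeans.
Variable R : realType.
Local Notation C := (Cplx R).

Lemma realC_gt0 (e : C) : 0 < e -> exists2 x : R, 0 < x & e = x%:C%C.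
Proof.
move=> e0; exists (modu e); first by rewrite -ltcR -moduE normr_gt0 gt_eqF.
by rewrite -moduE gtr0_norm.
Qed.

Lemma modu_real (x : R) : modu x%:C%C = `|x|.
Proof. by apply: (@complexI R); rewrite -moduE normc_def /= expr0n addr0 sqrtr_sqr. Qed.

Lemma cvg_moduP (a : nat -> C) (l : C) : a n @[n --> \oo] --> l <->
  forall eps : R, 0 < eps -> exists N, forall n, (N <= n)%N -> modu (a n - l) <= eps.
Proof.
split=> [h eps e0|h].
  have e0' : 0 < (eps%:C%C : C) by rewrite (ltcR 0).
  move/cvgrPdist_le: h => /(_ _ e0')[N _ hN]; exists N => n /hN /=.
  by rewrite distrC moduE lecR.
apply/cvgrPdist_le => e /realC_gt0[x x0 ->]; have [N hN] := h x x0.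
by exists N => // n /hN; rewrite /= distrC moduE lecR.
Qed.

Lemma cvg_conj (a : nat -> C) (l : C) : a n @[n --> \oo] --> l -> (a n)^* @[n --> \oo] --> l^*.
Proof.
move=> /cvg_moduP h; apply/cvg_moduP => e /h[N hN]; exists N => n /hN.
by rewrite -rmorphB modu_conj.
Qed.

Lemma cvg_ge0 (a : nat -> C) (l : C) : (forall n, 0 <= a n) -> a n @[n --> \oo] --> l -> 0 <= l.
Proof.
move=> a0 /cvg_moduP h.
have ha n : a n = (modu (a n))%:C%C by rewrite -moduE ger0_norm.
have im0 : complex.Im l = 0.
  apply/eqP; rewrite -normr_eq0 eq_le normr_ge0 andbT; apply/ler_addgt0Pr => e e0.
  have [N /(_ N (leqnn N))] := h e e0; rewrite add0r; apply: le_trans.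
  apply: le_trans (Im_le_modu _).
  suff -> : complex.Im (a N - l) = - complex.Im l by rewrite normrN.
  by rewrite ha; case: (l) => ? ? /=; rewrite sub0r.
have re0 : 0 <= complex.Re l.
  rewrite leNgt; apply/negP => lt0.
  have [|N /(_ N (leqnn N))] := h (- complex.Re l / 2); first by rewrite divr_gt0 // oppr_gt0.
  have := Re_le_modu (a N - l); rewrite ReD ReN {1}ha /= => h1 h2.
  have := le_trans h1 h2; rewrite ler_norml => /andP[_]; have := modu_ge0 (a N); lra.
by rewrite lecE /= im0 eqxx re0.
Qed.

Lemma derivable_cdiff (f : C -> C) p : derivable f p 1 -> cdiff f p ('D_1 f p).
Proof.
move=> hd eps e0.
have e0' : 0 < (eps%:C%C : C) by rewrite (ltcR 0).
have /cvgrPdist_le /(_ _ e0') := hd; rewrite -nbhs_nearE /= => -[d /= /realC_gt0[x x0 ->] hx].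
exists x => // z zp; case: (eqVneq z p) => [->|zp'].
  by rewrite !subrr mulr0 subr0 modu0 mulr0.
have := hx (z - p); rewrite /= distrC subr0 -modu_lt => /(_ zp); rewrite subr_eq0 => /(_ zp').
rewrite /= -[_ *: 1]/(_ * 1) mulr1 subrK -/(derive f p 1) moduE lecR => h.
have -> : f z - f p - 'D_1 f p * (z - p) = - ('D_1 f p - (z - p)^-1 *: (f z - f p)) * (z - p).
  rewrite -[_ *: _]/(_ * _); field; by rewrite subr_eq0.
by rewrite mulNr moduN moduM ler_wpM2r // modu_ge0.
Qed.

Lemma meanD n (F G : C -> C) : mean n (fun w => F w + G w) = mean n F + mean n G.
Proof. by rewrite /mean big_split mulrDr. Qed.

Lemma meanZ n a (F : C -> C) : mean n (fun w => a * F w) = a * mean n F.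
Proof. by rewrite /mean -mulr_sumr mulrCA. Qed.

Lemma mean_sum (I : finType) n (F : I -> C -> C) :
  mean n (fun w => \sum_i F i w) = \sum_i mean n (F i).
Proof. by rewrite /mean exchange_big mulr_sumr. Qed.

Lemma mean_cst n (a : C) : mean n (fun=> a) = a.
Proof.
rewrite /mean sumr_const card_ord -[a *+ _]mulr_natl natrX mulrA mulVf ?mul1r //.
Qed.

Lemma mean_conj n (F : C -> C) : (mean n F)^* = mean n (fun w => (F w)^*).
Proof. by rewrite /mean rmorphM rmorph_sum fmorphV rmorphXn rmorph_nat. Qed.

Lemma mean_ge0 n (F : C -> C) : (forall w, modu w = 1 -> 0 <= F w) -> 0 <= mean n F.
Proof.
move=> h; rewrite mulr_ge0 ?invr_ge0 ?exprn_ge0 //; apply: sumr_ge0 => j _.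
by apply: h; exact: modu_cis.
Qed.

Lemma eq_mean n (F G : C -> C) : (forall w, modu w = 1 -> F w = G w) -> mean n F = mean n G.
Proof. by move=> h; rewrite /mean; congr (_ * _); apply: eq_bigr => j _; apply: h; exact: modu_cis. Qed.

Lemma modu_pow2 n : modu ((2 ^+ n : C)) = 2 ^+ n.
Proof. by rewrite moduX -[2 in LHS](rmorph_nat (real_complex R)) modu_real ger0_norm. Qed.

Lemma mean_le n (F : C -> C) (e : R) : (forall w, modu w = 1 -> modu (F w) <= e) ->
  modu (mean n F) <= e.
Proof.
move=> h; rewrite /mean moduM moduV modu_pow2 mulrC ler_pdivrMr ?exprn_gt0 //.
apply: le_trans (modu_sum _ _ _) _.
apply: (@le_trans _ _ (\sum_(j < 2 ^ n) e)).
  by apply: ler_sum => j _; apply: h; exact: modu_cis.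
by rewrite sumr_const card_ord -[e *+ _]mulr_natl natrX mulrC.
Qed.

(** Antipodal roots of unity cancel; for n = 0 the only node is 1. *)
Lemma mean_inv n : (0 < n)%N -> mean n (fun w : C => w^-1) = 0.
Proof.
case: n => // n _; rewrite /mean; suff -> : \sum_(j < 2 ^ n.+1) (node R n.+1 j)^-1 = 0 :> C.
  by rewrite mulr0.
rewrite expnS mul2n -addnn big_split_ord /= -big_split big1 //= => j _.
suff -> : node R n.+1 (2 ^ n + j) = - node R n.+1 j by rewrite invrN subrr.
rewrite /node natrD mulrDl cisD.
have -> : (2 ^ n)%:R / 2 ^+ n.+1 = 4^-1 + 4^-1 :> R.
  by rewrite natrX exprS; field; rewrite expf_neq0.
have i2 : ('i%C * 'i%C : C) = -1 by rewrite -expr2 sqr_i.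
by rewrite cisD !cis_quarter i2 mulN1r.
Qed.

(** [gam] deforms the circle of radius del about c linearly into the circle of radius r about 0. It
    stays in |p| <= r and at distance at least del from c, and its edges at t = 0 and t = 1
    cancel. *)
Lemma mean_homotopy (g : C -> C) (c : C) (r del : R) : 0 < del -> modu c + del <= r ->
  (forall p, modu p <= r -> del <= modu (p - c) -> derivable g p 1) ->
  mean n (fun w => g (r%:C%C * w) * (r%:C%C * w)) -
  mean n (fun w => g (c + del%:C%C * w) * (del%:C%C * w)) @[n --> \oo] --> (0 : C).
Proof.
move=> d0 cr hg.
pose rad (s : R) : R := s * r + (1 - s) * del.
pose gam (s t : R) : C := (1 - s)%:C%C * c + (rad s)%:C%C * cis t.
have c0 := modu_ge0 c; have r0 : 0 < r by lra.
have rad0 s : 0 <= s <= 1 -> 0 <= rad s <= r.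
  by move=> hs; rewrite /rad; apply/andP; split; nra.
pose K := modu c + r + r * (4 * pi).
have pi0 := pi_gt0 R.
have K0 : 0 < K by rewrite /K; nra.
have lip s t s' t' : 0 <= s <= 1 -> 0 <= t <= 1 -> 0 <= s' <= 1 -> 0 <= t' <= 1 ->
    modu (gam s t - gam s' t') <= K * (`|s - s'| + `|t - t'|).
  move=> hs ht hs' ht'.
  have -> : gam s t - gam s' t' = (s' - s)%:C%C * c + ((s - s') * (r - del))%:C%C * cis t
      + (rad s')%:C%C * (cis t - cis t').
    rewrite /gam /rad !(rmorphD, rmorphB, rmorphM, rmorph1) /=; ring.
  have h1 := moduD ((s' - s)%:C%C * c + ((s - s') * (r - del))%:C%C * cis t)
    ((rad s')%:C%C * (cis t - cis t')).
  have h2 := moduD ((s' - s)%:C%C * c) (((s - s') * (r - del))%:C%C * cis t).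
  rewrite !moduM !modu_real modu_cis mulr1 normrM in h1 h2.
  have := cis_lipschitz t t'; have := rad0 s' hs'.
  rewrite (distrC s' s) in h2.
  rewrite (@ger0_norm _ (r - del)) in h2; last by lra.
  move=> hr; rewrite (@ger0_norm _ (rad s')) in h1; last by case/andP: hr.
  move: h1 h2 hr; set x := `|s - s'|; set y := `|t - t'|; set m := modu (cis t - cis t').
  have x0 : 0 <= x by exact: normr_ge0.
  have y0 : 0 <= y by exact: normr_ge0.
  have m0 : 0 <= m by exact: modu_ge0.
  move=> h1 h2 hr h3.
  have h4 : rad s' * m <= r * (4 * pi * y) by apply: ler_pM; case/andP: hr.
  have h5 : 0 <= x * del by rewrite mulr_ge0 // ltW.
  have h6 : 0 <= (modu c + r) * y by rewrite mulr_ge0 //; lra.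
  have h7 : 0 <= r * (4 * pi) * x by rewrite !mulr_ge0 // ltW.
  rewrite /K; lra.
have dif s t : 0 <= s <= 1 -> 0 <= t <= 1 -> exists d, cdiff g (gam s t) d.
  move=> hs ht; exists ('D_1 g (gam s t)); apply: derivable_cdiff; apply: hg.
    apply: le_trans (moduD _ _) _; rewrite !moduM modu_cis mulr1 !modu_real !ger0_norm; try lra.
      by rewrite /rad; nra.
    by case/andP: (rad0 s hs).
  have e : gam s t - c + s%:C%C * c = (rad s)%:C%C * cis t.
    by rewrite /gam !(rmorphD, rmorphB, rmorphM, rmorph1) /=; ring.
  have := moduD (gam s t - c) (s%:C%C * c); rewrite e !moduM modu_cis mulr1 !modu_real.
  rewrite !ger0_norm; [|by case/andP: hs|by case/andP: (rad0 s hs)].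
  by rewrite /rad; nra.
have dg := discrete_goursat K0 lip dif.
apply/cvg_moduP => eps e0; have [N hN] := dg eps e0; exists (maxn N 2) => n.
rewrite geq_max => /andP[nN n2]; apply: le_trans (hN n nN); rewrite subr0 /square_sum.
have g01 : gam^~ (0 + 1) = gam^~ 0 by apply/funext => s; rewrite /gam add0r cis1 cis0.
have g1 : gam (0 + 1) = (fun t => 0 + r%:C%C * cis t).
  by apply/funext => t; rewrite /gam /rad add0r subrr !mul0r mul1r addr0.
have g0 : gam 0 = (fun t => c + del%:C%C * cis t).
  by apply/funext => t; rewrite /gam /rad subr0 !mul0r !mul1r add0r.
rewrite g01 g1 g0 !path_sum_circle [X in X - _ - _]addrC addrK.
under [X in _ <= modu (_ * X - _)]eq_bigr do rewrite add0r.
(* Path sums are means times a factor of modulus 2^n |cis (2^-n) - cis (- 2^-n)|, which [cis_gap]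
   bounds below. *)
rewrite /mean -!mulrBr moduM [leRHS]moduM moduV modu_pow2.
apply: ler_wpM2r; first exact: modu_ge0.
have := cis_gap R n2; set m := modu _ => hm.
have p0 : 0 < 2 ^+ n :> R by rewrite exprn_gt0.
by rewrite -div1r ler_pdivrMr // mulrC; lra.
Qed.

End CircleMeans.

Section CauchyFormulas.
Variable R : realType.
Local Notation C := (Cplx R).
Variables (F : C -> C) (r : R).
Hypothesis r0 : 0 < r.
Hypothesis hF : forall p, modu p <= r -> derivable F p 1.

Lemma realC_neq0 (x : R) : 0 < x -> (x%:C%C : C) != 0.
Proof. by move=> x0; rewrite gt_eqF // (ltcR 0). Qed.

Lemma modu1_neq0 (w : C) : modu w = 1 -> w != 0.
Proof. by move=> h; apply/eqP => w0; have := h; rewrite w0 modu0 => /esym/eqP; rewrite oner_eq0. Qed.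

Lemma derivable_subV (z p : C) : p != z -> derivable (fun q : C => (q - z)^-1) p 1.
Proof.
move=> pz; apply: derivableV; first by rewrite subr_eq0.
by apply: derivableB; [exact: derivable_id|exact: derivable_cst].
Qed.

(** After deformation to a small circle about z, differentiability at z keeps the mean of F close to
    F(z). *)
Lemma mean_cauchy z : modu z < r ->
  mean n (fun w => F (r%:C%C * w) * (r%:C%C * w / (r%:C%C * w - z))) @[n --> \oo] --> F z.
Proof.
move=> zr; apply/cvg_moduP => eps e0.
have [del d0 hdel] := derivable_cdiff (hF (ltW zr)) ltr01; set D := 'D_1 F z in hdel.
pose m := modu D + 1; have m0 : 0 < m by rewrite ltr_wpDl // modu_ge0.
(* The three bounds ensure the derivative estimate with error 1, room for the homotopy, and (|D| +
   1) d <= eps / 2. *)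
pose d := Num.min (del / 2) (Num.min (r - modu z) (eps / 2 / m)).
have dp : 0 < d by rewrite !lt_min !divr_gt0 //= subr_gt0 zr.
have dr : modu z + d <= r.
  by rewrite addrC -lerBrDr /d !ge_min lexx orbT.
have dd : d < del.
  by apply: (@le_lt_trans _ _ (del / 2)); [rewrite ge_min lexx|lra].
have dm : m * d <= eps / 2.
  by rewrite mulrC -ler_pdivlMr // /d !ge_min lexx !orbT.
have hg p : modu p <= r -> d <= modu (p - z) -> derivable (fun q => F q * (q - z)^-1) p 1.
  move=> pr pd; apply: derivableM; first exact: hF.
  apply: derivable_subV; apply: contraL pd => /eqP ->.
  by rewrite subrr modu0 -ltNge.
have e20 : 0 < eps / 2 by rewrite divr_gt0.
have [N hN] := (cvg_moduP _ _).1 (mean_homotopy dp dr hg) (eps / 2) e20.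
exists N => n /hN; rewrite subr0 => h1.
have h2 : modu (mean n (fun w => F (z + d%:C%C * w) / (z + d%:C%C * w - z) * (d%:C%C * w)) - F z)
    <= eps / 2.
  rewrite -(mean_cst n (- F z)) -meanD; apply: mean_le => w w1.
  have w0 := modu1_neq0 w1; have dn0 := realC_neq0 dp.
  have -> : F (z + d%:C%C * w) / (z + d%:C%C * w - z) * (d%:C%C * w) - F z
     = (F (z + d%:C%C * w) - F z - D * (z + d%:C%C * w - z)) + D * (d%:C%C * w).
    rewrite [z + _]addrC addrK mulfVK ?mulf_neq0 //; ring.
  apply: le_trans (moduD _ _) _; have := hdel (z + d%:C%C * w).
  rewrite [z + _]addrC addrK !moduM w1 mulr1 modu_real gtr0_norm // mul1r => /(_ dd).
  rewrite /m in dm; lra.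
rewrite (_ : mean n _ = mean n (fun w => F (r%:C%C * w) / (r%:C%C * w - z) * (r%:C%C * w))).
  set A := mean n _ in h1 *; set B := mean n _ in h1 h2.
  have := moduD (A - B) (B - F z); rewrite addrA subrK; lra.
by apply: eq_mean => w _; rewrite mulrA mulrAC.
Qed.

(** Deform for F(q) / q^2. On the small circle of radius d, F(d w) / (d w) is F(0) / (d w), of mean
    zero, plus a difference quotient close to F'(0). *)
Lemma mean_derive :
  mean n (fun w => F (r%:C%C * w) * (r%:C%C * w)^-1) @[n --> \oo] --> 'D_1 F 0.
Proof.
apply/cvg_moduP => eps e0.
have h0 : modu 0 <= r by rewrite modu0 ltW.
have e20 : 0 < eps / 2 by rewrite divr_gt0.
have [del del0 hdel] := derivable_cdiff (hF h0) e20; set D := 'D_1 F 0 in hdel *.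
pose d := Num.min (del / 2) r.
have dp : 0 < d by rewrite lt_min divr_gt0 //=.
have dr : modu 0 + d <= r by rewrite modu0 add0r ge_min lexx orbT.
have dd : d < del by apply: (@le_lt_trans _ _ (del / 2)); [rewrite ge_min lexx|lra].
have hg p : modu p <= r -> d <= modu (p - 0) -> derivable (fun q => F q * ((q - 0)^-1 * (q - 0)^-1)) p 1.
  move=> pr pd; have p0 : p != 0.
    by apply: contraL pd => /eqP ->; rewrite subrr modu0 -ltNge.
  apply: derivableM; first exact: hF.
  by apply: derivableM; exact: derivable_subV.
have [N hN] := (cvg_moduP _ _).1 (mean_homotopy dp dr hg) (eps / 2) e20.
exists (maxn N 1) => n; rewrite geq_max => /andP[/hN]; rewrite subr0 => h1 n1.
have dn0 := realC_neq0 dp; have rn0 := realC_neq0 r0.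
rewrite (@eq_mean _ n (fun w => F (r%:C%C * w) * ((r%:C%C * w - 0)^-1 * (r%:C%C * w - 0)^-1)
    * (r%:C%C * w)) (fun w => F (r%:C%C * w) * (r%:C%C * w)^-1)) in h1; last first.
  by move=> w /modu1_neq0 w0; rewrite subr0; field; rewrite w0.
rewrite (@eq_mean _ n (fun w => F (0 + d%:C%C * w) * ((0 + d%:C%C * w - 0)^-1
     * (0 + d%:C%C * w - 0)^-1) * (d%:C%C * w))
   (fun w => F 0 / d%:C%C * w^-1 + (D + (F (d%:C%C * w) - F 0 - D * (d%:C%C * w - 0)) / (d%:C%C * w))))
  in h1; last first.
  by move=> w /modu1_neq0 w0; rewrite add0r subr0; field; rewrite w0.
rewrite meanD meanZ mean_inv // mulr0 add0r meanD mean_cst opprD addrA in h1.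
set A := mean n _ - D in h1 *; set B := mean n _ in h1.
have hB : modu B <= eps / 2.
  apply: mean_le => w w1; rewrite moduM moduV ler_pdivrMr; last first.
    by rewrite moduM w1 mulr1 modu_real gtr0_norm.
  have := hdel (d%:C%C * w); rewrite subr0; apply.
  by rewrite moduM w1 mulr1 modu_real gtr0_norm.
have := moduD (A - B) B; rewrite subrK; lra.
Qed.

End CauchyFormulas.

(** On the circle |p| = a the conjugate of p is a^2 / p, which makes the conjugated Cauchy factor a
    rational function of p with its pole moved outside the circle when |z| < a. *)
Lemma conj_disk_factor (K : numClosedFieldType) (a w z : K) : a^* = a -> w^* = w^-1 ->
  a != 0 -> w != 0 -> a * w != z -> (a * w / (a * w - z))^* = (1 - z^* * (a ^+ 2)^-1 * (a * w))^-1.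
Proof.
move=> ha hw a0 w0 awz.
have d0 : a / w - z^* != 0.
  by rewrite -hw -{1}ha -rmorphM -rmorphB fmorph_eq0 subr_eq0.
rewrite rmorphM fmorphV rmorphB rmorphM /= ha hw.
have e : 1 - z^* * (a ^+ 2)^-1 * (a * w) = (a / w - z^*) / (a / w) by field; rewrite a0 w0.
by rewrite e invf_div.
Qed.

Lemma cvg_fsum (K : numFieldType) (I : finType) (a : I -> nat -> K) (l : I -> K) :
  (forall i, a i N @[N --> \oo] --> l i) -> \sum_i a i N @[N --> \oo] --> \sum_i l i.
Proof. by move=> h; apply: cvg_big => [x|i _]; [exact: add_continuous|exact: h]. Qed.

(** * Pick positivity of the constrained Schur class *)

Section CircleGram.
Variable R : realType.
Local Notation C := (Cplx R).
Variables (n : nat) (z : 'I_n -> C) (r : R).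
Hypothesis r0 : 0 < r.
Hypothesis zr : forall i, modu (z i) < r.

Let rho : C := ((r ^+ 2)^-1)%:C%C.

(* Boundary values of the Cauchy kernel reproducing t(z_i), t'(0), t(0) on |w| = r;
   [circle_refl] is the rational function equal to their conjugates on that circle. *)
Definition circle_fun (p : 'I_n + bool) (w : C) : C :=
  match p with
  | inl i => w / (w - z i)
  | inr b => if b then w^-1 else 1
  end.

Definition circle_refl (q : 'I_n + bool) (w : C) : C :=
  match q with
  | inl j => (1 - (z j)^* * rho * w)^-1
  | inr b => if b then rho * w else 1
  end.

(** The value at z_i, the derivative at 0 and the value at 0 of [circle_refl q]; for r = 1 these are
    the entries of [gram]. *)
Definition circle_gram (p q : 'I_n + bool) : C :=
  match p, q with
  | inl i, inl j => (1 - (z j)^* * rho * z i)^-1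
  | inl i, inr b => if b then rho * z i else 1
  | inr b, inl j => if b then (z j)^* * rho else 1
  | inr b, inr b' => if b == b' then (if b then rho else 1) else 0
  end.

Definition point (p : 'I_n + bool) : C := if p is inl i then z i else 0.

Let rn0 : (r%:C%C : C) != 0 := realC_neq0 r0.

Let rhoE : rho = (r%:C%C ^+ 2)^-1.
Proof. by rewrite /rho fmorphV rmorphXn. Qed.

Lemma circle_conj q (w : C) : modu w = 1 ->
  (circle_fun q (r%:C%C * w))^* = circle_refl q (r%:C%C * w).
Proof.
move=> w1; have w0 := modu1_neq0 w1.
have wc : w^* = w^-1.
  apply: (mulfI w0); rewrite mulfV // -normCK moduE w1.
  by rewrite -(rmorphXn (real_complex R)) expr1n.
have rc : (r%:C%C)^* = r%:C%C :> C by apply: geC0_conj; rewrite (lecR 0) ltW.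
case: q => [j|[]] /=.
- rewrite rhoE; apply: conj_disk_factor => //.
  by apply: contraTneq (zr j) => <-; rewrite moduM w1 mulr1 modu_real gtr0_norm // ltxx.
- rewrite rhoE; transitivity ((r%:C%C : C)^-1 * w).
    by rewrite [LHS]fmorphV [X in X^-1](rmorphM Num.conj) /= [X in X * _]rc [X in _ * X]wc invfM invrK.
  by field; rewrite rn0.
- by rewrite rmorph1.
Qed.

Lemma refl_denom j (w : C) : modu w <= r -> 1 - (z j)^* * rho * w != 0.
Proof.
move=> wr; rewrite subr_eq0 eq_sym; apply/eqP => h.
have : modu ((z j)^* * rho * w) < 1.
  rewrite !moduM modu_conj modu_real gtr0_norm ?invr_gt0 ?exprn_gt0 //.
  rewrite mulrAC ltr_pdivrMr ?exprn_gt0 // mul1r expr2.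
  apply: (@le_lt_trans _ _ (modu (z j) * r)); last by rewrite ltr_pM2r.
  by rewrite ler_wpM2l // modu_ge0.
by rewrite h modu1 ltxx.
Qed.

Lemma derivable_refl q (w : C) : modu w <= r -> derivable (circle_refl q) w 1.
Proof.
move=> wr; case: q => [j|[]] /=; last exact: derivable_cst.
  apply: derivableV; first exact: refl_denom.
  apply: derivableB; first exact: derivable_cst.
  by apply: derivableM; [exact: derivable_cst|exact: derivable_id].
by apply: derivableM; [exact: derivable_cst|exact: derivable_id].
Qed.

Lemma derive_refl0 q : 'D_1 (circle_refl q) 0 = circle_gram (inr true) q.
Proof.
have lin (a : C) : derivable (fun w : C => a * w) 0 1 /\ 'D_1 (fun w : C => a * w) 0 = a.
  have -> : (fun w : C => a * w) = cst a * id by apply/funext => w; rewrite fctE.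
  split; first by apply: derivableM; [exact: derivable_cst|exact: derivable_id].
  rewrite deriveM; [|exact: derivable_cst|exact: derivable_id].
  by rewrite derive_id derive_cst scaler0 addr0 -[_ *: _]/(_ * _) mulr1.
case: q => [j|[]]; rewrite /circle_refl /circle_gram /=; last first.
- exact: (derive_cst (1 : C) (0 : C) (1 : C)).
- by have [_] := lin rho.
- have [hd hv] := lin ((z j)^* * rho).
  set f := fun w : C => _ * w in hd hv.
  have hc : derivable (cst 1 : C -> C) (0 : C) 1 by exact: derivable_cst.
  have f0 : (cst 1 - f) 0 = 1 by rewrite !fctE /f mulr0 subr0.
  rewrite (_ : (fun w : C => _) = (fun w => ((cst 1 - f) w)^-1)); last first.
    by apply/funext => w; rewrite !fctE.
  have fd := derivableB hc hd.
  rewrite (deriveV _ fd) f0 ?oner_neq0 // (deriveB hc hd) derive_cst hv sub0r.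
  by rewrite expr1n invr1 scalerN scaleN1r opprK.
Qed.

(** Cauchy's formulas for the product of [circle_refl q] and t. The condition t'(0) = 0 reduces the
    derivative at 0 to a multiple of t(0), so both unit vectors see the same value. *)
Lemma circle_gram_mean (t : C -> C) p q :
  (forall w, modu w <= r -> derivable t w 1) -> 'D_1 t 0 = 0 ->
  mean N (fun w => circle_fun p (r%:C%C * w) * (circle_fun q (r%:C%C * w))^* * t (r%:C%C * w))
    @[N --> \oo] --> circle_gram p q * t (point p).
Proof.
move=> ht t0; pose F w := circle_refl q w * t w.
have hF w : modu w <= r -> derivable F w 1.
  by move=> wr; apply: derivableM; [exact: derivable_refl|exact: ht].
have -> : (fun N => mean N (fun w => circle_fun p (r%:C%C * w) * (circle_fun q (r%:C%C * w))^*
     * t (r%:C%C * w))) = (fun N => mean N (fun w => F (r%:C%C * w) * circle_fun p (r%:C%C * w))).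
  apply/funext => N; apply: eq_mean => w w1.
  by rewrite circle_conj // /F mulrAC mulrC -mulrA [circle_fun _ _ * _]mulrC mulrA.
have m0 : modu 0 < r by rewrite modu0.
case: p => [i|[]].
- have -> : circle_gram (inl i) q * t (point (inl i)) = F (z i) by rewrite /F; case: q {F hF}.
  exact: mean_cauchy.
- have -> : circle_gram (inr true) q * t (point (inr true)) = 'D_1 F 0.
    rewrite /F deriveM; [|exact/derivable_refl/ltW|exact/ht/ltW].
    by rewrite t0 derive_refl0 scaler0 add0r -[_ *: _]/(_ * _) mulrC.
  exact: mean_derive.
- have -> : circle_gram (inr false) q * t (point (inr false)) = F 0.
    by rewrite /F; case: q {F hF} => [j|[]] /=; rewrite ?mulr0 ?subr0 ?invr1.
  have -> : (fun N => mean N (fun w => F (r%:C%C * w) * circle_fun (inr false) (r%:C%C * w))) =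
      (fun N => mean N (fun w => F (r%:C%C * w) * (r%:C%C * w / (r%:C%C * w - 0)))).
    apply/funext => N; apply: eq_mean => w /modu1_neq0 w0.
    by rewrite subr0 mulfV ?mulf_neq0.
  exact: mean_cauchy.
Qed.

Lemma circle_form_mean (t : 'I_n + bool -> 'I_n + bool -> C -> C) :
  (forall p q w, modu w <= r -> derivable (t p q) w 1) -> (forall p q, 'D_1 (t p q) 0 = 0) ->
  mean N (fun w => \sum_p \sum_q circle_fun p (r%:C%C * w) * (circle_fun q (r%:C%C * w))^*
     * t p q (r%:C%C * w)) @[N --> \oo] --> \sum_p \sum_q circle_gram p q * t p q (point p).
Proof.
move=> ht t0.
have -> : (fun N => mean N (fun w => \sum_p \sum_q circle_fun p (r%:C%C * w)
   * (circle_fun q (r%:C%C * w))^* * t p q (r%:C%C * w))) = (fun N => \sum_p \sum_q mean N (fun w =>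
   circle_fun p (r%:C%C * w) * (circle_fun q (r%:C%C * w))^* * t p q (r%:C%C * w))).
  by apply/funext => N; rewrite mean_sum; apply: eq_bigr => p _; rewrite mean_sum.
apply: cvg_fsum => p; apply: cvg_fsum => q.
by apply: circle_gram_mean => [w|]; [exact: ht|exact: t0].
Qed.

End CircleGram.

Section TraceFunctional.
Variables (K : numFieldType) (p q k : nat) (A : 'M[K]_(k, p)) (B : 'M[K]_(q, k)).

Lemma cvg_trace_mul {T} (F : set_system T) {FF : Filter F} (f : T -> 'M[K]_(p, q)) (M : 'M[K]_(p, q)) :
  f @ F --> M -> \tr (A *m f t *m B) @[t --> F] --> \tr (A *m M *m B).
Proof.
have e (N : 'M[K]_(p, q)) : \tr (A *m N *m B) = \sum_j \sum_i (B *m A) j i * N i j.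
  by rewrite mxtrace_mulC mulmxA; apply: eq_bigr => j _; rewrite mxE.
move=> h; rewrite e; under eq_cvg do rewrite e.
apply: cvg_big => [x|j _]; first exact: add_continuous.
apply: cvg_big => [x|i _]; first exact: add_continuous.
by apply: cvgM; [exact: cvg_cst|exact: cvg_entry].
Qed.

Lemma derivable_trace_mul (S : K -> 'M[K]_(p, q)) w : derivable S w 1 ->
  derivable (fun w => \tr (A *m S w *m B)) w 1 /\
  'D_1 (fun w => \tr (A *m S w *m B)) w = \tr (A *m 'D_1 S w *m B).
Proof.
move=> hS.
have e : (fun h : K => \tr (A *m (h^-1 *: ((S \o shift w) (h *: 1) - S w)) *m B)) =
  (fun h => h^-1 *: (((fun w => \tr (A *m S w *m B)) \o shift w) (h *: 1) - \tr (A *m S w *m B))).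
  apply/funext => h; rewrite -scalemxAr -scalemxAl mxtraceZ mulmxBr mulmxBl.
  by rewrite [\tr (_ - _)]linearB.
have h : \tr (A *m (h^-1 *: ((S \o shift w) (h *: 1) - S w)) *m B) @[h --> 0^'] -->
    \tr (A *m 'D_1 S w *m B) by exact: cvg_trace_mul.
rewrite e in h; split; first by apply/cvg_ex; exists (\tr (A *m 'D_1 S w *m B)).
exact: cvg_lim h.
Qed.

End TraceFunctional.

Section PickPositivity.
Variable R : realType.
Local Notation C := (Cplx R).
Variables (n k : nat) (z : 'I_n -> C) (S : C -> 'M[C]_k).
Hypothesis schurS : schur1 S.

Lemma schur1_contr w : modu w < 1 -> forall v : 'rV_k, fsq (v *m S w) <= fsq v.
Proof.
move=> w1; apply: col_contr_row; apply: opnorm_le1_contr.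
have [_ + _] := schurS; rewrite -(lee_fin _ 1%R); apply: le_trans.
by apply: ereal_sup_ubound; exists w => //; rewrite /unit_disk /= -modu_lt1.
Qed.

Lemma sum_trace_mul (I : finType) (a : I -> C) (x y : I -> 'rV[C]_k) (M : 'M[C]_k) :
  \tr ((\sum_p a p *: x p) *m M *m (\sum_q a q *: y q)^t*) =
  \sum_p \sum_q a p * (a q)^* * \tr (x p *m M *m (y q)^t*).
Proof.
rewrite !mulmx_suml linear_sum; apply: eq_bigr => p _ /=.
rewrite adjmx_sum mulmx_sumr linear_sum; apply: eq_bigr => q _ /=.
by rewrite adjmxZ -!scalemxAl -scalemxAr scalerA mxtraceZ.
Qed.

Lemma fsq_comb (I : finType) (a : I -> C) (x : I -> 'rV[C]_k) :
  fsq (\sum_p a p *: x p) = \sum_p \sum_q a p * (a q)^* * \tr (x p *m (x q)^t*).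
Proof.
have := sum_trace_mul a x x 1%:M; rewrite mulmx1 -fsqT => ->.
by apply: eq_bigr => p _; apply: eq_bigr => q _; rewrite mulmx1.
Qed.

(** On the circle |u S - v|^2 + |u|^2 - |u S|^2 = |u|^2 - 2 Re <u S, v> + |v|^2 is nonnegative. The
    means of <u S, v> and of |v|^2 have the same limit, since Cauchy's formulas replace x_p S(w) by
    y_p. *)
Lemma pick_circle (r : R) (x : 'I_n + bool -> 'rV[C]_k) :
  0 < r -> r < 1 -> (forall i, modu (z i) < r) ->
  0 <= \sum_p \sum_q circle_gram z r p q * \tr (x p *m (x q)^t*)
     - (\sum_p \sum_q circle_gram z r p q *
         \tr (x p *m S (point z p) *m (x q *m S (point z q))^t*))^*.
Proof.
move=> r0 r1 zr.
pose y p := x p *m S (point z p).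
pose u (w : C) := \sum_p circle_fun z p (r%:C%C * w) *: x p.
pose v (w : C) := \sum_p circle_fun z p (r%:C%C * w) *: y p.
have der A B : (forall w : C, modu w <= r -> derivable (fun w => \tr (A *m S w *m B) : C) w 1)
    /\ 'D_1 (fun w => \tr (A *m S w *m B) : C) 0 = 0.
  have [hS _ S0] := schurS.
  have hd w : modu w <= r -> derivable S w 1.
    by move=> wr; apply: hS; rewrite /unit_disk /= -modu_lt1; exact: le_lt_trans r1.
  split=> [w wr|]; first by have [] := derivable_trace_mul A B (hd w wr).
  have [|_ ->] := derivable_trace_mul A B (hd 0 _); first by rewrite modu0 ltW.
  by rewrite -derive1E S0 mulmx0 mul0mx mxtrace0.
have H1 := @circle_form_mean R n z r r0 zr (fun p q => cst (\tr (x p *m (x q)^t*)))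
  (fun p q w _ => derivable_cst _ w 1) (fun p q => derive_cst _ (0 : C) 1).
have H2 := @circle_form_mean R n z r r0 zr (fun p q w => \tr (x p *m S w *m (y q)^t*))
  (fun p q w => (der _ (x p) ((y q)^t*)).1 w) (fun p q => (der _ (x p) ((y q)^t*)).2).
have H3 := @circle_form_mean R n z r r0 zr (fun p q => cst (\tr (y p *m (y q)^t*)))
  (fun p q w _ => derivable_cst _ w 1) (fun p q => derive_cst _ (0 : C) 1).
have E1 (w : C) : \sum_p \sum_q circle_fun z p (r%:C%C * w) * (circle_fun z q (r%:C%C * w))^*
    * cst (\tr (x p *m (x q)^t*)) (r%:C%C * w) = fsq (u w).
  by rewrite fsq_comb.
have E2 (w : C) : \sum_p \sum_q circle_fun z p (r%:C%C * w) * (circle_fun z q (r%:C%C * w))^*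
    * \tr (x p *m S (r%:C%C * w) *m (y q)^t*) = \tr (u w *m S (r%:C%C * w) *m (v w)^t*).
  by rewrite sum_trace_mul.
have E3 (w : C) : \sum_p \sum_q circle_fun z p (r%:C%C * w) * (circle_fun z q (r%:C%C * w))^*
    * cst (\tr (y p *m (y q)^t*)) (r%:C%C * w) = fsq (v w).
  by rewrite fsq_comb.
set U := \sum_p \sum_q _ * \tr (x p *m (x q)^t*).
set Y := \sum_p \sum_q _ * _.
have -> : U - Y^* = U - Y - Y^* + Y by ring.
pose a N := mean N (fun w => fsq (u w)) - mean N (fun w => \tr (u w *m S (r%:C%C * w) *m (v w)^t*))
  - (mean N (fun w => \tr (u w *m S (r%:C%C * w) *m (v w)^t*)))^* + mean N (fun w => fsq (v w)).
apply: (@cvg_ge0 R a); last first.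
  have c1 : mean N (fun w => fsq (u w)) @[N --> \oo] --> U.
    apply: cvg_trans H1; apply: near_eq_cvg; apply: nearW => N.
    by apply: eq_mean => w _; rewrite E1.
  have c2 : mean N (fun w => \tr (u w *m S (r%:C%C * w) *m (v w)^t*)) @[N --> \oo] --> Y.
    apply: cvg_trans H2; apply: near_eq_cvg; apply: nearW => N.
    by apply: eq_mean => w _; rewrite E2.
  have c3 : mean N (fun w => fsq (v w)) @[N --> \oo] --> Y.
    apply: cvg_trans H3; apply: near_eq_cvg; apply: nearW => N.
    by apply: eq_mean => w _; rewrite E3.
  apply: cvgD c3; apply: cvgB (cvg_conj c2); exact: cvgB c1 c2.
move=> N; rewrite /a mean_conj -mulN1r -meanZ -[X in _ + X + _]mulN1r -meanZ -!meanD.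
apply: mean_ge0 => w w1.
have := fsq_ge0 (u w *m S (r%:C%C * w) - v w); rewrite fsqB => h.
have rw1 : modu (r%:C%C * w) < 1 by rewrite moduM w1 mulr1 modu_real gtr0_norm.
have := schur1_contr rw1 (u w); rewrite -subr_ge0 => h'.
have := addr_ge0 h h'; congr (0 <= _); ring.
Qed.

End PickPositivity.

(** * Passage to the unit circle *)

Section RadiusLimit.
Variable R : realType.
Local Notation C := (Cplx R).
Variables (n : nat) (z : 'I_n -> C).
Hypothesis z1 : forall i, `|z i| < 1.

Lemma circle_gram_cvg (r : nat -> R) p q : r N @[N --> \oo] --> (1 : R) ->
  circle_gram z (r N) p q @[N --> \oo] --> gram z p q.
Proof.
move=> hr.
pose rho N : C := ((r N ^+ 2)^-1)%:C%C.
have hrho : rho N @[N --> \oo] --> (1 : C).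
  have h : (r N ^+ 2)^-1 @[N --> \oo] --> (1 : R).
    have e : 1 = (1 * 1)^-1 :> R by rewrite mulr1 invr1.
    rewrite [X in _ --> X]e.
    by apply: cvgV; [rewrite mulr1 oner_neq0|exact: (cvgM hr hr)].
  apply/cvg_moduP => e e0; move/cvgrPdist_le : h => /(_ e e0)[N _ hN]; exists N => m /hN h'.
  have -> : rho m - 1 = ((r m ^+ 2)^-1 - 1)%:C%C :> C by rewrite rmorphB rmorph1.
  by rewrite modu_real distrC.
have cr (b : C) : rho N * b @[N --> \oo] --> b.
  have h : rho N * b @[N --> \oo] --> 1 * b.
    apply: cvgM; first exact: hrho.
    exact: cvg_cst.
  rewrite mul1r in h.
  exact: h.
have cl (a b : C) : a * rho N * b @[N --> \oo] --> a * b.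
  under eq_cvg do rewrite -mulrA.
  apply: cvgM; first exact: cvg_cst.
  exact: cr.
have cc (b : C) : (fun _ : nat => b) @ \oo --> b by exact: cvg_cst.
case: p q => [i|[]] [j|[]]; rewrite /circle_gram /gram -/(rho _) /=.
- apply: cvgV; first exact: szego_denom.
  by rewrite [z i * _]mulrC; apply: cvgB; [exact: cvg_cst|exact: cl].
- exact: cr.
- exact: cc.
- have h : (z j)^* * rho N @[N --> \oo] --> (z j)^* * 1.
    by apply: cvgM; [exact: cvg_cst|exact: hrho].
  by rewrite mulr1 in h.
- exact: hrho.
- exact: cc.
- exact: cc.
- exact: cc.
- exact: cc.
Qed.

Lemma radius_seq : exists r : nat -> R, [/\ r N @[N --> \oo] --> (1 : R),
  forall N, 0 < r N < 1 & forall N i, modu (z i) < r N].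
Proof.
pose m := \big[Num.max/0]_i modu (z i).
have m0 : 0 <= m by apply: bigmax_ge_id.
have m1 : m < 1 by apply: bigmax_lt => // i _; rewrite modu_lt1.
have zm i : modu (z i) <= m by apply: le_bigmax.
(* The factor 1/2 keeps the radii strictly above m already for N = 0, where [harmonic] is 1. *)
exists (fun N => 1 - (1 - m) / 2 * harmonic N).
have hb N : 0 < (harmonic N : R) <= 1.
  by rewrite /harmonic /= invr_gt0 ltr0n /= invf_le1 ?ltr0n // ler1n.
have e N : m < 1 - (1 - m) / 2 * harmonic N < 1 by have := hb N; nra.
split=> [|N|N i]; last 2 first.
- by have := e N; lra.
- by apply: le_lt_trans (zm i) _; have := e N; lra.
have h : 1 = 1 - (1 - m) / 2 * 0 by rewrite mulr0 subr0.
rewrite [X in _ --> X]h.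
by apply: cvgB; [exact: cvg_cst|apply: cvgM; [exact: cvg_cst|exact: cvg_harmonic]].
Qed.

Variables (k m : nat) (e : 'I_n + bool -> 'M[C]_(k, m)) (f : 'I_n + bool -> 'M[C]_(m, k)).
Hypothesis ef_frame : frame z e f.

Lemma fsq_gram (u : 'rV[C]_m) :
  fsq u = \sum_p \sum_q gram z p q * \tr ((u *m f p) *m (u *m f q)^t*).
Proof.
have [_ fe ee] := ef_frame.
rewrite -{1}[u]mulmx1 -fe mulmx_sumr fsq_sum; apply: eq_bigr => p _; apply: eq_bigr => q _.
rewrite !mulmxA (adjmxM (u *m f q)) mulmxA -(mulmxA _ (e p)) ee.
by rewrite mul_mx_scalar -scalemxAl mxtraceZ.
Qed.

Lemma schur1_pick (S : C -> 'M[C]_k) : schur1 S ->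
  psd (1%:M - pick_op e f (S \o z) (S 0) *m (pick_op e f (S \o z) (S 0))^t*).
Proof.
move=> hS; apply: contr_psd => u; rewrite -subr_ge0.
rewrite -[fsq (u *m _)]fsq_real !fsq_gram.
have [r [rl r01 zr]] := radius_seq.
have yE p : u *m pick_op e f (S \o z) (S 0) *m f p = u *m f p *m S (point z p).
  by rewrite (pick_coord ef_frame); case: p.
pose a N := \sum_p \sum_q circle_gram z (r N) p q * \tr ((u *m f p) *m (u *m f q)^t*)
  - (\sum_p \sum_q circle_gram z (r N) p q *
      \tr (u *m f p *m S (point z p) *m (u *m f q *m S (point z q))^t*))^*.
apply: (@cvg_ge0 R a) => [N|].
  by have /andP[? ?] := r01 N; apply: pick_circle.
apply: cvgB; [|apply: cvg_conj]; apply: cvg_fsum => p; apply: cvg_fsum => q.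
  by apply: cvgM; [exact: circle_gram_cvg|exact: cvg_cst].
by rewrite !yE; apply: cvgM; [exact: circle_gram_cvg|exact: cvg_cst].
Qed.

End RadiusLimit.

Theorem theorem1p3 (R : realType) (k n : nat) (hk : (1 <= k)%N) (hn : (1 <= n)%N)
    (z : 'I_n -> Cplx R) (hz : forall j, unit_disk (z j))
    (hz0 : forall j, z j != 0) (hzinj : injective z)
    (W : 'I_n -> 'M[Cplx R]_k) :
  (exists2 S : Cplx R -> 'M[Cplx R]_k, schur1 S & forall j, S (z j) = W j)
  <->
  (forall l l' : nat, (1 <= l)%N -> (l <= l')%N -> (l' <= k)%N ->
   forall alpha beta : 'M[Cplx R]_(l', l), GG (alpha, beta) ->
   forall X : 'I_n -> 'M[Cplx R]_(k, l),
   0 <= \sum_(i < n) \sum_(j < n)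
          \tr (X j *m Kab alpha beta (z i) (z j) *m (X i)^t*
               - (W j)^t* *m X j *m Kab alpha beta (z i) (z j)
                   *m (X i)^t* *m W i)).
Proof.
have [m [e [f ef]]] := frame_exists hz k hz0 hzinj.
split=> [[S hS SW] l l' _ _ _ al be [Z1 _] X|hK].
  have pS := schur1_pick hz ef hS.
  have -> : W = S \o z by apply/funext => j; rewrite /= SW.
  exact: (pick_kernel ef hz X pS Z1).
have hker : kernel_cond z W.
  by move=> l l' l1 ll' l'k al be Z1 al_inj X; exact: (hK l l' l1 ll' l'k al be _ X).
have [p [A [b [c [d [hA AW cb]]]]]] := interpolant ef hz hz0 hzinj hker.
exists (rational_transfer A b c d); first exact: rational_transfer_schur1.
by move=> j; rewrite rational_transferE ?AW //; exact: (resolvent_unit hA (hz j)).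
Qed.
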